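(* Let $\Gamma,\Gamma'$ be two $4$-dimensional Bieberbach groups whose lattice of translations is the canonical lattice $\mathbb Z^4$. Then $M_\Gamma=\Gamma\backslash\mathbb R^4$ and $M_{\Gamma'}=\Gamma'\backslash\mathbb R^4$ are isospectral (on functions) if and only if they are $p$-isospectral for all $0\le p\le 4$.
   Context: A Bieberbach group of dimension $n$ is a torsion-free discrete cocompact subgroup $\Gamma$ of the isometry group $I(\mathbb R^n)$; $M_\Gamma=\Gamma\backslash\mathbb R^n$ is the corresponding compact flat Riemannian manifold. The translations in $\Gamma$ form a lattice in $\mathbb R^n$, the lattice of translations of $\Gamma$. Two compact Riemannian manifolds are $p$-isospectral if the Laplacians acting on smooth $p$-forms have the same eigenvalues with the same multiplicities; isospectral means $0$-isospectral. *)

(* Defs.v *)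
From HB Require Import structures.
From mathcomp Require Import all_boot all_order all_algebra generic_quotient.
From mathcomp Require Import all_classical all_reals all_analysis.

Set Implicit Arguments.
Unset Strict Implicit.
Unset Printing Implicit Defensive.

Import Order.TTheory GRing.Theory Num.Theory.
Import numFieldNormedType.Exports.

Local Open Scope classical_set_scope.
Local Open Scope ring_scope.

(* The library norm on 'rV[R]_n is the sup norm (used only for its topology);
   isometries refer to the Euclidean distance. *)
Definition eucl_dist (R : realType) (n : nat) (x y : 'rV[R]_n) : R :=
  Num.sqrt (\sum_(i < n) (x 0 i - y 0 i) ^+ 2).

Definition is_isometry (R : realType) (n : nat) (f : 'rV[R]_n -> 'rV[R]_n) : Prop :=
  forall x y, eucl_dist (f x) (f y) = eucl_dist x y.

(* Subgroups of I(R^n); bijectivity of the elements comes from isom_inv. *)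
Record isom_group (R : realType) (n : nat) := IsomGroup {
  isom_set : set ('rV[R]_n -> 'rV[R]_n);
  isom_isometry : forall f, isom_set f -> is_isometry f;
  isom_id : isom_set id;
  isom_comp : forall f g, isom_set f -> isom_set g -> isom_set (f \o g);
  isom_inv : forall f, isom_set f ->
    exists g, [/\ isom_set g, cancel f g & cancel g f] }.

Section Quotient.
Context {R : realType} {n : nat} (G : isom_group R n).

Definition same_orbit : rel 'rV[R]_n :=
  fun x y => `[< exists2 f, isom_set G f & f x = y >].

Lemma same_orbit_refl : reflexive same_orbit.
Proof. by move=> x; apply/asboolP; exists id => //; exact: isom_id. Qed.

Lemma same_orbit_sym : symmetric same_orbit.
Proof.
suff H x y : same_orbit x y -> same_orbit y x by move=> x y; apply/idP/idP; exact: H.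
move=> /asboolP[f Gf <-]; have [g [Gg fK _]] := isom_inv Gf.
by apply/asboolP; exists g.
Qed.

Lemma same_orbit_trans : transitive same_orbit.
Proof.
move=> y x z /asboolP[f Gf <-] /asboolP[g Gg <-].
by apply/asboolP; exists (g \o f) => //; exact: isom_comp.
Qed.

Definition orbit_equiv : equiv_rel 'rV[R]_n :=
  EquivRel same_orbit same_orbit_refl same_orbit_sym same_orbit_trans.

(* The underlying topological space of M_G = G \ R^n. *)
Definition flat_quotient := quotient_topology {eq_quot orbit_equiv}%qT.
HB.instance Definition _ := Topological.on flat_quotient.

End Quotient.

Definition torsion_free (R : realType) (n : nat) (G : isom_group R n) : Prop :=
  forall (f : 'rV[R]_n -> 'rV[R]_n) (k : nat),
    isom_set G f -> (0 < k)%N -> iter k f = id -> f = id.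

(* I(R^n) carries the compact-open topology. *)
Definition discrete_group (R : realType) (n : nat) (G : isom_group R n) : Prop :=
  isolated (isom_set G : set {compact-open, 'rV[R]_n -> 'rV[R]_n}) = isom_set G.

Definition cocompact (R : realType) (n : nat) (G : isom_group R n) : Prop :=
  compact [set: flat_quotient G].

Definition bieberbach (R : realType) (n : nat) (G : isom_group R n) : Prop :=
  [/\ torsion_free G, discrete_group G & cocompact G].

Definition translation_lattice (R : realType) (n : nat) (G : isom_group R n) :
    set 'rV[R]_n :=
  [set b | isom_set G (fun x => x + b)].

Definition canonical_lattice (R : realType) (n : nat) : set 'rV[R]_n :=
  [set v | forall i, v 0 i \is a Num.int].
Arguments canonical_lattice : clear implicits.

(* A p-form on R^n: w x M is the value at the point x on the p tangent vectors
   given by the rows of M; genuine forms satisfy is_alternating pointwise. *)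
Definition pform (R : realType) (n p : nat) : Type :=
  'rV[R]_n -> 'M[R]_(p, n) -> R.
HB.instance Definition _ R n p := GRing.Lmodule.on (@pform R n p).

Definition is_multilinear (R : realType) (n p : nat) (a : 'M[R]_(p, n) -> R) :=
  forall (i : 'I_p) (b c : R) (A B C : 'M[R]_(p, n)),
    row i A = b *: row i B + c *: row i C ->
    (forall j, j != i -> row j B = row j A /\ row j C = row j A) ->
    a A = b * a B + c * a C.

Definition is_alternating (R : realType) (n p : nat) (a : 'M[R]_(p, n) -> R) :=
  is_multilinear a /\
  forall (A : 'M[R]_(p, n)) (i j : 'I_p), i != j -> row i A = row j A -> a A = 0.

Definition basis_vec (R : realType) (n : nat) (i : 'I_n) : 'rV[R]_n :=
  delta_mx 0 i.
Arguments basis_vec : clear implicits.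

Fixpoint iter_partial (R : realType) (n : nat) (s : seq 'I_n)
    (f : 'rV[R]_n -> R) : 'rV[R]_n -> R :=
  if s is i :: s' then 'D_(basis_vec R n i) (iter_partial s' f) else f.

Definition smooth (R : realType) (n : nat) (f : 'rV[R]_n -> R) : Prop :=
  forall s : seq 'I_n,
    continuous (iter_partial s f) /\
    forall (x : 'rV[R]_n) (i : 'I_n),
      derivable (iter_partial s f) x (basis_vec R n i).

Definition smooth_form (R : realType) (n p : nat) (w : pform R n p) : Prop :=
  (forall x, is_alternating (w x)) /\ forall M, smooth (fun x => w x M).

(* (f^* w)_x (v_1, .., v_p) = w_(f x) (df_x v_1, .., df_x v_p);
   the library's Jacobian acts on row vectors from the right. *)
Definition pullback (R : realType) (n p : nat) (f : 'rV[R]_n -> 'rV[R]_n)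
    (w : pform R n p) : pform R n p :=
  fun x M => w (f x) (M *m jacobian f x).

(* Pullback along the covering R^n -> M_G identifies the smooth p-forms on
   M_G with the G-invariant smooth p-forms on R^n. *)
Definition quotient_form (R : realType) (n p : nat) (G : isom_group R n)
    (w : pform R n p) : Prop :=
  smooth_form w /\ forall f, isom_set G f -> pullback f w = w.

(* (d w)(v_0, .., v_p) = \sum_i (-1)^i D_(v_i) (w (v_0, .., ^v_i, .., v_p))
   for constant vector fields v_i (whose Lie brackets vanish). *)
Definition ext_deriv (R : realType) (n p : nat) (w : pform R n p) :
    pform R n p.+1 :=
  fun x M => \sum_(i < p.+1)
    (-1) ^+ i * 'D_(row i M) (fun y => w y (row' i M)) x.

(* The formal adjoint of ext_deriv for the Euclidean metric, in the
   orthonormal parallel frame (e_j):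
   (delta w)(v_1, .., v_p) = - \sum_j D_(e_j) (w (e_j, v_1, .., v_p)). *)
Definition codifferential (R : realType) (n p : nat) (w : pform R n p.+1) :
    pform R n p :=
  fun x M => - \sum_(j < n)
    'D_(basis_vec R n j)
      (fun y => w y (col_mx (basis_vec R n j) M : 'M[R]_(1 + p, n))) x.

Definition laplacian (R : realType) (n p : nat) : pform R n p -> pform R n p :=
  match p with
  | 0 => fun w => codifferential (ext_deriv w)
  | q.+1 => fun w => ext_deriv (codifferential w) + codifferential (ext_deriv w)
  end.

Definition eigenforms (R : realType) (n p : nat) (G : isom_group R n) (l : R) :
    set (pform R n p) :=
  [set w | quotient_form G w /\ laplacian w = l *: w].

(* The linear subspace E of V has a basis with k elements. *)
Definition has_dim (R : realType) (V : lmodType R) (E : set V) (k : nat) : Prop :=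
  exists b : 'I_k -> V,
    (forall i, E (b i)) /\
    (forall v, E v -> exists! c : 'rV[R]_k, v = \sum_(i < k) c 0 i *: b i).

(* Same eigenvalues with the same multiplicities; l is an eigenvalue when its
   multiplicity is not 0. *)
Definition p_isospectral (R : realType) (n p : nat) (G G' : isom_group R n) : Prop :=
  forall (l : R) (k : nat),
    has_dim (@eigenforms R n p G l) k <-> has_dim (@eigenforms R n p G' l) k.
Arguments p_isospectral {R n} p G G'.

Definition isospectral (R : realType) (n : nat) (G G' : isom_group R n) : Prop :=
  p_isospectral 0 G G'.

(* Main.v *)
Require Import Defs.
From mathcomp Require Import all_boot all_order all_algebra.
From mathcomp Require Import all_classical all_reals all_analysis.
From mathcomp Require Import ring lra.

Set Implicit Arguments.
Unset Strict Implicit.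
Unset Printing Implicit Defensive.

Import Order.TTheory GRing.Theory Num.Theory.
Import numFieldNormedType.Exports.

Local Open Scope classical_set_scope.
Local Open Scope ring_scope.

(** The reason for the theorem is that the multiplicities of the eigenvalues on
    forms of every degree are determined by the proportions of 17 types of
    group elements, and that these proportions can be recovered from the
    spectrum on functions alone.

    A form invariant under the lattice is a sum of plane waves with constant
    alternating coefficients, and the Laplacian multiplies the waves of
    frequency [u] by [4 * pi ^+ 2 * dot u u] whatever the degree
    ([fcoef_laplacian], [Fourier_unique]). An eigenspace is thus the space of
    invariants of a finite group, the holonomy group, in a space with a finite
    basis, and its dimension is the trace of the averaging projector
    ([has_dim_projection]). This gives [holonomy_formula]: the multiplicity of
    an eigenvalue on [p]-forms is the mean, over the elements [aff B b] of the
    group modulo translations, of the product of [wave_trace], which depends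
    on the eigenvalue but not on [p], and [ext_trace], the trace of [B] on the
    [p]-th exterior power, which depends on [p] but not on the eigenvalue.

    Since the lattice is Z^4, every [B] is a signed permutation. Both traces
    are invariant under conjugation by signed permutations, so it is enough to
    consider one [B] in each of the 20 conjugacy classes. As a power of each
    element is a lattice translation, the part of [b] that acts on the waves
    fixed by [B] takes finitely many values modulo the lattice, and the
    absence of torsion forbids all those for which the element, or one of its
    powers, has a fixed point modulo lattice translations. What remains are
    the 17 pairs of [canonical_types] ([crystal_type]).

    Sorting the sum in [holonomy_formula] by types, the multiplicities become
    the combinations of the products of traces of the 17 types, weighted by
    their proportions in the group ([type_expansion]). The wave traces of the
    17 types on suitable spheres form a nonsingular matrix of integers up to a
    factor 2 ([trace_table_independent]). In degree 0 the exterior trace is 1;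
    so two isospectral groups have the same proportions of all types, hence
    the same multiplicities in every degree.

    The analysis of periodic functions is done with the limit of averages over
    finer and finer rational grids in place of the integral ([mean]), and with
    the real waves [cas] in place of the complex exponentials. The uniqueness
    of Fourier coefficients is proved with powers of a trigonometric polynomial
    that peaks at a single point of the torus. *)

(** * Lattice-periodic functions and averages over rational grids *)

Section Torus.
Context {R : realType} {n : nat}.
Local Notation V := 'rV[R]_n.
Implicit Types (h f g : V -> R) (x v : V).

Definition lattice_periodic h :=
  forall x v, canonical_lattice R n v -> h (x + v) = h x.

Definition torus_fun h := continuous h /\ lattice_periodic h.

Lemma latticeN v : canonical_lattice R n v -> canonical_lattice R n (- v).
Proof. by move=> vi i; rewrite mxE rpredN. Qed.

Lemma latticeD u v : canonical_lattice R n u -> canonical_lattice R n v ->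
  canonical_lattice R n (u + v).
Proof. by move=> ui vi i; rewrite mxE rpredD. Qed.

Definition unit_cube : set V := [set x | forall i, `[0, 1]%classic (x ord0 i)].

Lemma unit_cube_compact : compact unit_cube.
Proof.
apply: (@rV_compact R n (fun=> `[0, 1]%classic)) => i; exact: segment_compact.
Qed.

Lemma cube_representative x :
  exists2 v, canonical_lattice R n v & unit_cube (x + v).
Proof.
exists (- \row_i (Num.floor (x 0 i))%:~R).
  by apply: latticeN => i; rewrite mxE intr_int.
move=> i; rewrite /= !mxE in_itv /= subr_ge0 floor_le_tmp.
by rewrite lerBlDr addrC; have := floorD1_gt (x 0 i); rewrite intrD => /ltW.
Qed.

Lemma torus_bounded h : torus_fun h -> exists C, forall x, `|h x| <= C.
Proof.
move=> [hc hp].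
have : compact (h @` unit_cube).
  by apply: continuous_compact unit_cube_compact; exact: continuous_subspaceT.
move=> /compact_bounded[M [_ HM]]; exists (M + 1) => x.
have [v vi xv] := cube_representative x.
by rewrite -(hp x v vi); apply: HM; [rewrite ltrDl | exists (x + v)].
Qed.

(** Every point has a lattice translate in the compact unit cube, so a uniform
    estimate on the cube is a uniform estimate everywhere. *)
Lemma torus_unif_continuous h : torus_fun h -> forall e : R, 0 < e ->
  \forall t \near (0 : V), forall x : V, `|h (x + t) - h x| < e.
Proof.
move=> [hc hp] e e0.
have cov : near_covering unit_cube by apply/compact_near_coveringP/unit_cube_compact.
have /= := cov _ (nbhs (0 : V)) (fun t x => `|h (x + t) - h x| < e) _.
case=> [x _|A A0 HA].
  have e20 : 0 < e / 2 by rewrite divr_gt0.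
  have hx := hc x; move/cvgrPdist_lt: hx => /(_ _ e20) hx.
  have addc : (fun z : V * V => z.1 + z.2) @ (x, (0 : V)) --> x.
    by rewrite -[X in _ --> X]addr0; apply: (@add_continuous V (x, (0 : V))).
  have h1 : \forall z \near (x, (0 : V)), `|h x - h (z.1 + z.2)| < e / 2.
    exact: (addc _ hx).
  have h2 : \forall z \near (x, (0 : V)), `|h x - h z.1| < e / 2.
    have fc : (fun z : V * V => z.1) @ (x, (0 : V)) --> x by exact: cvg_fst.
    exact: (fc _ hx).
  have h3 : \forall z \near (x, (0 : V)), `|h (z.1 + z.2) - h z.1| < e.
    near=> z.
    have a1 : `|h x - h (z.1 + z.2)| < e / 2 by near: z.
    have a2 : `|h x - h z.1| < e / 2 by near: z.
    rewrite (_ : _ - _ = (h x - h z.1) - (h x - h (z.1 + z.2))); last by ring.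
    by rewrite (le_lt_trans (ler_normB _ _)) // (splitr e) ltrD.
  exact: h3.
exists A => //= t At x; have [v vi xv] := cube_representative x.
by rewrite -(hp x v vi) -(hp (x + t) v vi) (addrAC x t); exact: HA.
Unshelve. all: by end_near. Qed.

(** The points of the unit cube with denominator [N.+1]; modulo the lattice
    they form a finite group, which is why sums over them are invariant under
    translation by each of them. *)
Definition grid (N : nat) (j : {ffun 'I_n -> 'I_N.+1}) : V :=
  \row_i ((j i)%:R / N.+1%:R).

Definition grid_avg (N : nat) h : R :=
  (N.+1%:R ^+ n)^-1 * \sum_(j : {ffun 'I_n -> 'I_N.+1}) h (grid j).

(** Addition of indices is addition modulo [N.+1]; the carry is a lattice
    vector. *)
Lemma gridD N (j u : {ffun 'I_n -> 'I_N.+1}) :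
  exists2 v, canonical_lattice R n v & grid j + grid u = grid (j + u) + v.
Proof.
exists (\row_i ((j i + u i)%N %/ N.+1)%:R) => [i|]; first by rewrite mxE natr_int.
apply/rowP => i; rewrite !mxE ffunE /= -mulrDl -natrD {1}(divn_eq (j i + u i) N.+1).
by rewrite natrD natrM mulrDl mulfK ?pnatr_eq0 // addrC.
Qed.

Lemma grid_avg_shift N h (u : {ffun 'I_n -> 'I_N.+1}) : lattice_periodic h ->
  grid_avg N (fun x => h (x + grid u)) = grid_avg N h.
Proof.
move=> hp; congr (_ * _); rewrite [RHS](reindex_inj (addIr u)).
by apply: eq_bigr => j _; have [v vi ->] := gridD j u; exact: hp.
Qed.

Lemma grid_avg_cst N (c : R) : grid_avg N (fun=> c) = c.
Proof.
by rewrite /grid_avg sumr_const card_ffun !card_ord -[c *+ _]mulr_natl natrX mulrA mulVf ?mul1r //.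
Qed.

Lemma grid_avgD N f g :
  grid_avg N (fun x => f x + g x) = grid_avg N f + grid_avg N g.
Proof. by rewrite /grid_avg big_split mulrDr. Qed.

Lemma grid_avgZ N (c : R) f : grid_avg N (fun x => c * f x) = c * grid_avg N f.
Proof. by rewrite /grid_avg -mulr_sumr mulrCA. Qed.

Lemma le_grid_avg N f g : (forall x, f x <= g x) -> grid_avg N f <= grid_avg N g.
Proof.
move=> fg; rewrite ler_wpM2l ?invr_ge0 ?exprn_ge0 //.
by apply: ler_sum => j _; exact: fg.
Qed.

End Torus.

(** * The mean of a periodic function *)

(** A free ultrafilter on the integers makes every bounded sequence converge,
    and its limits respect sums, products by constants and inequalities. The
    mean below is therefore defined for every continuous periodic
    function. *)
Definition limit_filter : set_system nat :=
  sval (cid (ultraFilterLemma eventually_filter)).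

Lemma limit_filterP : UltraFilter limit_filter /\ \oo `<=` limit_filter.
Proof. exact: (svalP (cid (ultraFilterLemma eventually_filter))). Qed.

#[global] Instance limit_filter_ultra : UltraFilter limit_filter.
Proof. exact: limit_filterP.1. Qed.

Section Mean.
Context {R : realType} {n : nat}.
Local Notation V := 'rV[R]_n.
Implicit Types (h f g : V -> R) (x v : V).

Lemma bounded_limit (u : nat -> R) (C : R) :
  (forall k, `|u k| <= C) -> cvg (u k @[k --> limit_filter]).
Proof.
move=> uC.
have cK : compact `[- C, C] by exact: segment_compact.
have FK : (u @ limit_filter) `[- C, C]%classic.
  apply: (@filterE _ limit_filter) => k.
  by rewrite /= in_itv /= -ler_norml.
have [p [_ clp]] := cK _ _ FK.
apply/cvg_ex; exists p => A Ap.
have [//|UnA] := in_ultra_setVsetC (u @^-1` A) limit_filter_ultra.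
have [q []] := clp (~` A) A UnA Ap; by [].
Qed.

(** The factorials are chosen as denominators because every rational vector
    eventually lies in these grids: [mean] is invariant under all rational
    translations. It plays the role of the integral over the torus. *)
Definition mean h : R := lim (grid_avg (k`!.-1) h @[k --> limit_filter]).

Lemma factK k : (k`!.-1).+1 = k`!.
Proof. by rewrite prednK ?fact_gt0. Qed.

Lemma mean_cvg h : torus_fun h ->
  grid_avg (k`!.-1) h @[k --> limit_filter] --> mean h.
Proof.
move=> /torus_bounded[C hC]; apply: (@bounded_limit _ C) => k.
rewrite ler_norml -{1}(grid_avg_cst (n := n) k`!.-1 (- C)).
rewrite -[X in _ && (_ <= X)](grid_avg_cst (n := n) k`!.-1 C).
by apply/andP; split; apply: le_grid_avg => x; have := hC x;
  rewrite ler_norml => /andP[].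
Qed.

Lemma mean_unique h (l : R) :
  grid_avg (k`!.-1) h @[k --> limit_filter] --> l -> mean h = l.
Proof. exact: cvg_lim. Qed.

Lemma mean_cst (c : R) : mean (fun=> c) = c.
Proof.
apply: mean_unique; under eq_fun do rewrite grid_avg_cst.
exact: cvg_cst.
Qed.

Lemma meanD f g : torus_fun f -> torus_fun g ->
  mean (fun x => f x + g x) = mean f + mean g.
Proof.
move=> tf tg; apply: mean_unique; under eq_fun do rewrite grid_avgD.
by apply: cvgD; exact: mean_cvg.
Qed.

Lemma meanZ (c : R) f : torus_fun f -> mean (fun x => c * f x) = c * mean f.
Proof.
move=> tf; apply: mean_unique; under eq_fun do rewrite grid_avgZ.
by apply: cvgMl_tmp; exact: mean_cvg.
Qed.

Lemma le_mean f g : torus_fun f -> torus_fun g -> (forall x, f x <= g x) ->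
  mean f <= mean g.
Proof.
move=> tf tg fg; apply: ler_cvg_to (mean_cvg tf) (mean_cvg tg) _.
by apply: (@filterE _ limit_filter) => k; exact: le_grid_avg.
Qed.

Lemma torus_cst (c : R) : torus_fun (fun _ : V => c).
Proof. by split=> //; exact: cst_continuous. Qed.

Lemma torusD f g : torus_fun f -> torus_fun g -> torus_fun (fun x => f x + g x).
Proof.
move=> [fc fp] [gc gp]; split=> [x|x v vi]; last by rewrite fp ?gp.
exact: (continuousD (fc x) (gc x)).
Qed.

Lemma torusM f g : torus_fun f -> torus_fun g -> torus_fun (fun x => f x * g x).
Proof.
move=> [fc fp] [gc gp]; split=> [x|x v vi]; last by rewrite fp ?gp.
exact: (continuousM (fc x) (gc x)).
Qed.

Lemma torusZ (c : R) f : torus_fun f -> torus_fun (fun x => c * f x).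
Proof. by move=> tf; apply: torusM => //; exact: torus_cst. Qed.

Lemma torusX k f : torus_fun f -> torus_fun (fun x => f x ^+ k).
Proof.
move=> tf; elim: k => [|k IH]; first exact: torus_cst.
by under eq_fun do rewrite exprS; exact: torusM.
Qed.

Lemma torus_sum (I : Type) (s : seq I) (P : pred I) (F : I -> V -> R) :
  (forall i, torus_fun (F i)) -> torus_fun (fun x => \sum_(i <- s | P i) F i x).
Proof.
move=> tF; elim: s => [|i s IH].
  rewrite (_ : (fun _ => _) = fun=> 0); first exact: torus_cst.
  by apply/funext => x; rewrite big_nil.
case Pi : (P i).
  rewrite (_ : (fun _ => _) = fun x => F i x + \sum_(i <- s | P i) F i x).
    exact: torusD.
  by apply/funext => x; rewrite big_cons Pi.
rewrite (_ : (fun _ => _) = fun x => \sum_(i <- s | P i) F i x) //.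
by apply/funext => x; rewrite big_cons Pi.
Qed.

Lemma mean_sum (I : Type) (s : seq I) (P : pred I) (F : I -> V -> R) :
  (forall i, torus_fun (F i)) ->
  mean (fun x => \sum_(i <- s | P i) F i x) = \sum_(i <- s | P i) mean (F i).
Proof.
move=> tF; elim: s => [|i s IH].
  rewrite (_ : (fun _ => _) = fun=> 0) ?mean_cst ?big_nil //.
  by apply/funext => x; rewrite big_nil.
rewrite big_cons; case Pi : (P i).
  rewrite -IH -meanD //; last exact: torus_sum.
  by congr mean; apply/funext => x; rewrite big_cons Pi.
by rewrite -IH; congr mean; apply/funext => x; rewrite big_cons Pi.
Qed.

Lemma torus_shift f v : torus_fun f -> torus_fun (fun x => f (x + v)).
Proof.
move=> [fc fp]; split=> [x|x u ui]; last by rewrite (addrAC x u v); exact: fp.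
have idc : {for x, continuous (fun z : V => z)} by move=> A.
apply: (@continuous_comp _ _ _ (fun x => x + v) f); last exact: fc.
exact: (continuousD idc (@cst_continuous _ _ v x)).
Qed.

(** The denominator [K.+1] divides [k`!] for large [k], so that the shift is
    then one by a vector of the grid that is averaged over. *)
Lemma mean_shift f (K : nat) (u : {ffun 'I_n -> 'I_K.+1}) : torus_fun f ->
  mean (fun x => f (x + grid u)) = mean f.
Proof.
move=> tf; apply: mean_unique; apply: cvg_trans (mean_cvg tf).
apply: near_eq_cvg; apply: limit_filterP.2.
exists K.+1 => // k /= Kk.
have dK : (K.+1 %| k`!)%N by apply: dvdn_fact; exact: Kk.
pose u' := [ffun i => inord (u i * (k`! %/ K.+1)) : 'I_(k`!.-1).+1].
have u'E i : (u' i : nat) = (u i * (k`! %/ K.+1))%N.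
  rewrite ffunE inordK // factK -[X in (_ < X)%N](divnK dK) mulnC ltn_pmul2l //.
  by rewrite divn_gt0 // dvdn_leq ?fact_gt0.
have -> : grid u = grid u' :> V.
  apply/rowP => i; rewrite !mxE u'E factK -[X in _ = _ / X%:R](divnK dK) !natrM.
  rewrite [X in _ = _ / X]mulrC -mulf_div divff ?mulr1 // pnatr_eq0 -lt0n.
  by rewrite divn_gt0 // dvdn_leq ?fact_gt0.
by rewrite grid_avg_shift //; exact: tf.2.
Qed.

End Mean.

(** * The mean of a derivative vanishes *)

Section MeanDerive.
Context {R : realType} {n : nat}.
Local Notation V := 'rV[R]_n.
Implicit Types (h f g : V -> R) (x v : V).

Lemma is_derive_line f x v (t : R) : derivable f (x + t *: v) v ->
  is_derive t (1 : R) (fun s : R => f (x + s *: v)) ('D_v f (x + t *: v)).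
Proof.
have E : (fun h : R => h^-1 *: (((fun s : R => f (x + s *: v)) \o shift t) (h *: 1)
            - f (x + t *: v)))
       = (fun h : R => h^-1 *: ((f \o shift (x + t *: v)) (h *: v) - f (x + t *: v))).
  apply/funext => h /=; congr (_ *: (f _ - _)).
  by rewrite [h *: 1]mulr1 scalerDl addrCA.
by move=> df; split; rewrite /derivable /derive E.
Qed.

(** By the mean value theorem the difference quotient is a value of the
    derivative at a nearby point, and the derivative is uniformly
    continuous. *)
Lemma difference_quotient_unif f v : torus_fun ('D_v f) ->
  (forall x, derivable f x v) -> forall e : R, 0 < e ->
  \forall t \near 0^'+, forall x, `|(f (x + t *: v) - f x) / t - 'D_v f x| <= e.
Proof.
move=> tdf df e e0.
have sc : (fun t : R => t *: v) @ (0 : R) --> (0 : V).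
  by rewrite -[X in _ --> X](scale0r v); apply: (@cvgZr_tmp _ _ _ _ _ id); exact: cvg_id.
have /sc := torus_unif_continuous tdf e0.
case=> d /= d0 H; exists d => //= t td t0 x.
rewrite /= sub0r normrN in td.
have cl (s : R) : is_derive s (1 : R) (fun s : R => f (x + s *: v)) ('D_v f (x + s *: v)).
  exact: is_derive_line.
have [|c /andP[]] := MVT t0 (fun s _ => cl s).
  apply: derivable_within_continuous => s _; by have [] := cl s.
rewrite !bnd_simp scale0r addr0 subr0 => c0 ct ->.
rewrite mulfK ?gt_eqF //; apply/ltW/(H c) => /=.
rewrite sub0r normrN gtr0_norm //; move: td; rewrite gtr0_norm //.
exact: lt_trans.
Qed.

(** The difference quotient with step [1 / k`!] has average exactly zero over
    the grid of denominator [k`!], because that step is a grid vector; it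
    approaches the derivative uniformly. This replaces integration by
    parts. *)
Lemma mean_derive f (i : 'I_n) : torus_fun f -> torus_fun ('D_(basis_vec R n i) f) ->
  (forall x, derivable f x (basis_vec R n i)) -> mean ('D_(basis_vec R n i) f) = 0.
Proof.
set v := basis_vec R n i => tf tdf df.
suff H (e : R) : 0 < e -> `|mean ('D_v f)| <= e.
  by apply/eqP; rewrite -normr_le0; apply/ler_addgt0Pr => e e0; rewrite add0r; exact: H.
move=> e0; have := difference_quotient_unif tdf df e0.
case=> d /= d0 Hd.
have cm := cvg_norm (mean_cvg tdf).
apply: (cvgr_to_le (cm _)); apply: limit_filterP.2.
exists (maxn 2 (Num.truncn d^-1).+1) => // k /=; rewrite geq_max => /andP[k2 kd].
set N := k`!.-1.
have NK : N.+1 = k`! by rewrite /N factK.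
have kN : (k <= N.+1)%N by rewrite NK fact_geq.
(* The step [v / k`!] is the grid vector with the single index 1. *)
pose u := [ffun j => if j == i then inord 1 else ord0] : {ffun 'I_n -> 'I_N.+1}.
have uE : grid u = (N.+1%:R)^-1 *: v :> V.
  apply/rowP => j; rewrite !mxE ffunE /=.
  case: (j == i); last by rewrite mul0r mulr0.
  by rewrite inordK ?mul1r ?mulr1 // (leq_trans k2).
have N0 : 0 < N.+1%:R^-1 :> R by rewrite invr_gt0.
have Nd : N.+1%:R^-1 < d.
  rewrite invf_plt ?posrE // (lt_le_trans (truncnS_gt _)) // ler_nat.
  exact: leq_trans kN.
have K := Hd N.+1%:R^-1; rewrite /= sub0r normrN gtr0_norm // in K.
have {K} K := K Nd N0.
pose q x := (f (x + N.+1%:R^-1 *: v) - f x) / N.+1%:R^-1.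
have q0 : grid_avg N q = 0.
  rewrite /q (_ : (fun x => _) = fun x => N.+1%:R^-1^-1 *
    (f (x + grid u) + (- 1) * f x)); last first.
    by apply/funext => x; rewrite uE mulN1r mulrC.
  by rewrite grid_avgZ grid_avgD grid_avgZ grid_avg_shift ?mulN1r ?subrr ?mulr0 //; exact: tf.2.
have -> : grid_avg N ('D_v f) = grid_avg N ('D_v f) + (-1) * grid_avg N q.
  by rewrite q0 mulr0 addr0.
rewrite -grid_avgZ -grid_avgD ler_norml.
rewrite -{1}(grid_avg_cst (n := n) N (- e)) -[X in _ && (_ <= X)](grid_avg_cst (n := n) N e).
apply/andP; split; apply: le_grid_avg => x; have := K x; rewrite ler_norml => /andP[].
  by rewrite /q => _; lra.
by rewrite /q => + _; lra.
Qed.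

End MeanDerive.

(** * Real plane waves *)

Section Waves.
Context {R : realType} {n : nat}.
Local Notation V := 'rV[R]_n.
Implicit Types (h f g : V -> R) (x v u : V).

Definition dot u x : R := \sum_(i < n) u 0 i * x 0 i.

Lemma dotC u x : dot u x = dot x u.
Proof. by apply: eq_bigr => i _; rewrite mulrC. Qed.

Lemma dotDr u x y : dot u (x + y) = dot u x + dot u y.
Proof. by rewrite -big_split; apply: eq_bigr => i _; rewrite mxE mulrDr. Qed.

Lemma dotZr u (c : R) x : dot u (c *: x) = c * dot u x.
Proof. by rewrite mulr_sumr; apply: eq_bigr => i _; rewrite mxE mulrCA. Qed.

Lemma dotNr u x : dot u (- x) = - dot u x.
Proof. by rewrite -scaleN1r dotZr mulN1r. Qed.

Lemma dotDl u v x : dot (u + v) x = dot u x + dot v x.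
Proof. by rewrite !(dotC _ x) dotDr. Qed.

Lemma dotNl u x : dot (- u) x = - dot u x.
Proof. by rewrite !(dotC _ x) dotNr. Qed.

Lemma dot0l x : dot 0 x = 0.
Proof. by apply: big1 => i _; rewrite mxE mul0r. Qed.

Lemma dot0r x : dot x 0 = 0.
Proof. by rewrite dotC dot0l. Qed.

Lemma dot_basis u (i : 'I_n) : dot u (basis_vec R n i) = u 0 i.
Proof.
rewrite /dot (bigD1 i) //= big1 ?addr0 => [|j ji]; rewrite mxE ?eqxx ?mulr1 //.
by rewrite (negbTE ji) andbF mulr0.
Qed.

Lemma dot_eq0 u : (dot u u == 0) = (u == 0).
Proof.
apply/eqP/eqP => [u0|->]; last by rewrite dot0l.
apply/rowP => i; rewrite mxE; apply/eqP; rewrite -sqrf_eq0 expr2.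
have /eqP := u0; rewrite psumr_eq0 => [|j _]; last by rewrite -expr2 sqr_ge0.
by move=> /allP/(_ i (mem_index_enum _)) /implyP; apply.
Qed.

Lemma lattice_dot u v : canonical_lattice R n u -> canonical_lattice R n v ->
  dot u v \is a Num.int.
Proof. by move=> ui vi; apply: rpred_sum => i _; rewrite rpredM. Qed.

(** The function cos + sin of a frequency (the Hartley kernel). It is a single
    real function for each lattice vector [u], and these functions are
    orthonormal for [mean]; they do the work of the complex exponentials
    without leaving the real numbers. The price is that derivatives and
    translations exchange [u] and [- u], see [is_derive_cas] and [casD]. *)
Definition cas u x : R := cos (2 * pi * dot u x) + sin (2 * pi * dot u x).

Lemma cos_int (t : R) : t \is a Num.int -> cos (2 * pi * t) = 1.
Proof.
move=> /intrP[m ->]; wlog m0 : m / (0 <= m)%R => [H|].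
  case: (leP 0 m) => [/H//|m0]; rewrite -cosN -mulrN -rmorphN.
  by apply: H; rewrite oppr_ge0 ltW.
case: m m0 => // m _; elim: m => [|m IH]; first by rewrite mulr0 cos0.
by rewrite -(addn1 m) PoszD rmorphD /= mulrDr mulr1 mulr_natl cosD2pi -mulr_natl IH.
Qed.

Lemma sin_int (t : R) : t \is a Num.int -> sin (2 * pi * t) = 0.
Proof.
move=> /intrP[m ->]; wlog m0 : m / (0 <= m)%R => [H|].
  case: (leP 0 m) => [/H//|m0]; apply/eqP; rewrite -oppr_eq0 -sinN -mulrN -rmorphN.
  by apply/eqP; apply: H; rewrite oppr_ge0 ltW.
case: m m0 => // m _; elim: m => [|m IH]; first by rewrite mulr0 sin0.
by rewrite -(addn1 m) PoszD rmorphD /= mulrDr mulr1 mulr_natl sinD2pi -mulr_natl IH.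
Qed.

Lemma casD u x y :
  cas u (x + y) = cos (2 * pi * dot u y) * cas u x + sin (2 * pi * dot u y) * cas (- u) x.
Proof.
rewrite /cas; move: (2 * pi) => c.
rewrite dotDr mulrDr cosD sinD dotNl !mulrN cosN sinN; ring.
Qed.

Lemma cas_prod u v x : cas u x * cas v x =
  2^-1 * ((cas (u - v) x + cas (v - u) x) + (cas (u + v) x + (-1) * cas (- (u + v)) x)).
Proof.
rewrite -(opprB u v) /cas; move: (2 * pi) => c.
rewrite !dotNl !dotDl !dotNl.
have -> : c * (dot u x - dot v x) = c * dot u x - c * dot v x by ring.
have -> : c * - (dot u x - dot v x) = - (c * dot u x) + c * dot v x by ring.
have -> : c * (dot u x + dot v x) = c * dot u x + c * dot v x by ring.
have -> : c * - (dot u x + dot v x) = - (c * dot u x) - c * dot v x by ring.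
by rewrite !(sinN, cosN, sinD, cosD); field.
Qed.

Lemma cas_periodic u : canonical_lattice R n u -> lattice_periodic (cas u).
Proof.
move=> ui x v vi; rewrite casD cos_int ?sin_int; last 2 first.
- exact: lattice_dot.
- exact: lattice_dot.
by rewrite mul1r mul0r addr0.
Qed.

Lemma is_derive_along f x v (d : R) :
  is_derive (0 : R) (1 : R) (fun s : R => f (x + s *: v)) d -> is_derive x v f d.
Proof.
have E : (fun h : R => h^-1 *: (((fun s : R => f (x + s *: v)) \o shift (0 : R)) (h *: (1 : R))
            - f (x + (0 : R) *: v)))
       = (fun h : R => h^-1 *: ((f \o shift x) (h *: v) - f x)).
  apply/funext => h /=; rewrite scale0r !addr0; congr (_ *: (f _ - _)).
  by rewrite [h *: 1]mulr1 addrC.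
by move=> [+ +]; rewrite /derivable /derive E; split.
Qed.

Lemma is_derive_cas u x v :
  is_derive x v (cas u) (2 * pi * dot u v * cas (- u) x).
Proof.
apply: is_derive_along; pose L (s : R) := 2 * pi * dot u x + (2 * pi * dot u v) * s.
have -> : (fun s : R => cas u (x + s *: v)) = (cos \o L) + (sin \o L).
  apply/funext => s; rewrite /cas /L /= dotDr dotZr fctE /=.
  by congr (cos _ + sin _); ring.
have dL : is_derive (0 : R) (1 : R) L (2 * pi * dot u v).
  have -> : L = cst (2 * pi * dot u x) + (2 * pi * dot u v) *: id by apply/funext.
  have := is_deriveD (is_derive_cst (2 * pi * dot u x) (0 : R) (1 : R))
    (is_deriveZ (2 * pi * dot u v) (is_derive_id (0 : R) (1 : R))).
  by rewrite add0r -[_ *: 1]/(_ * 1) mulr1.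
apply: is_derive_eq.
rewrite /L mulr0 addr0 /cas dotNl !mulrN cosN sinN.
by ring.
Qed.

Lemma dot_continuous u : continuous (dot u).
Proof.
have -> : dot u = \sum_(i < n) (fun x => u 0 i * x 0 i).
  by apply/funext => x; rewrite fct_sumE.
elim/big_ind: _ => [|f g fc gc x|i _ x]; first exact: cst_continuous.
  exact: (continuousD (fc x) (gc x)).
exact: (continuousM (@cst_continuous _ _ (u 0 i) x) (@coord_continuous _ _ _ 0 i x)).
Qed.

Lemma cas_continuous u : continuous (cas u).
Proof.
move=> x; have cd : {for x, continuous (fun z => 2 * pi * dot u z)}.
  exact: (continuousM (@cst_continuous _ _ (2 * pi) x) (@dot_continuous u x)).
apply: continuousD.
  by apply: (@continuous_comp _ _ _ _ cos) => //; exact: continuous_cos.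
by apply: (@continuous_comp _ _ _ _ sin) => //; exact: continuous_sin.
Qed.

Lemma torus_cas u : canonical_lattice R n u -> torus_fun (cas u).
Proof. by move=> ui; split; [exact: cas_continuous|exact: cas_periodic]. Qed.

Lemma lattice0 : canonical_lattice R n 0.
Proof. by move=> i; rewrite mxE rpred0. Qed.

Lemma pi2_neq0 : 2 * pi != 0 :> R.
Proof. by rewrite mulf_neq0 ?pnatr_eq0 // gt_eqF ?pi_gt0. Qed.

(** For [u <> 0] the wave is a multiple of a partial derivative of
    [cas (- u)], whence its mean vanishes by [mean_derive]. *)
Lemma mean_cas u : canonical_lattice R n u -> mean (cas u) = (u == 0)%:R.
Proof.
move=> ui; case: eqP => [->|u0].
  rewrite -[RHS]mulr1 mul1r -[RHS](mean_cst (n := n)); congr mean.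
  by apply/funext => x; rewrite /cas dot0l mulr0 cos0 sin0 addr0.
have [i iu] : exists i, u 0 i != 0.
  apply/existsP; apply: contra_notT u0; rewrite negb_exists => /forallP H.
  by apply/rowP => i; have := H i; rewrite negbK mxE => /eqP.
have cE : 'D_(basis_vec R n i) (cas (- u)) = (fun x => - (2 * pi * u 0 i) * cas u x).
  apply/funext => x.
  by rewrite (@derive_val _ _ _ _ _ _ _ (is_derive_cas (- u) x _)) opprK dotNl dot_basis mulrN.
have tu : torus_fun (cas u) by exact: torus_cas.
have := mean_derive (f := cas (- u)) (i := i).
rewrite cE meanZ // => H.
have /eqP : - (2 * pi * u 0 i) * mean (cas u) = 0.
  apply: H.
  - by apply: torus_cas; exact: latticeN.
  - exact: torusZ.
  - by move=> x; have [] := is_derive_cas (- u) x (basis_vec R n i).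
by rewrite mulf_eq0 oppr_eq0 mulf_eq0 (negbTE pi2_neq0) (negbTE iu) => /eqP.
Qed.

Lemma mean_cas_prod u v : canonical_lattice R n u -> canonical_lattice R n v ->
  mean (fun x => cas u x * cas v x) = (u == v)%:R.
Proof.
move=> ui vi.
have dl := latticeD ui (latticeN vi); have dl' := latticeD vi (latticeN ui).
have al := latticeD ui vi; have al' := latticeN al.
under eq_fun do rewrite cas_prod.
have t1 := torus_cas dl; have t2 := torus_cas dl'.
have t3 := torus_cas al; have t4 := torus_cas al'.
have t12 := torusD t1 t2; have t4' := torusZ (-1) t4; have t34 := torusD t3 t4'.
rewrite (meanZ _ (torusD t12 t34)) (meanD t12 t34) (meanD t1 t2) (meanD t3 t4').
rewrite (meanZ _ t4) !mean_cas // oppr_eq0 mulN1r subrr addr0 !subr_eq0 [v == u]eq_sym.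
case: eqP => _; last by rewrite addr0 mulr0.
by rewrite -mulr2n -[1 *+ 2]/(2%:R) mulVf ?pnatr_eq0.
Qed.

End Waves.

(** * Trigonometric peaks *)

Section Uniqueness.
Context {R : realType} {n : nat}.
Local Notation V := 'rV[R]_n.
Implicit Types (h f T P : V -> R) (x v u : V).

Section Multipliers.
Variable g : V -> R.
Hypothesis tg : torus_fun g.

(** Multipliers of [g] are the functions by which the set of periodic [T] such
    that [g * T] has only zero Fourier coefficients is stable. They form an
    algebra that contains the waves, hence also the powers of [peak]. *)
Definition annihilator T :=
  torus_fun T /\ forall u, canonical_lattice R n u ->
    mean (fun x => g x * T x * cas u x) = 0.

Definition multiplier P :=
  torus_fun P /\ forall T, annihilator T -> annihilator (fun x => T x * P x).

Lemma multiplier_cas v : canonical_lattice R n v -> multiplier (cas v).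
Proof.
move=> vi; split; first exact: torus_cas.
move=> T [tT aT]; split; first by apply: torusM => //; exact: torus_cas.
move=> u ui.
have tgT : torus_fun (fun x => g x * T x) by exact: torusM.
have tc w : canonical_lattice R n w -> torus_fun (fun x => g x * T x * cas w x).
  by move=> wi; apply: torusM => //; exact: torus_cas.
have dl := latticeD vi (latticeN ui); have dl' := latticeD ui (latticeN vi).
have al := latticeD vi ui; have al' := latticeN al.
have t1 := tc _ dl; have t2 := tc _ dl'; have t3 := tc _ al; have t4 := tc _ al'.
have t12 := torusD t1 t2; have t4' := torusZ (-1) t4; have t34 := torusD t3 t4'.
rewrite (_ : (fun x => _) = fun x => 2^-1 *
   ((g x * T x * cas (v - u) x + g x * T x * cas (u - v) x) +
    (g x * T x * cas (v + u) x + (-1) * (g x * T x * cas (- (v + u)) x)))); last first.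
  by apply/funext => x; rewrite mulrA -[LHS]mulrA cas_prod; ring.
rewrite (meanZ _ (torusD t12 t34)) (meanD t12 t34) (meanD t1 t2) (meanD t3 t4').
by rewrite (meanZ _ t4) !aT // !(mulr0, addr0).
Qed.

Lemma multiplierM P Q : multiplier P -> multiplier Q -> multiplier (fun x => P x * Q x).
Proof.
move=> [tP aP] [tQ aQ]; split; first exact: torusM.
move=> T /aP /aQ; rewrite (_ : (fun x => _) = fun x => T x * (P x * Q x)) //.
by apply/funext => x; rewrite mulrA.
Qed.

Lemma multiplierZ c P : multiplier P -> multiplier (fun x => c * P x).
Proof.
move=> [tP aP]; split; first exact: torusZ.
move=> T /aP [tTP aTP]; split.
  by rewrite (_ : (fun x => _) = fun x => c * (T x * P x));
    [exact: torusZ|apply/funext => x; ring].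
move=> u ui; rewrite (_ : (fun x => _) = fun x => c * (g x * (T x * P x) * cas u x)).
  rewrite meanZ ?aTP ?mulr0 //.
  by apply: torusM; [exact: torusM|exact: torus_cas].
by apply/funext => x; ring.
Qed.

Lemma multiplierD P Q : multiplier P -> multiplier Q -> multiplier (fun x => P x + Q x).
Proof.
move=> [tP aP] [tQ aQ]; split; first exact: torusD.
move=> T aT; have [tTP aTP] := aP _ aT; have [tTQ aTQ] := aQ _ aT; split.
  by rewrite (_ : (fun x => _) = fun x => T x * P x + T x * Q x);
    [exact: torusD|apply/funext => x; ring].
move=> u ui; rewrite (_ : (fun x => _) =
  fun x => g x * (T x * P x) * cas u x + g x * (T x * Q x) * cas u x).
  rewrite meanD ?aTP ?aTQ ?addr0 //.
    by apply: torusM; [exact: torusM|exact: torus_cas].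
  by apply: torusM; [exact: torusM|exact: torus_cas].
by apply/funext => x; ring.
Qed.

Lemma cas0 : cas (0 : V) = fun=> 1.
Proof. by apply/funext => x; rewrite /cas dot0l mulr0 cos0 sin0 addr0. Qed.

Lemma multiplier_cst c : multiplier (fun=> c).
Proof.
rewrite (_ : (fun=> c) = fun x => c * cas (0 : V) x).
  by apply/multiplierZ/multiplier_cas/lattice0.
by apply/funext => x; rewrite cas0 mulr1.
Qed.

Lemma multiplier_prod (I : Type) (s : seq I) (F : I -> V -> R) :
  (forall i, multiplier (F i)) -> multiplier (fun x => \prod_(i <- s) F i x).
Proof.
move=> mF; elim: s => [|i s IH].
  rewrite (_ : (fun _ => _) = fun=> 1); first exact: multiplier_cst.
  by apply/funext => x; rewrite big_nil.
rewrite (_ : (fun _ => _) = fun x => F i x * \prod_(i <- s) F i x).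
  exact: multiplierM.
by apply/funext => x; rewrite big_cons.
Qed.

Lemma multiplierX k P : multiplier P -> multiplier (fun x => P x ^+ k).
Proof.
move=> mP; elim: k => [|k IH]; first exact: multiplier_cst.
by under eq_fun do rewrite exprS; exact: multiplierM.
Qed.

End Multipliers.

(** A trigonometric polynomial with values in [0, 1] that equals 1 exactly on
    the lattice translates of [y]. Its powers concentrate there. *)
Definition peak (y x : V) : R := \prod_(i < n) ((1 + cos (2 * pi * (x 0 i - y 0 i))) / 2).

Lemma basis_lattice (i : 'I_n) : canonical_lattice R n (basis_vec R n i).
Proof. by move=> j; rewrite mxE natr_int. Qed.

Lemma multiplier_peak g y : torus_fun g -> multiplier g (peak y).
Proof.
move=> tg; apply: multiplier_prod => // i.
pose e := basis_vec R n i.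
have ei := basis_lattice i; have ei' := latticeN ei.
pose c1 := cos (2 * pi * dot e (- y)); pose s1 := sin (2 * pi * dot e (- y)).
rewrite (_ : (fun x => _) =
  fun x => 2^-1 + ((c1 + s1) / 4 * cas (- e) x + (c1 - s1) / 4 * cas e x)).
  apply: multiplierD => //; first exact: multiplier_cst.
  by apply: multiplierD => //; apply: multiplierZ => //; exact: multiplier_cas.
apply/funext => x; rewrite /c1 /s1 /cas !dotNl dotC [dot e x]dotC !dot_basis !mxE.
move: (2 * pi) => c; rewrite mulrBr !mulrN !(cosN, sinN, cosB).
by field.
Qed.

Lemma peak_factor_ge0 (t : R) : 0 <= (1 + cos t) / 2.
Proof. by rewrite divr_ge0 // -lerBlDl sub0r cos_geN1. Qed.

Lemma peak_factor_le1 (t : R) : (1 + cos t) / 2 <= 1.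
Proof. by rewrite ler_pdivrMr // mul1r -[2]/(1 + 1) lerD2l cos_le1. Qed.

Lemma peak_ge0 y x : 0 <= peak y x.
Proof. by apply: prodr_ge0 => i _; exact: peak_factor_ge0. Qed.

Lemma peak_le1 y x : peak y x <= 1.
Proof.
by apply: prodr_ile1 => i _; rewrite peak_factor_ge0 peak_factor_le1.
Qed.

Lemma peak_diag y : peak y y = 1.
Proof. by apply: big1 => i _; rewrite subrr mulr0 cos0 divff ?pnatr_eq0. Qed.

(** Subtracting the nearest integer brings the argument into the interval where
    the cosine is injective. *)
Lemma cos_eq1_int (t : R) : cos (2 * pi * t) = 1 -> t \is a Num.int.
Proof.
move=> ct; pose m := Num.floor (t + 2^-1); pose s := t - m%:~R.
have cs : cos (2 * pi * s) = 1.
  have mi : (m%:~R : R) \is a Num.int := intr_int _ _.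
  have -> : 2 * pi * s = 2 * pi * t - 2 * pi * m%:~R by rewrite mulrBr.
  by rewrite cosB ct (cos_int mi) (sin_int mi) mulr0 mulr1 addr0.
have s1 : `|s| <= 2^-1.
  have := floor_le_tmp (t + 2^-1); have := floorD1_gt (t + 2^-1).
  rewrite intrD -/m ler_norml /s => H1 H2; apply/andP; split; lra.
have p0 : 0 <= 2 * pi :> R by rewrite mulr_ge0 ?pi_ge0.
have : 2 * pi * `|s| = 0.
  apply: (@cos_inj R).
  - rewrite in_itv /= mulr_ge0 //=.
    by rewrite (le_trans (ler_wpM2l p0 s1)) // mulrAC divff ?mul1r ?pnatr_eq0.
  - by rewrite in_itv /= lexx pi_ge0.
  - by rewrite cos0 -[in LHS](ger0_norm p0) -normrM cos_norm.
move/eqP; rewrite mulf_eq0 (negbTE pi2_neq0) normr_eq0 subr_eq0 => /eqP ->.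
exact: intr_int.
Qed.

Lemma peak_eq1 y x : peak y x = 1 -> canonical_lattice R n (x - y).
Proof.
move=> b1 i; apply: cos_eq1_int; rewrite !mxE; apply/eqP.
rewrite eq_le cos_le1 /= leNgt; apply/negP => c1.
suff : peak y x < 1 by rewrite b1 ltxx.
rewrite /peak (bigD1 i) //=; apply: le_lt_trans (_ : (1 + cos (2 * pi * (x 0 i - y 0 i))) / 2 < 1).
  rewrite ler_piMr ?peak_factor_ge0 //.
  by apply: prodr_ile1 => j _; rewrite peak_factor_ge0 peak_factor_le1.
by rewrite ltr_pdivrMr // mul1r -[2]/(1 + 1) ltrD2l.
Qed.

End Uniqueness.

(** * Uniqueness of Fourier coefficients *)

Section FourierUnique.
Context {R : realType} {n : nat}.
Local Notation V := 'rV[R]_n.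
Implicit Types (h f g : V -> R) (x v u : V).

Lemma peak_torus (y : V) : torus_fun (peak y : V -> R).
Proof. by have [] := multiplier_peak y (torus_cst (n := n) (0 : R)). Qed.

(** On the compact set of the points of the cube where [g] is small, [peak y]
    has a maximum, and it is not 1 because these points are not translates
    of [y]. *)
Lemma peak_away g (y : V) (c : R) : torus_fun g -> c < g y ->
  exists2 eta, 0 < eta < 1 & forall x, g x <= c -> peak y x <= eta.
Proof.
move=> [gc gp] cgy; pose K := unit_cube `&` [set x : V | g x <= c].
have cK : compact K.
  apply: compact_closedI; first exact: unit_cube_compact.
  by apply: (@closed_comp _ _ g [set z : R | z <= c]) => [x _|]; [exact: gc|exact: closed_le].
have bT := peak_torus y.
have [K0|K0] := pselect (K !=set0); last first.
  exists 2^-1 => [|x gx]; first by rewrite invr_gt0 ltr0n invf_lt1 ?ltr0n // ltr1n.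
  have [v vi xv] := cube_representative x.
  by case: K0; exists (x + v); split => //=; rewrite gp.
have [z zK zmax] : exists2 z, z \in K & forall t, t \in K -> peak y t <= peak y z.
  by apply: compact_EVT_max => //; apply: continuous_subspaceT; exact: bT.1.
have bz : peak y z < 1.
  rewrite lt_neqAle peak_le1 andbT; apply/eqP => /peak_eq1 zy.
  have [_ /=] : K z by rewrite inE in zK.
  by rewrite -(subrK y z) addrC gp // leNgt cgy.
exists (Num.max 2^-1 (peak y z)) => [|x gx].
  rewrite lt_max invr_gt0 ltr0n /= gt_max bz andbT.
  by rewrite invf_lt1 ?ltr0n // ltr1n.
have [v vi xv] := cube_representative x.
rewrite le_max; apply/orP; right; rewrite -(bT.2 x v vi); apply: zmax.
by rewrite inE; split => //=; rewrite gp.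
Qed.

(** The peak is at least [zeta] on a ball around [y]. The translates of this
    ball by a fine grid cover the torus, so the sum of the shifts of the [k]-th
    power of the peak is at least [zeta ^+ k] everywhere, and all shifts have
    the same mean. The constant [M] is the inverse of the number of shifts and
    does not depend on [k]. *)
Lemma peak_mean_lb (y : V) (zeta : R) : 0 < zeta < 1 ->
  exists2 M : R, 0 < M & forall k, M * zeta ^+ k <= mean (fun x => peak y x ^+ k).
Proof.
move=> /andP[z0 z1]; have bT := peak_torus y.
have : \forall x \near y, zeta < peak y x.
  have := bT.1 y; rewrite /continuous_at peak_diag => /cvgr_gt; exact.
move=> /nbhs_ballP[r /= r0 Hr].
pose K := Num.truncn r^-1; have Kr : K.+1%:R^-1 < r.
  by rewrite invf_plt ?posrE // truncnS_gt.
pose J : finType := {ffun 'I_n -> 'I_K.+1}.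
have J0 : 0 < #|J|%:R :> R by rewrite ltr0n; apply/card_gt0P; exists [ffun=> ord0].
have K0 : K.+1%:R != 0 :> R by rewrite pnatr_eq0.
exists #|J|%:R^-1 => [|k]; first by rewrite invr_gt0.
rewrite ler_pdivrMl // -(mean_cst (n := n) (zeta ^+ k)).
have bkT : torus_fun (fun x => peak y x ^+ k) by exact: torusX.
have -> : #|J|%:R * mean (fun x => peak y x ^+ k) =
    mean (fun x => \sum_(j : J) peak y (x + grid j) ^+ k).
  rewrite mean_sum => [|j]; last exact: (torus_shift (grid j) bkT).
  rewrite (eq_bigr (fun=> mean (fun z => peak y z ^+ k))) => [|j _]; last first.
    exact: (mean_shift j bkT).
  by rewrite sumr_const -[RHS]mulr_natl.
apply: le_mean => [||x]; first exact: torus_cst.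
  by apply: torus_sum => j; exact: (torus_shift (grid j) bkT).
(* The grid vector [grid j], up to a lattice vector [w], is the multiple of
   [1 / K.+1] next below [y - x]. *)
pose m i := Num.floor ((y 0 i - x 0 i) * K.+1%:R).
pose j : J := [ffun i => inord `|(m i %% K.+1%:Z)%Z|%N].
have jE i : ((j i)%:R : R) = (m i %% K.+1%:Z)%Z%:~R.
  have mp : (0 <= m i %% K.+1%:Z)%Z by rewrite modz_ge0.
  rewrite ffunE inordK.
    by rewrite -[in RHS](gez0_abs mp).
  by rewrite -ltz_nat gez0_abs // ltz_pmod.
pose w : V := \row_i (m i %/ K.+1%:Z)%Z%:~R.
have wi : canonical_lattice R n w by move=> i; rewrite mxE intr_int.
rewrite (bigD1 j) //= -[leLHS]addr0; apply: lerD; last first.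
  by apply: sumr_ge0 => i _; rewrite exprn_ge0 ?peak_ge0.
rewrite lerXn2r ?nnegrE ?peak_ge0 ?(ltW z0) //.
rewrite -(bT.2 _ w wi); apply/ltW/Hr; rewrite -ball_normE /=.
apply: le_lt_trans Kr; rewrite [leLHS]mx_normrE.
apply: bigmax_le => [|[a i] _ /=]; first by rewrite invr_ge0.
rewrite !mxE !ord1 jE.
have E : (m i %% K.+1%:Z)%Z%:~R / K.+1%:R + (m i %/ K.+1%:Z)%Z%:~R = (m i)%:~R / K.+1%:R :> R.
  have -> : (m i)%:~R = (m i %/ K.+1%:Z)%Z%:~R * K.+1%:R + (m i %% K.+1%:Z)%Z%:~R :> R.
    by rewrite {1}(divz_eq (m i) K.+1%:Z) intrD intrM.
  by rewrite mulrDl mulfK // addrC.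
rewrite -addrA E opprD addrA.
have -> : y 0 i - x 0 i - (m i)%:~R / K.+1%:R =
  ((y 0 i - x 0 i) * K.+1%:R - (m i)%:~R) / K.+1%:R by field.
rewrite normrM normfV [X in _ / X]ger0_norm // ler_piMl ?invr_ge0 //.
have := floor_le_tmp ((y 0 i - x 0 i) * K.+1%:R); have := floorD1_gt ((y 0 i - x 0 i) * K.+1%:R).
by rewrite intrD -/(m i) ler_norml => H1 H2; apply/andP; split; lra.
Qed.

(** If [g y > 0] then [g * peak y ^+ k] has mean zero for all [k], since
    [peak y] is a multiplier. But its part near [y] contributes at least
    [c * M * zeta ^+ k], while the rest is bounded by a multiple of
    [eta ^+ k] with [eta < zeta]: a contradiction for large [k]. *)
Lemma Fourier_coef_nonpos g : torus_fun g ->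
  (forall u, canonical_lattice R n u -> mean (fun x => g x * cas u x) = 0) ->
  forall y, g y <= 0.
Proof.
move=> tg g0 y; rewrite leNgt; apply/negP => gy.
have [C HC] := torus_bounded tg.
pose c := g y / 2.
have c0 : 0 < c by rewrite divr_gt0.
have cg : c < g y by rewrite /c ltr_pdivrMr // ltr_pMr // ltr1n.
have [eta /andP[e0 e1] He] := peak_away tg cg.
pose zeta := (1 + eta) / 2.
have z01 : 0 < zeta < 1 by rewrite /zeta; apply/andP; split; lra.
have ez : eta < zeta by rewrite /zeta; lra.
have [M M0 HM] := peak_mean_lb y z01.
have C0 : 0 <= C by apply: le_trans (HC 0); exact: normr_ge0.
have bT := peak_torus y.
have a1 : annihilator g (fun=> 1).
  split; first exact: torus_cst.
  by move=> u /g0 <-; congr mean; apply/funext => x; rewrite mulr1.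
(* Compare the two contributions to the mean of [g * peak y ^+ k], which is 0. *)
have key k : c * (M * zeta ^+ k) <= (C + c) * eta ^+ k.
  have [_ /(_ _ a1) [_ /(_ 0 (lattice0 (R := R) (n := n)))]] :=
    multiplierX tg k (multiplier_peak y tg).
  rewrite cas0; under eq_fun do rewrite mul1r mulr1.
  move=> m0; have tk : torus_fun (fun x => peak y x ^+ k) by exact: torusX.
  have : c * mean (fun x => peak y x ^+ k) + - ((C + c) * eta ^+ k) <= 0.
    rewrite -meanZ // -(mean_cst (n := n) (- ((C + c) * eta ^+ k))).
    rewrite -meanD //; [|exact: torusZ|exact: torus_cst].
    rewrite -m0; apply: le_mean.
    - by apply: torusD; [exact: torusZ|exact: torus_cst].
    - exact: torusM.
    move=> x; have bk0 : 0 <= peak y x ^+ k by rewrite exprn_ge0 ?peak_ge0.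
    have ek0 : 0 <= eta ^+ k by rewrite exprn_ge0 // ltW.
    have [gx|gx] := leP (g x) c; last first.
      have : c * peak y x ^+ k <= g x * peak y x ^+ k by rewrite ler_wpM2r // ltW.
      have : 0 <= (C + c) * eta ^+ k by rewrite mulr_ge0 // addr_ge0 // ltW.
      lra.
    have bek : peak y x ^+ k <= eta ^+ k.
      by rewrite lerXn2r ?nnegrE ?peak_ge0 ?(ltW e0) //; exact: He.
    have gC : - C <= g x by have := HC x; rewrite ler_norml => /andP[].
    have : (g x + C) * peak y x ^+ k >= 0 by rewrite mulr_ge0 // -lerBlDr sub0r.
    have : (C + c) * peak y x ^+ k <= (C + c) * eta ^+ k.
      by rewrite ler_wpM2l // addr_ge0 // ltW.
    nra.
  have : c * (M * zeta ^+ k) <= c * mean (fun x => peak y x ^+ k).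
    by rewrite ler_wpM2l // ltW.
  lra.
have z0 : 0 < zeta by case/andP: z01.
have q1 : `|eta / zeta| < 1.
  by rewrite ger0_norm ?ltr_pdivrMr ?mul1r // divr_ge0 ?(ltW e0) ?(ltW z0).
have lim0 : (C + c) * (eta / zeta) ^+ k @[k --> \oo] --> (C + c) * 0.
  by apply: cvgMl_tmp; exact: cvg_expr.
have : c * M <= (C + c) * 0.
  apply: (cvgr_to_ge lim0); apply: nearW => k.
  by rewrite expr_div_n mulrA ler_pdivlMr ?exprn_gt0 // -mulrA key.
by rewrite mulr0 leNgt mulr_gt0.
Qed.

Lemma Fourier_unique g : torus_fun g ->
  (forall u, canonical_lattice R n u -> mean (fun x => g x * cas u x) = 0) ->
  forall y, g y = 0.
Proof.
move=> tg g0 y; apply/eqP; rewrite eq_le (Fourier_coef_nonpos tg g0) /=.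
have tNg := torusZ (-1) tg.
rewrite -oppr_le0 -mulN1r; apply: (Fourier_coef_nonpos tNg) => u ui.
rewrite (_ : (fun x => _) = fun x => (-1) * (g x * cas u x)).
  by rewrite meanZ ?g0 ?mulr0 //; apply: torusM => //; exact: torus_cas.
by apply/funext => x; rewrite mulrA.
Qed.

End FourierUnique.

(** * Smooth periodic functions and their Fourier coefficients *)

Section Smooth.
Context {R : realType} {n : nat}.
Local Notation V := 'rV[R]_n.
Local Notation e_ := (basis_vec R n).
Implicit Types (h f g : V -> R) (x v u : V).

Lemma iter_partial_rcons (s : seq 'I_n) i f :
  iter_partial (rcons s i) f = iter_partial s ('D_(e_ i) f).
Proof. by elim: s => //= j s ->. Qed.

Lemma smooth_continuous f : smooth f -> continuous f.
Proof. by move=> sf; have [] := sf [::]. Qed.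

Lemma smooth_derivable f x i : smooth f -> derivable f x (e_ i).
Proof. by move=> sf; have [_] := sf [::]; exact. Qed.

Lemma smooth_partial f i : smooth f -> smooth ('D_(e_ i) f).
Proof. by move=> sf s; rewrite -iter_partial_rcons; exact: sf. Qed.

Lemma smoothD f g : smooth f -> smooth g -> smooth (f + g).
Proof.
move=> sf sg.
have E s : iter_partial s (f + g) = iter_partial s f + iter_partial s g.
  elim: s => //= i s ->; apply/funext => x.
  by rewrite deriveD //; [have [_] := sf s; exact|have [_] := sg s; exact].
move=> s; have [fc fd] := sf s; have [gc gd] := sg s; rewrite E; split.
  by move=> x; exact: (continuousD (fc x) (gc x)).
by move=> x i; apply: derivableD; [exact: fd|exact: gd].
Qed.

Lemma smoothZ (c : R) f : smooth f -> smooth (c *: f).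
Proof.
move=> sf.
have E s : iter_partial s (c *: f) = c *: iter_partial s f.
  elim: s => //= i s ->; apply/funext => x.
  by rewrite deriveZ //; have [_] := sf s; exact.
move=> s; have [fc fd] := sf s; rewrite E; split.
  by move=> x; exact: (continuousM (@cst_continuous _ _ c x) (fc x)).
by move=> x i; apply: derivableZ; exact: fd.
Qed.

Lemma smooth0 : smooth (0 : V -> R).
Proof.
have E s : iter_partial s (0 : V -> R) = 0.
  by elim: s => //= i s ->; apply/funext => x; exact: derive_cst.
move=> s; rewrite E; split; first exact: cst_continuous.
by move=> x i; exact: derivable_cst.
Qed.

Lemma smooth_sum (I : Type) (r : seq I) (F : I -> V -> R) :
  (forall i, smooth (F i)) -> smooth (\sum_(i <- r) F i).
Proof.
move=> sF; elim: r => [|i r IH]; first by rewrite big_nil; exact: smooth0.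
by rewrite big_cons; apply: smoothD.
Qed.

Lemma smooth_cas u : smooth (cas u).
Proof.
have E s : exists (c : R) (v : V), iter_partial s (cas u) = c *: cas v.
  elim: s => [|i s [c [v /= ->]]]; first by exists 1, u; rewrite scale1r.
  exists (c * (2 * pi * dot v (e_ i))), (- v); apply/funext => x.
  have dv := is_derive_cas v x (e_ i).
  rewrite deriveZ; last by have [] := dv.
  by rewrite (@derive_val _ _ _ _ _ _ _ dv) [LHS]mulrA.
move=> s; have [c [v ->]] := E s; split.
  move=> x; exact: (continuousM (@cst_continuous _ _ c x) (@cas_continuous _ _ v x)).
by move=> x i; apply: derivableZ; have [] := is_derive_cas v x (e_ i).
Qed.

Lemma periodic_derive f v : lattice_periodic f -> lattice_periodic ('D_v f).
Proof.
move=> fp x u ui; rewrite /derive.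
have E : (fun h : R => h^-1 *: ((f \o shift (x + u)) (h *: v) - f (x + u))) =
    (fun h : R => h^-1 *: ((f \o shift x) (h *: v) - f x)).
  by apply/funext => h /=; rewrite addrA !(fp _ _ ui).
by rewrite E.
Qed.

Lemma smooth_torus f : smooth f -> lattice_periodic f -> torus_fun f.
Proof. by move=> sf fp; split => //; exact: smooth_continuous. Qed.

Definition fcoef f u : R := mean (fun x => f x * cas u x).

Lemma fcoef_partial f i u : smooth f -> lattice_periodic f ->
  canonical_lattice R n u ->
  fcoef ('D_(e_ i) f) u = - (2 * pi * u 0 i) * fcoef f (- u).
Proof.
move=> sf fp ui; have ui' := latticeN ui.
have tf := smooth_torus sf fp.
have tdf := smooth_torus (smooth_partial i sf) (@periodic_derive f (e_ i) fp).
have dv x := is_derive_cas u x (e_ i).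
have E : 'D_(e_ i) (f * cas u) =
    fun x => 'D_(e_ i) f x * cas u x + (2 * pi * u 0 i) * (f x * cas (- u) x).
  apply/funext => x; rewrite deriveM; [|exact: smooth_derivable|by have [] := dv x].
  rewrite (@derive_val _ _ _ _ _ _ _ (dv x)) dot_basis addrC; congr (_ + _).
    exact: mulrC.
  by rewrite -[LHS]/(f x * _) mulrCA.
have t1 : torus_fun (fun x => 'D_(e_ i) f x * cas u x).
  by apply: torusM => //; exact: torus_cas.
have t2 : torus_fun (fun x => f x * cas (- u) x).
  by apply: torusM => //; exact: torus_cas.
have t3 : torus_fun (f * cas u) by apply: torusM => //; exact: torus_cas.
have := mean_derive (i := i) t3; rewrite E (meanD t1 (torusZ _ t2)) (meanZ _ t2).
move=> H; apply/eqP; rewrite mulNr -addr_eq0; apply/eqP/H.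
  exact: (torusD t1 (torusZ _ t2)).
by move=> x; apply: derivableM; [exact: smooth_derivable|have [] := dv x].
Qed.

(** The factor is symmetric in [i] and [j]: this is the commutation of partial
    derivatives, seen on Fourier coefficients. *)
Lemma fcoef_partial2 f i j u : smooth f -> lattice_periodic f ->
  canonical_lattice R n u ->
  fcoef ('D_(e_ i) ('D_(e_ j) f)) u = - (4 * pi ^+ 2 * (u 0 i * u 0 j)) * fcoef f u.
Proof.
move=> sf fp ui; rewrite fcoef_partial //; last 2 first.
- exact: smooth_partial.
- exact: periodic_derive.
rewrite fcoef_partial //; last exact: latticeN.
by rewrite opprK mxE; ring.
Qed.

Lemma fcoefD f g u : torus_fun f -> torus_fun g -> canonical_lattice R n u ->
  fcoef (f + g) u = fcoef f u + fcoef g u.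
Proof.
move=> tf tg ui; rewrite /fcoef -meanD; first last.
- by apply: torusM => //; exact: torus_cas.
- by apply: torusM => //; exact: torus_cas.
by congr mean; apply/funext => x; rewrite -mulrDl.
Qed.

Lemma fcoefZ (c : R) f u : torus_fun f -> canonical_lattice R n u ->
  fcoef (c *: f) u = c * fcoef f u.
Proof.
move=> tf ui; rewrite /fcoef -meanZ; last by apply: torusM => //; exact: torus_cas.
by congr mean; apply/funext => x; rewrite mulrA.
Qed.

Lemma fcoef_sum (I : Type) (r : seq I) (F : I -> V -> R) u :
  (forall i, torus_fun (F i)) -> canonical_lattice R n u ->
  fcoef (\sum_(i <- r) F i) u = \sum_(i <- r) fcoef (F i) u.
Proof.
move=> tF ui; rewrite /fcoef -mean_sum; last first.
  by move=> i; apply: torusM => //; exact: torus_cas.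
by congr mean; apply/funext => x; rewrite fct_sumE mulr_suml.
Qed.

Lemma fcoef_cas u v : canonical_lattice R n u -> canonical_lattice R n v ->
  fcoef (cas u) v = (u == v)%:R.
Proof. exact: mean_cas_prod. Qed.

(** The difference of the two sides has only zero Fourier coefficients. *)
Lemma Fourier_expansion f (S : seq V) : torus_fun f -> uniq S ->
  (forall u, u \in S -> canonical_lattice R n u) ->
  (forall u, canonical_lattice R n u -> u \notin S -> fcoef f u = 0) ->
  forall x, f x = \sum_(u <- S) fcoef f u * cas u x.
Proof.
move=> tf uS Si f0 x.
pose F u := if u \in S then fcoef f u *: cas u else 0.
have tF u : torus_fun (F u).
  rewrite /F; case: ifP => [/Si ui|_]; last exact: (torus_cst 0).
  by apply: torusZ; exact: torus_cas.
pose g := f + (-1) *: \sum_(u <- S) F u.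
have tS : torus_fun (\sum_(u <- S) F u).
  rewrite (_ : \sum_(u <- S) F u = fun x => \sum_(u <- S) F u x); first exact: torus_sum.
  by apply/funext => y; rewrite fct_sumE.
have g0 : g x = 0.
  apply: Fourier_unique; first exact: (torusD tf (torusZ _ tS)).
  move=> u ui; rewrite -/(fcoef g u) fcoefD ?fcoefZ ?fcoef_sum //; last exact: torusZ.
  have E v : v \in S -> fcoef (F v) u = (u == v)%:R * fcoef f u.
    move=> vS; have vi := Si _ vS.
    rewrite /F vS fcoefZ ?fcoef_cas //; last exact: torus_cas.
    by rewrite eq_sym mulrC; case: eqP => [->//|_]; rewrite !mul0r.
  rewrite big_seq (eq_bigr _ E) -big_seq -mulr_suml.
  have [uS'|uS'] := boolP (u \in S); last by rewrite f0 // !mulr0 addr0.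
  rewrite (bigD1_seq u) //= eqxx big1 => [|v vu]; last by rewrite eq_sym (negbTE vu).
  by rewrite addr0 mul1r mulN1r subrr.
move/eqP: g0; rewrite /g -[X in X == 0]/(f x + (-1) * (\sum_(u <- S) F u) x) mulN1r subr_eq0.
move=> /eqP ->; rewrite fct_sumE big_seq [RHS]big_seq; apply: eq_bigr => u uS'.
by rewrite /F uS'.
Qed.

End Smooth.

(** * The Hodge Laplacian as a componentwise Laplacian *)

Section LaplacianExpansion.
Context {R : realType} {n : nat}.
Local Notation V := 'rV[R]_n.
Local Notation e_ := (basis_vec R n).

Section Cofaces.
Context {q : nat}.
Implicit Types (v : V) (M : 'M[R]_(q, n)).

(** The block matrix by which the codifferential inserts a vector, with its
    row count written as a successor. *)
Definition add_row v M : 'M[R]_(q.+1, n) := (col_mx v M : 'M[R]_(1 + q, n)).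

Lemma row0_add_row v M : row ord0 (add_row v M) = v.
Proof.
apply/rowP => j; rewrite mxE /add_row.
have -> : ord0 = lshift q (ord0 : 'I_1) :> 'I_(1 + q) by apply: val_inj.
by rewrite (col_mxEu (m1 := 1)).
Qed.

Lemma rowS_add_row v M k : row (lift ord0 k) (add_row v M) = row k M.
Proof.
apply/rowP => j; rewrite [LHS]mxE [RHS]mxE /add_row.
have -> : lift ord0 k = rshift 1 k :> 'I_(1 + q) by apply: val_inj.
by rewrite (col_mxEd (m1 := 1)).
Qed.

Lemma row'0_add_row v M : row' ord0 (add_row v M) = M.
Proof.
apply/row_matrixP => k; rewrite -(rowS_add_row v M k).
by apply/rowP => j; rewrite !mxE.
Qed.

End Cofaces.

Lemma row'S_add_row q (v : V) (M : 'M[R]_(q.+1, n)) k :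
  row' (lift ord0 k) (add_row v M) = add_row v (row' k M).
Proof.
apply/row_matrixP => i; have [->|[i' ->]] : i = ord0 \/ exists i', i = lift ord0 i'.
  by case: (unliftP ord0 i) => [i' ->|->]; [right; exists i'|left].
  rewrite row0_add_row -[RHS](row0_add_row v M); apply/rowP => j; rewrite [LHS]mxE [LHS]mxE [RHS]mxE.
  by congr (add_row v M _ j); apply: val_inj.
rewrite rowS_add_row; apply/rowP => j; rewrite -[M in RHS](row'0_add_row v M) [LHS]mxE [LHS]mxE [RHS]mxE [RHS]mxE [RHS]mxE.
by congr (add_row v M _ j); apply: val_inj; rewrite /= /bump /= !add1n ltnS addnS.
Qed.

Context {p : nat} (w : pform R n p) (x : V) (M : 'M[R]_(p, n)).
(* A set of directions in which [w] is known to be twice differentiable: the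
   basis vectors for a smooth form evaluated on a frame, and all vectors for a
   form that is a finite sum of waves. *)
Variable dirs : set V.
Hypothesis dirs_basis : forall j, dirs (e_ j).
Hypothesis dirs_row : forall k, dirs (row k M).
Hypothesis dw : forall A a b y, dirs a -> dirs b ->
  derivable ('D_a (fun z => w z A)) y b.

Lemma ext_deriv_add_row j y : ext_deriv w y (add_row (e_ j) M) =
  'D_(e_ j) (fun z => w z M) y + \sum_(k < p) (- (-1) ^+ k) *
     'D_(row k M) (fun z => w z (row' (lift ord0 k) (add_row (e_ j) M))) y.
Proof.
rewrite /ext_deriv big_ord_recl /= expr0 mul1r row0_add_row row'0_add_row.
congr (_ + _); apply: eq_bigr => k _.
by rewrite rowS_add_row /= /bump /= add1n exprS mulN1r.
Qed.

Lemma codifferential_ext_deriv : codifferential (ext_deriv w) x M =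
  - (\sum_(j < n) 'D_(e_ j) ('D_(e_ j) (fun z => w z M)) x) +
  \sum_(k < p) \sum_(j < n) (-1) ^+ k * 'D_(e_ j) ('D_(row k M)
     (fun z => w z (row' (lift ord0 k) (add_row (e_ j) M)))) x.
Proof.
rewrite /codifferential exchange_big /= -!sumrN -big_split /=; apply: eq_bigr => j _.
pose D (k : 'I_p) : V -> R :=
  'D_(row k M) (fun z => w z (row' (lift ord0 k) (add_row (e_ j) M))).
pose F (k : 'I_p) : V -> R := (- (-1) ^+ k) *: D k.
rewrite (_ : (fun y => _) = 'D_(e_ j) (fun z => w z M) + \sum_(k < p) F k); last first.
  by apply/funext => y; rewrite [LHS](ext_deriv_add_row j y) /= fctE fct_sumE.
have dD k : derivable (D k) x (e_ j) by exact: dw.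
have dF k : derivable (F k) x (e_ j) by exact: derivableZ.
rewrite deriveD; [|exact: dw|exact: derivable_sum].
rewrite derive_sum // opprD -sumrN; congr (_ + _); apply: eq_bigr => k _.
by rewrite deriveZ // scaleNr opprK.
Qed.

End LaplacianExpansion.

Section LaplacianExpansionS.
Context {R : realType} {n q : nat}.
Local Notation V := 'rV[R]_n.
Local Notation e_ := (basis_vec R n).
Context (w : pform R n q.+1) (x : V) (M : 'M[R]_(q.+1, n)).
Variable dirs : set V.
Hypothesis dirs_basis : forall j, dirs (e_ j).
Hypothesis dirs_row : forall k, dirs (row k M).
Hypothesis dw : forall A a b y, dirs a -> dirs b ->
  derivable ('D_a (fun z => w z A)) y b.

Lemma ext_deriv_codifferential : ext_deriv (codifferential w) x M =
  - \sum_(k < q.+1) \sum_(j < n) (-1) ^+ k * 'D_(row k M) ('D_(e_ j)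
     (fun z => w z (row' (lift ord0 k) (add_row (e_ j) M)))) x.
Proof.
rewrite /ext_deriv -sumrN; apply: eq_bigr => k _; rewrite -mulr_sumr -mulrN; congr (_ * _).
rewrite (_ : (fun y => _) = - \sum_(j < n) 'D_(e_ j)
    (fun z => w z (row' (lift ord0 k) (add_row (e_ j) M)))); last first.
  apply/funext => y; rewrite /codifferential fctE fct_sumE; congr (- _).
  by apply: eq_bigr => j _; rewrite row'S_add_row.
have dj j : derivable ('D_(e_ j) (fun z => w z (row' (lift ord0 k) (add_row (e_ j) M)))) x (row k M).
  exact: dw.
by rewrite deriveN ?derive_sum //; exact: derivable_sum.
Qed.

End LaplacianExpansionS.

Section Weitzenbock.
Context {R : realType} {n p : nat}.
Local Notation V := 'rV[R]_n.
Local Notation e_ := (basis_vec R n).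

(** The flat Weitzenböck formula, before second derivatives are known to
    commute: the terms with [k] are the commutators of derivatives that the
    two halves of the Laplacian leave behind. *)
Lemma laplacianE (w : pform R n p) (M : 'M[R]_(p, n)) (dirs : set V) :
  (forall j, dirs (e_ j)) -> (forall k, dirs (row k M)) ->
  (forall A a b y, dirs a -> dirs b -> derivable ('D_a (fun z => w z A)) y b) ->
  exists N : 'I_p -> 'I_n -> 'M[R]_(p, n), forall x, laplacian w x M =
  - (\sum_(j < n) 'D_(e_ j) ('D_(e_ j) (fun z => w z M)) x) +
  \sum_(k < p) \sum_(j < n) (-1) ^+ k *
    ('D_(e_ j) ('D_(row k M) (fun z => w z (N k j))) x -
     'D_(row k M) ('D_(e_ j) (fun z => w z (N k j))) x).
Proof.
move=> db dr dw; exists (fun k j => row' (lift ord0 k) (add_row (e_ j) M)) => x.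
have := codifferential_ext_deriv x db dr dw.
move=> cE; case: p w M dr dw cE => [|q] w M dr dw cE.
  by rewrite /laplacian cE !big_ord0.
rewrite [LHS]/((ext_deriv (codifferential w) x M) + (codifferential (ext_deriv w) x M)).
rewrite cE (ext_deriv_codifferential x db dr dw) [LHS]addrC -[LHS]addrA; congr (_ + _).
rewrite -sumrN -big_split; apply: eq_bigr => k _ /=.
rewrite -sumrN -big_split; apply: eq_bigr => j _ /=.
by rewrite mulrBr.
Qed.

End Weitzenbock.

(** * The Laplacian on Fourier coefficients *)

Section FourierLaplacian.
Context {R : realType} {n p : nat}.
Local Notation V := 'rV[R]_n.
Local Notation e_ := (basis_vec R n).

Definition frame (g : 'I_p -> 'I_n) : 'M[R]_(p, n) := \matrix_(i, j) (j == g i)%:R.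

Lemma row_frame g i : row i (frame g) = e_ (g i).
Proof. by apply/rowP => j; rewrite !mxE eqxx. Qed.

(** The commutators of [laplacianE] have zero Fourier coefficients by
    [fcoef_partial2]; what remains is minus the sum of the second
    derivatives. *)
Lemma fcoef_laplacian (w : pform R n p) (g : 'I_p -> 'I_n) u :
  (forall M, smooth (fun x => w x M)) ->
  (forall M, lattice_periodic (fun x => w x M)) ->
  canonical_lattice R n u ->
  fcoef (fun x => laplacian w x (frame g)) u =
  4 * pi ^+ 2 * dot u u * fcoef (fun x => w x (frame g)) u.
Proof.
move=> sw pw ui.
pose dirs : set V := [set v | exists j, v = e_ j].
have dirs_e j : dirs (e_ j) by exists j.
have dirs_r k : dirs (row k (frame g)) by exists (g k); rewrite row_frame.
have dw A a b y : dirs a -> dirs b -> derivable ('D_a (fun z => w z A)) y b.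
  by move=> [j ->] [k ->]; apply: smooth_derivable; exact: smooth_partial.
have [N HN] := laplacianE dirs_e dirs_r dw.
have tD i j M : torus_fun ('D_(e_ i) ('D_(e_ j) (fun z => w z M))).
  apply: smooth_torus; first by do 2 apply: smooth_partial.
  by do 2 apply: periodic_derive.
pose F1 (j : 'I_n) : V -> R := 'D_(e_ j) ('D_(e_ j) (fun z => w z (frame g))).
pose A (k : 'I_p) (j : 'I_n) : V -> R := 'D_(e_ j) ('D_(e_ (g k)) (fun z => w z (N k j))).
pose B (k : 'I_p) (j : 'I_n) : V -> R := 'D_(e_ (g k)) ('D_(e_ j) (fun z => w z (N k j))).
have tA k j : torus_fun (A k j) by exact: tD.
have tB k j : torus_fun (B k j) by exact: tD.
have AB k j : fcoef (A k j) u = fcoef (B k j) u.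
  apply: etrans (fcoef_partial2 j (g k) (sw (N k j)) (pw (N k j)) ui) _.
  rewrite [u 0 j * _]mulrC; apply: esym.
  exact: (fcoef_partial2 (g k) j (sw (N k j)) (pw (N k j)) ui).
have key (a b : V -> R) : torus_fun a -> torus_fun b -> fcoef a u = fcoef b u ->
    fcoef (a + (-1) *: b) u = 0.
  move=> ta tb ab; rewrite (fcoefD ta (torusZ _ tb) ui) (fcoefZ _ tb ui) ab.
  by rewrite mulN1r subrr.
pose F2 (k : 'I_p) (j : 'I_n) : V -> R := (-1) ^+ k *: (A k j + (-1) *: B k j).
have tAB k j : torus_fun (A k j + (-1) *: B k j).
  exact: (torusD (tA k j) (torusZ _ (tB k j))).
have t1 : torus_fun (\sum_(j < n) F1 j).
  rewrite (_ : \sum_(j < n) F1 j = fun x => \sum_(j < n) F1 j x).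
    by apply: torus_sum => j; exact: tD.
  by apply/funext => x; rewrite fct_sumE.
have t2 k j : torus_fun (F2 k j).
  exact: (torusZ _ (tAB k j)).
have t2' k : torus_fun (\sum_(j < n) F2 k j).
  rewrite (_ : \sum_(j < n) _ = fun x => \sum_(j < n) F2 k j x).
    by apply: torus_sum => j; exact: t2.
  by apply/funext => x; rewrite fct_sumE.
have t2'' : torus_fun (\sum_(k < p) \sum_(j < n) F2 k j).
  rewrite (_ : \sum_(k < p) _ = fun x => \sum_(k < p) (\sum_(j < n) F2 k j) x).
    by apply: torus_sum => k; exact: t2'.
  by apply/funext => x; rewrite fct_sumE.
rewrite (_ : (fun x => _) = (-1) *: (\sum_(j < n) F1 j) + \sum_(k < p) \sum_(j < n) F2 k j); last first.
  apply/funext => x; rewrite HN; congr (_ + _).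
    by rewrite -[RHS]/(-1 * (\sum_(j < n) F1 j) x) fct_sumE mulN1r.
  rewrite fct_sumE; apply: eq_bigr => k _; rewrite fct_sumE; apply: eq_bigr => j _.
  by rewrite row_frame -[RHS]/((-1) ^+ k * (A k j x + (-1) * B k j x)) mulN1r.
rewrite fcoefD //; last exact: torusZ.
have tF1 j : torus_fun (F1 j) by exact: tD.
rewrite fcoefZ // (fcoef_sum _ tF1 ui) (fcoef_sum _ t2' ui) [X in _ + X]big1 => [|k _]; last first.
  rewrite (fcoef_sum _ (t2 k) ui) big1 // => j _.
  rewrite (fcoefZ _ (tAB k j) ui) (_ : fcoef _ u = 0) ?mulr0 //.
  exact: (key _ _ (tA k j) (tB k j) (AB k j)).
rewrite addr0 mulN1r -sumrN /dot !mulr_sumr mulr_suml; apply: eq_bigr => j _.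
by rewrite (fcoef_partial2 j j (sw _) (pw _) ui) mulNr opprK.
Qed.

Definition trig_fun (T : Type) (r : seq T) (c : T -> R) (U : T -> V) : V -> R :=
  fun x => \sum_(t <- r) c t * cas (U t) x.

Lemma is_derive_trig (T : Type) (r : seq T) c U x v :
  is_derive x v (trig_fun r c U)
   (trig_fun r (fun t => 2 * pi * dot (U t) v * c t) (fun t => - U t) x).
Proof.
rewrite /trig_fun; elim: r => [|t r IH].
  rewrite big_nil (_ : (fun _ => _) = cst 0); first exact: is_derive_cst.
  by apply/funext => y; rewrite big_nil.
rewrite big_cons (_ : (fun _ => _) = c t *: cas (U t) + trig_fun r c U); last first.
  by apply/funext => y; rewrite big_cons.
apply: is_deriveD => //.
rewrite -mulrA mulrCA; apply: is_deriveZ; exact: is_derive_cas.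
Qed.

Lemma derive_trig (T : Type) (r : seq T) c U v :
  'D_v (trig_fun r c U) = trig_fun r (fun t => 2 * pi * dot (U t) v * c t) (fun t => - U t).
Proof. by apply/funext => x; apply: derive_val; exact: is_derive_trig. Qed.

(** For finite sums of waves all directional derivatives are explicit, and the
    commutators of [laplacianE] vanish for every tuple of vectors [M], not
    only for frames. *)
Lemma laplacian_trig (T : Type) (r : seq T) (a : T -> 'M[R]_(p, n) -> R) (U : T -> V) (w : pform R n p) :
  (forall x M, w x M = trig_fun r (fun t => a t M) U x) ->
  forall x M, laplacian w x M =
    trig_fun r (fun t => 4 * pi ^+ 2 * dot (U t) (U t) * a t M) U x.
Proof.
move=> wE x M; pose dirs : set V := setT.
have wE' A : (fun z => w z A) = trig_fun r (fun t => a t A) U by apply/funext => z.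
have dw A v b y : dirs v -> dirs b -> derivable ('D_v (fun z => w z A)) y b.
  by move=> _ _; rewrite wE' derive_trig; have [] := is_derive_trig r
    (fun t => 2 * pi * dot (U t) v * a t A) (fun t => - U t) y b.
have D2 A v b : 'D_v ('D_b (fun z => w z A)) x =
    \sum_(t <- r) - (4 * pi ^+ 2 * (dot (U t) v * dot (U t) b) * a t A * cas (U t) x).
  rewrite wE' derive_trig (derive_val (is_derive := is_derive_trig _ _ _ x v)); apply: eq_bigr => t _.
  by rewrite opprK dotNl; ring.
have [N ->] := @laplacianE _ _ _ w M dirs (fun=> I) (fun=> I) dw.
rewrite [X in _ + X]big1 => [|k _]; last first.
  rewrite big1 // => j _; rewrite (D2 (N k j) (e_ j) (row k M)).
  rewrite (D2 (N k j) (row k M) (e_ j)) (_ : _ - _ = 0) ?mulr0 //.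
  apply/eqP; rewrite subr_eq0; apply/eqP.
  by apply: eq_bigr => t _; congr (- (_ * _ * _ * _)); exact: mulrC.
rewrite addr0 -sumrN (eq_bigr (fun j => \sum_(t <- r)
  4 * pi ^+ 2 * (U t 0 j * U t 0 j) * a t M * cas (U t) x)) => [|j _].
  rewrite exchange_big /trig_fun /=; apply: eq_bigr => t _.
  by rewrite /dot mulr_sumr !mulr_suml; apply: eq_bigr.
rewrite D2 -sumrN; apply: eq_bigr => t _.
by rewrite opprK dot_basis.
Qed.

End FourierLaplacian.

From mathcomp Require Import fingroup perm.

(** * Multilinear and alternating forms *)

Section Multilinear.
Context {R : realType} {n p : nat}.
Local Notation V := 'rV[R]_n.
Local Notation e_ := (basis_vec R n).
Implicit Types (a b : 'M[R]_(p, n) -> R) (M : 'M[R]_(p, n)).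

Definition set_row (k : 'I_p) (v : V) M : 'M[R]_(p, n) :=
  \matrix_(i, j) if i == k then v 0 j else M i j.

Lemma row_set_row k v M : row k (set_row k v M) = v.
Proof. by apply/rowP => j; rewrite !mxE eqxx. Qed.

Lemma row_set_row_neq k v M i : i != k -> row i (set_row k v M) = row i M.
Proof. by move=> ik; apply/rowP => j; rewrite !mxE (negbTE ik). Qed.

Lemma set_row_id k M : set_row k (row k M) M = M.
Proof. by apply/matrixP => i j; rewrite !mxE; case: eqP => // ->. Qed.

Lemma multilinear_set_row a k M (b c : R) (u v : V) : is_multilinear a ->
  a (set_row k (b *: u + c *: v) M) = b * a (set_row k u M) + c * a (set_row k v M).
Proof.
move=> ma; apply: (ma k); first by rewrite !row_set_row.
by move=> j jk; rewrite !row_set_row_neq.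
Qed.

Lemma multilinear_row_sum a k M : is_multilinear a ->
  a M = \sum_(j < n) M k j * a (set_row k (e_ j) M).
Proof.
move=> ma.
have a0 : a (set_row k 0 M) = 0.
  have := multilinear_set_row k M 0 0 0 0 ma.
  by rewrite !scale0r addr0 !mul0r addr0.
have E (s : seq 'I_n) : a (set_row k (\sum_(j <- s) M k j *: e_ j) M) =
    \sum_(j <- s) M k j * a (set_row k (e_ j) M).
  elim: s => [|j s IH]; first by rewrite !big_nil.
  rewrite !big_cons -[X in _ + X]scale1r multilinear_set_row // mul1r.
  by congr (_ + _).
rewrite -E -{1}(set_row_id k M); congr (a (set_row _ _ _)).
rewrite [LHS]row_sum_delta; apply: eq_bigr => j _; by rewrite mxE.
Qed.

(** Rows are replaced by basis vectors one at a time: the induction is on the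
    number [k] of rows that may still be arbitrary. *)
Lemma multilinear_eq_frames a b : is_multilinear a -> is_multilinear b ->
  (forall g : 'I_p -> 'I_n, a (frame g) = b (frame g)) -> forall M, a M = b M.
Proof.
move=> ma mb ab.
have H k : forall M, (forall i : 'I_p, (k <= i)%N -> exists j, row i M = e_ j) -> a M = b M.
  elim: k => [|k IH] M HM.
    have /choice [g gE] : forall i : 'I_p, exists j, row i M = e_ j by move=> i; exact: HM.
    rewrite (_ : M = frame g) //; apply/row_matrixP => i.
    by rewrite row_frame gE.
  have [kp|pk] := ltnP k p; last first.
    by apply: IH => i ki; move: (leq_ltn_trans (leq_trans pk ki) (ltn_ord i)); rewrite ltnn.
  pose k' := Ordinal kp.
  rewrite (multilinear_row_sum k' M ma) (multilinear_row_sum k' M mb).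
  apply: eq_bigr => j _; congr (_ * _); apply: IH => i ki.
  have [->|ik] := eqVneq i k'; first by exists j; rewrite row_set_row.
  by rewrite row_set_row_neq //; apply: HM; rewrite ltn_neqAle ki andbT eq_sym.
by move=> M; apply: (H p) => i pi; move: (leq_ltn_trans pi (ltn_ord i)); rewrite ltnn.
Qed.

Definition monomial_form (g : 'I_p -> 'I_n) M : R := \prod_i M i (g i).

Lemma monomial_multilinear g : is_multilinear (monomial_form g).
Proof.
move=> i b c A B C rA rBC.
rewrite /monomial_form (bigD1 i) //= [X in _ = b * X + _](bigD1 i) //=.
rewrite [X in _ = _ + c * X](bigD1 i) //=.
have EB : \prod_(j < p | j != i) B j (g j) = \prod_(j < p | j != i) A j (g j).
  apply: eq_bigr => j ji; have [/rowP/(_ (g j)) + _] := rBC j ji; by rewrite !mxE.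
have EC : \prod_(j < p | j != i) C j (g j) = \prod_(j < p | j != i) A j (g j).
  apply: eq_bigr => j ji; have [_ /rowP/(_ (g j)) +] := rBC j ji; by rewrite !mxE.
have /rowP/(_ (g i)) := rA; rewrite !mxE => ->; rewrite EB EC; ring.
Qed.

Lemma multilinear_sum (I : Type) (r : seq I) (c : I -> R) (F : I -> 'M[R]_(p, n) -> R) :
  (forall i, is_multilinear (F i)) ->
  is_multilinear (fun M => \sum_(i <- r) c i * F i M).
Proof.
move=> mF i b d A B C rA rBC; rewrite !mulr_sumr -big_split; apply: eq_bigr => j _ /=.
by rewrite (mF j i b d A B C rA rBC); ring.
Qed.

Lemma monomial_frame (g h : {ffun 'I_p -> 'I_n}) : monomial_form g (frame h) = (g == h)%:R.
Proof.
rewrite /monomial_form; case: eqP => [->|gh].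
  by apply: big1 => i _; rewrite mxE eqxx.
have [i gi] : exists i, g i != h i.
  apply/existsP; apply: contra_notT gh; rewrite negb_exists => /forallP H.
  by apply/ffunP => i; have := H i; rewrite negbK => /eqP.
by rewrite (bigD1 i) //= mxE (negbTE gi) mul0r.
Qed.

Lemma frame_eq (g h : 'I_p -> 'I_n) : g =1 h -> frame g = frame h :> 'M[R]_(p, n).
Proof. by move=> gh; apply/matrixP => i j; rewrite !mxE gh. Qed.

Lemma multilinear_expansion a M : is_multilinear a ->
  a M = \sum_(g : {ffun 'I_p -> 'I_n}) a (frame g) * monomial_form g M.
Proof.
move=> ma; move: M; apply: multilinear_eq_frames => //.
  by apply: multilinear_sum => g; exact: monomial_multilinear.
move=> h; rewrite (bigD1 [ffun i => h i]) //= big1 => [|g gh].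
  rewrite -(@frame_eq [ffun i => h i] h) => [|i]; last by rewrite ffunE.
  by rewrite monomial_frame eqxx mulr1 addr0.
rewrite -(@frame_eq [ffun i => h i] h) => [|i]; last by rewrite ffunE.
by rewrite monomial_frame (negbTE gh) mulr0.
Qed.

(** The projector onto alternating forms. *)
Definition alternation a : 'M[R]_(p, n) -> R := fun M =>
  (p`!%:R)^-1 * \sum_(s : 'S_p) (-1) ^+ s * a (row_perm s M).

Lemma multilinear_row_perm a (s : 'S_p) : is_multilinear a ->
  is_multilinear (fun M => a (row_perm s M)).
Proof.
move=> ma i b c A B C rA rBC.
have rp M j : row j (row_perm s M) = row (s j) M by apply/rowP => k; rewrite !mxE.
apply: (ma (s^-1%g i)); first by rewrite !rp permKV.
move=> j ji; rewrite !rp; apply: rBC.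
by apply: contra ji => /eqP <-; rewrite permK.
Qed.

Lemma alternation_alternating a : is_multilinear a -> is_alternating (alternation a).
Proof.
move=> ma; split.
  have := @multilinear_sum _ (index_enum _) (fun s : 'S_p => (p`!%:R)^-1 * (-1) ^+ s)
    _ (fun s => multilinear_row_perm s ma).
  rewrite (_ : (fun M => _) = alternation a) //; apply/funext => M.
  by rewrite /alternation mulr_sumr; apply: eq_bigr => s _; rewrite mulrA.
move=> A i j ij rA.
have tA : row_perm (tperm i j) A = A.
  apply/row_matrixP => k; rewrite (_ : row k _ = row (tperm i j k) A); last first.
    by apply/rowP => l; rewrite !mxE.
  by case: tpermP => [->|->|].
have S : \sum_(s : 'S_p) (-1) ^+ s * a (row_perm s A) =
       - \sum_(s : 'S_p) (-1) ^+ s * a (row_perm s A).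
  rewrite {1}(reindex_inj (mulIg (tperm i j))) -sumrN; apply: eq_bigr => s _.
  by rewrite row_permM tA odd_permM odd_tperm ij signr_addb expr1 mulrN1 mulNr.
rewrite /alternation; apply/eqP; rewrite mulf_eq0; apply/orP; right.
by rewrite -[_ == 0](mulrn_eq0 _ 2) mulr2n {1}S addNr.
Qed.

(** Expand [a] on the tuple that has the sum of rows [i] and [j] in both
    places, where it vanishes. *)
Lemma alternating_tperm a i j M : is_alternating a -> i != j ->
  a (row_perm (tperm i j) M) = - a M.
Proof.
move=> [ma aa] ij; pose u := row i M; pose v := row j M.
pose m x y := a (set_row i x (set_row j y M)).
have mxx x : m x x = 0.
  apply: (aa _ i j ij); rewrite row_set_row row_set_row_neq 1?eq_sym //.
  by rewrite row_set_row.
have mDl x y z : m (x + y) z = m x z + m y z.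
  by rewrite /m -[x]scale1r -[y]scale1r multilinear_set_row // !scale1r !mul1r.
have sC x y : set_row i x (set_row j y M) = set_row j y (set_row i x M).
  apply/matrixP => k l; rewrite !mxE; case: eqP => // ->.
  by rewrite (negbTE ij).
have mDr x y z : m z (x + y) = m z x + m z y.
  by rewrite /m !sC -[x]scale1r -[y]scale1r multilinear_set_row // !scale1r !mul1r.
have -> : a M = m u v.
  by rewrite /m /u /v set_row_id set_row_id.
have -> : a (row_perm (tperm i j) M) = m v u.
  congr a; apply/matrixP => k l; rewrite !mxE.
  case: tpermP => [->|->|/eqP/negbTE -> /eqP/negbTE -> //]; rewrite ?eqxx //.
  by rewrite eq_sym (negbTE ij).
have := mxx (u + v); rewrite mDl !mDr !mxx add0r addr0 => /eqP.
by rewrite addrC addr_eq0 => /eqP ->; rewrite ?opprK.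
Qed.

Lemma alternating_perm a (s : 'S_p) M : is_alternating a ->
  a (row_perm s M) = (-1) ^+ s * a M.
Proof.
move=> aa; have [ts -> dts] := prod_tpermP s.
elim: ts dts M => [_ M|t ts IH /= /andP[dt dts] M].
  by rewrite big_nil row_perm1 odd_perm1 mul1r.
rewrite big_cons row_permM alternating_tperm // IH //.
by rewrite odd_permM odd_tperm dt signr_addb expr1 mulN1r mulNr.
Qed.

Lemma alternation_id a M : is_alternating a -> alternation a M = a M.
Proof.
move=> aa; rewrite /alternation (eq_bigr (fun=> a M)) => [|s _]; last first.
  by rewrite alternating_perm // mulrA -signr_addb addbb mul1r.
rewrite sumr_const -[a M *+ _]mulr_natl (_ : #|_| = p`!); last first.
  by rewrite -[RHS](card_Sn p); apply: eq_card => s; rewrite !inE.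
by rewrite mulrA mulVf ?mul1r // pnatr_eq0 -lt0n fact_gt0.
Qed.

End Multilinear.

(** * Dimension as the trace of a projector *)

(** A factorization [A = C *m B] of full rank has [B *m C = 1] when [A] is
    idempotent, and the trace of a product does not depend on its order. *)
Lemma mxtrace_idempotent (F : fieldType) (N : nat) (A : 'M[F]_N) :
  A *m A = A -> \tr A = (\rank A)%:R.
Proof.
move=> AA; have E : row_base A *m col_base A = 1%:M.
  apply: (row_free_inj (row_base_free A)); rewrite mul1mx.
  have Cf : row_full (col_base A) by exact: col_base_full.
  apply: (row_full_inj Cf).
  by rewrite mulmx_base -mulmxA mulmx_base mulmxA mulmx_base AA.
by rewrite -{1}(mulmx_base A) mxtrace_mulC E mxtrace1.
Qed.

Section Projection.
Context {R : realType} {V : lmodType R} {T : finType}.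
Variables (phi : T -> V) (kappa : T -> V -> R) (E : set V) (P : V -> V).
Hypothesis kappa_phi : forall (c : T -> R) s, kappa s (\sum_t c t *: phi t) = c s.
Hypothesis P_lin : forall c : T -> R, P (\sum_t c t *: phi t) = \sum_t c t *: P (phi t).
Hypothesis E_span : forall w, E w -> w = \sum_t kappa t w *: phi t.
Hypothesis P_id : forall w, E w -> P w = w.
Hypothesis P_E : forall c : T -> R, E (P (\sum_t c t *: phi t)).

Let N := #|T|.
Let vec (c : 'rV[R]_N) : V := \sum_t c 0 (enum_rank t) *: phi t.
Let coord (w : V) : 'rV[R]_N := \row_j kappa (enum_val j) w.

Let vecK c : coord (vec c) = c.
Proof. by apply/rowP => j; rewrite mxE kappa_phi enum_valK. Qed.

Let coordK w : E w -> vec (coord w) = w.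
Proof.
move=> Ew; rewrite {2}(E_span Ew); apply: eq_bigr => t _.
by rewrite mxE enum_rankK.
Qed.

Let vec_lin k (d : 'rV[R]_k) (B : 'M[R]_(k, N)) :
  vec (d *m B) = \sum_i d 0 i *: vec (row i B).
Proof.
rewrite /vec; under [RHS]eq_bigr do rewrite scaler_sumr.
rewrite exchange_big; apply: eq_bigr => t _ /=.
by rewrite mxE scaler_suml; apply: eq_bigr => i _; rewrite scalerA mxE.
Qed.

Let phiE s : phi s = \sum_t ((t == s)%:R : R) *: phi t.
Proof.
rewrite (bigD1 s) //= eqxx scale1r big1 ?addr0 // => t ts.
by rewrite (negbTE ts) scale0r.
Qed.

Let A : 'M[R]_N := \matrix_i coord (P (phi (enum_val i))).

Let EPphi s : E (P (phi s)).
Proof. by rewrite phiE; exact: P_E. Qed.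

Let P_vec c : P (vec c) = vec (c *m A).
Proof.
rewrite /vec P_lin -/(vec (c *m A)) vec_lin (reindex (@enum_val T T)) /=; last first.
  by exists enum_rank => t _; rewrite ?enum_valK ?enum_rankK.
apply: eq_bigr => i _; rewrite enum_valK rowK coordK //.
Qed.

Let E_vec w : E w -> coord w *m A = coord w.
Proof. by move=> Ew; rewrite -{2}(P_id Ew) -{2}(coordK Ew) P_vec vecK. Qed.

Let E_PA c : E (vec (c *m A)).
Proof. by rewrite -P_vec; exact: P_E. Qed.

Let A_idem : A *m A = A.
Proof. by apply/row_matrixP => i; rewrite row_mul rowK E_vec. Qed.

Let dim_rank k : has_dim E k -> k = \rank A.
Proof.
move=> [b [Eb bu]]; pose B : 'M[R]_(k, N) := \matrix_i coord (b i).
have vB (d : 'rV[R]_k) : vec (d *m B) = \sum_i d 0 i *: b i.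
  by rewrite vec_lin; apply: eq_bigr => i _; rewrite rowK coordK.
have vec0 : vec 0 = 0 by apply: big1 => t _; rewrite mxE scale0r.
have E0 : E 0 by rewrite -vec0 -(mul0mx _ A); exact: E_PA.
have Bf : row_free B.
  apply: inj_row_free => d dB; have [c [_ cu]] := bu _ E0.
  rewrite -(cu 0); last by rewrite big1 // => i _; rewrite mxE scale0r.
  by apply/esym/cu; rewrite -vB dB vec0.
have BA : (B <= A)%MS.
  apply/row_subP => i; rewrite rowK -(E_vec (Eb i)); exact: submxMl.
have AB : (A <= B)%MS.
  apply/row_subP => i; rewrite rowK; have [c [cE _]] := bu _ (EPphi (enum_val i)).
  by rewrite cE -vB vecK submxMl.
have /eqP <- : \rank B == k by exact: Bf.
by apply/eqP; rewrite eqn_leq !mxrankS.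
Qed.

Let rank_dim : has_dim E (\rank A).
Proof.
pose B := row_base A; exists (fun i => vec (row i B)); split => [i|v Ev].
  have /submxP[D ->] : (row i B <= A)%MS by rewrite -(eq_row_base A) row_sub.
  exact: E_PA.
have /submxP[d dB] : (coord v <= B)%MS.
  by rewrite (eq_row_base A) -(E_vec Ev) submxMl.
exists d; split; first by rewrite -vec_lin -dB coordK.
move=> d' d'E; apply: (row_free_inj (row_base_free A)).
by rewrite -/B -dB d'E -vec_lin vecK.
Qed.

(** On the finite-dimensional span of the [phi t], with coordinates [kappa],
    the operator [P] is a projector onto [E]; so the dimension of [E] is the
    rank of its matrix, hence the trace, which is a sum of explicit diagonal
    coordinates. *)
Lemma has_dim_projection k : has_dim E k <-> k%:R = \sum_t kappa t (P (phi t)).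
Proof.
have -> : \sum_t kappa t (P (phi t)) = (\rank A)%:R.
  rewrite -(mxtrace_idempotent A_idem) /mxtrace (reindex (@enum_val T T)) /=.
    by apply: eq_bigr => i _; rewrite !mxE.
  by exists enum_rank => t _; rewrite ?enum_valK ?enum_rankK.
split=> [/dim_rank ->//|/eqP]; rewrite eqr_nat => /eqP ->; exact: rank_dim.
Qed.

Lemma has_dim_exists : exists k, has_dim E k.
Proof. by exists (\rank A). Qed.

End Projection.

(** * Forms that are finite sums of waves *)

Section Affine.
Context {R : realType} {n : nat}.
Local Notation V := 'rV[R]_n.

Definition aff (B : 'M[R]_n) (b : V) : V -> V := fun x => x *m B + b.

Lemma mulmxr_continuous (B : 'M[R]_n) : continuous (mulmxr B : V -> V).
Proof.
have -> : (mulmxr B : V -> V) = \sum_(i < n) (fun x : V => x 0 i *: row i B).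
  by apply/funext => x; rewrite fct_sumE /= mulmx_sum_row.
elim/big_ind: _ => [|f g fc gc x|i _ x]; first exact: cst_continuous.
  exact: (continuousD (fc x) (gc x)).
exact: (cvgZr_tmp (@coord_continuous _ _ _ 0 i x)).
Qed.

Lemma jacobian_aff B b x : jacobian (aff B b) x = B.
Proof.
have mc := @mulmxr_continuous B.
have dm : is_diff x (mulmxr B : V -> V) (mulmxr B : V -> V).
  by apply: DiffDef; [exact: linear_differentiable|exact: diff_lin].
have E : 'd (aff B b) x = mulmxr B :> (V -> V).
  have -> : aff B b = (mulmxr B : V -> V) + cst b by apply/funext.
  have [_ ->] := is_diffD dm (is_diff_cst b x).
  by apply/funext => y; exact: addr0.
rewrite /jacobian; apply/row_matrixP => i; rewrite rowE mul_rV_lin1 E.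
by rewrite /= -rowE.
Qed.

Lemma pullback_aff p (w : pform R n p) B b x M :
  pullback (aff B b) w x M = w (x *m B + b) (M *m B).
Proof. by rewrite /pullback jacobian_aff. Qed.

Lemma dot_mulmx (u x : V) B : dot u (x *m B) = dot (u *m B^T) x.
Proof.
have dotE (v y : V) : dot v y = (v *m y^T) 0 0.
  by rewrite !mxE; apply: eq_bigr => i _; rewrite !mxE.
by rewrite !dotE trmx_mul mulmxA.
Qed.

Lemma cas_aff (u x : V) B b : cas u (x *m B + b) =
  cos (2 * pi * dot u b) * cas (u *m B^T) x +
  sin (2 * pi * dot u b) * cas (- (u *m B^T)) x.
Proof.
have casB v : cas v (x *m B) = cas (v *m B^T) x by rewrite /cas dot_mulmx.
by rewrite casD !casB mulNmx.
Qed.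

End Affine.

Section TrigForms.
Context {R : realType} {n p : nat}.
Local Notation V := 'rV[R]_n.

Definition trig_form (r : seq (('M[R]_(p, n) -> R) * V)) : pform R n p :=
  fun x M => \sum_(t <- r) t.1 M * cas t.2 x.

(** The lattice vectors whose waves have eigenvalue [l] for the Laplacian. *)
Definition frequency (l : R) (u : V) :=
  canonical_lattice R n u /\ 4 * pi ^+ 2 * dot u u = l.

(** All forms met on the way from the waves to the eigenforms belong to this
    class, which is closed under sums, under permutation of the arguments and
    under pull-back by the elements of the group; its members are smooth
    eigenvectors of the Laplacian. *)
Definition is_trig_form (l : R) (w : pform R n p) := exists r,
  [/\ w = trig_form r,
      forall t, List.In t r -> is_multilinear t.1 &
      forall t, List.In t r -> frequency l t.2].

Lemma trig_form0 l : is_trig_form l 0.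
Proof.
exists [::]; split => //.
by apply/funext => x; apply/funext => M; rewrite /trig_form big_nil.
Qed.

Lemma trig_formD l w1 w2 : is_trig_form l w1 -> is_trig_form l w2 ->
  is_trig_form l (w1 + w2).
Proof.
move=> [r1 [-> m1 f1]] [r2 [-> m2 f2]]; exists (r1 ++ r2); split.
- by apply/funext => x; apply/funext => M; rewrite /trig_form big_cat.
- by move=> t tin; have [H|H] := List.in_app_or r1 r2 t tin; [exact: m1|exact: m2].
- by move=> t tin; have [H|H] := List.in_app_or r1 r2 t tin; [exact: f1|exact: f2].
Qed.

Lemma multilinearZ (c : R) (a : 'M[R]_(p, n) -> R) :
  is_multilinear a -> is_multilinear (fun M => c * a M).
Proof. by move=> ma i b d A B C rA rBC; rewrite (ma i b d A B C rA rBC); ring. Qed.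

Lemma trig_formZ l c w : is_trig_form l w -> is_trig_form l (c *: w).
Proof.
move=> [r [-> mr fr]].
exists [seq ((fun M => c * t.1 M), t.2) | t <- r]; split.
- apply/funext => x; apply/funext => M; rewrite /trig_form big_map.
  rewrite -[LHS]/(c * trig_form r x M) /trig_form mulr_sumr.
  by apply: eq_bigr => t _; rewrite mulrA.
- move=> t tin; have [t' [<- H]] := iffLR (List.in_map_iff _ r t) tin; have mt' := mr _ H; exact: multilinearZ.
- by move=> t tin; have [t' [<- /fr]] := iffLR (List.in_map_iff _ r t) tin.
Qed.

Lemma trig_form_sum l (I : Type) (s : seq I) (F : I -> pform R n p) :
  (forall i, is_trig_form l (F i)) -> is_trig_form l (\sum_(i <- s) F i).
Proof.
move=> tF; elim: s => [|i s IH]; first by rewrite big_nil; exact: trig_form0.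
by rewrite big_cons; exact: trig_formD.
Qed.

Lemma trig_form1 l (a : 'M[R]_(p, n) -> R) u : is_multilinear a -> frequency l u ->
  is_trig_form l (fun x M => a M * cas u x).
Proof.
move=> ma fu; exists [:: (a, u)]; split.
- by apply/funext => x; apply/funext => M; rewrite /trig_form big_seq1.
- by move=> t [<-|[]].
- by move=> t [<-|[]].
Qed.

Lemma multilinear_mulmx (a : 'M[R]_(p, n) -> R) (B : 'M[R]_n) :
  is_multilinear a -> is_multilinear (fun M => a (M *m B)).
Proof.
move=> ma i b c A C D rA rCD; apply: (ma i).
  by rewrite !row_mul rA mulmxDl !scalemxAl.
by move=> j ji; have [rC rD] := rCD j ji; rewrite !row_mul rC rD.
Qed.

Lemma frequencyN l (u : V) : frequency l u -> frequency l (- u).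
Proof. by move=> [ui ul]; split; [exact: latticeN|rewrite dotNl dotNr opprK]. Qed.

(** The pull-back by [aff B b], written without the Jacobian; see
    [pullback_aff]. *)
Definition aff_pull (B : 'M[R]_n) (b : V) (w : pform R n p) : pform R n p :=
  fun x M => w (x *m B + b) (M *m B).

Lemma aff_pull_sum B b (I : Type) (s : seq I) (F : I -> pform R n p) :
  aff_pull B b (\sum_(i <- s) F i) = \sum_(i <- s) aff_pull B b (F i).
Proof.
elim: s => [|i s IH]; first by rewrite !big_nil.
by rewrite !big_cons -IH.
Qed.

Lemma trig_form_aff_pull l B b w : B *m B^T = 1%:M ->
  (forall u : V, canonical_lattice R n u -> canonical_lattice R n (u *m B^T)) ->
  is_trig_form l w -> is_trig_form l (aff_pull B b w).
Proof.
move=> BB Bl [r [-> mr fr]].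
have fB u : frequency l u -> frequency l (u *m B^T).
  move=> [ui <-]; split; first exact: Bl.
  by rewrite -dot_mulmx -mulmxA (mulmx1C BB) mulmx1.
have : forall t, List.In t r -> is_multilinear t.1 /\ frequency l t.2.
  by move=> t tr; split; [exact: mr|exact: fr].
rewrite (_ : aff_pull B b (trig_form r) =
  \sum_(t <- r) (fun x M => t.1 (M *m B) * cas t.2 (x *m B + b))); last first.
  apply/funext => x; apply/funext => M; rewrite /aff_pull /trig_form.
  by elim: r {mr fr} => [|t r IH]; rewrite ?big_nil ?big_cons // IH.
elim: r {mr fr} => [|t r IH] H; first by rewrite big_nil; exact: trig_form0.
rewrite big_cons; apply: trig_formD; last by apply: IH => s sr; apply: H; right.
have [mt ft] := H t (or_introl erefl).
rewrite (_ : (fun x M => _) =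
  (cos (2 * pi * dot t.2 b)) *: (fun x M => t.1 (M *m B) * cas (t.2 *m B^T) x)
  + (sin (2 * pi * dot t.2 b)) *: (fun x M => t.1 (M *m B) * cas (- (t.2 *m B^T)) x) :> pform R n p).
  apply: trig_formD; apply: trig_formZ; apply: trig_form1.
  - exact: multilinear_mulmx.
  - exact: fB.
  - exact: multilinear_mulmx.
  - exact/frequencyN/fB.
apply/funext => x; apply/funext => M; rewrite cas_aff.
rewrite -[RHS]/(_ * (_ * _) + _ * (_ * _)); ring.
Qed.

Lemma trig_form_row_perm l (s : 'S_p) w :
  is_trig_form l w -> is_trig_form l (fun x M => w x (row_perm s M)).
Proof.
move=> [r [-> mr fr]].
exists [seq ((fun M => t.1 (row_perm s M)), t.2) | t <- r]; split.
- by apply/funext => x; apply/funext => M; rewrite /trig_form big_map.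
- move=> t tin; have [t' [<- H]] := iffLR (List.in_map_iff _ r t) tin; have mt' := mr _ H; exact: multilinear_row_perm.
- by move=> t tin; have [t' [<- /fr]] := iffLR (List.in_map_iff _ r t) tin.
Qed.

Lemma trig_form_multilinear l w : is_trig_form l w -> forall x, is_multilinear (w x).
Proof.
move=> [r [-> mr _]] x i b d A B C rA rBC; rewrite /trig_form.
elim: r mr => [|t r IH] mr; first by rewrite !big_nil; ring.
rewrite !big_cons IH; last by move=> s sr; apply: mr; right.
by rewrite (mr t (or_introl erefl) i b d A B C rA rBC); ring.
Qed.

Lemma trig_form_smooth l w M : is_trig_form l w -> smooth (fun x => w x M).
Proof.
move=> [r [-> _ _]]; rewrite (_ : (fun x => _) = \sum_(t <- r) (t.1 M *: cas t.2)).
  by apply: smooth_sum => t; apply: smoothZ; exact: smooth_cas.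
by apply/funext => x; rewrite fct_sumE.
Qed.

Lemma trig_form_laplacian l w : is_trig_form l w -> laplacian w = l *: w.
Proof.
move=> [r [wE _ fr]]; apply/funext => x; apply/funext => M.
rewrite (@laplacian_trig _ _ _ _ r (fun t => t.1) (fun t => t.2) w); last by rewrite wE.
rewrite -[RHS]/(l * w x M) wE /trig_fun /trig_form.
elim: r fr {wE} => [|t r IH] fr; first by rewrite !big_nil mulr0.
rewrite !big_cons IH => [|s sr]; last by apply: fr; right.
have [_ ->] := fr t (or_introl erefl); ring.
Qed.

End TrigForms.

(** * The dimension formula for eigenforms *)

Section DimensionFormula.
Context {R : realType} {n : nat}.
Local Notation V := 'rV[R]_n.

(** The trace of [B] on the [p]-th exterior power, as the trace of [B] on all
    [p]-tensors followed by the alternation. *)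
Definition ext_trace (p : nat) (B : 'M[R]_n) : R :=
  (p`!%:R)^-1 * \sum_(s : 'S_p) (-1) ^+ s *
    \sum_(g : {ffun 'I_p -> 'I_n}) \prod_i B (g (s i)) (g i).

(** The trace of the pull-back by [aff B b] on the span of the waves with
    frequencies in [S], when [S] is stable under [B] and under opposites. *)
Definition wave_trace (S : seq V) (B : 'M[R]_n) (b : V) : R :=
  \sum_(u <- S) (u *m B^T == u)%:R * cos (2 * pi * dot u b).

Lemma pform_sumE p (I : Type) (r : seq I) (F : I -> pform R n p) x M :
  (\sum_(i <- r) F i) x M = \sum_(i <- r) F i x M.
Proof.
by elim: r => [|i r IH]; rewrite ?big_nil // !big_cons -IH.
Qed.

Lemma trig_form_periodic p l (w : pform R n p) : is_trig_form l w ->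
  forall x v M, canonical_lattice R n v -> w (x + v) M = w x M.
Proof.
move=> [r [-> _ fr]] x v M vi; rewrite /trig_form.
elim: r fr => [|t r IH] fr; first by rewrite !big_nil.
rewrite !big_cons IH => [|s sr]; last by apply: fr; right.
by have [ti _] := fr t (or_introl erefl); rewrite cas_periodic.
Qed.

Lemma big_seq_sub (T : choiceType) (S : seq T) (F : T -> R) : uniq S ->
  \sum_(u : seq_sub S) F (val u) = \sum_(u <- S) F u.
Proof.
move=> uS; rewrite -(big_map (fun u : seq_sub S => val u) xpredT F).
apply: perm_big; apply: uniq_perm => //.
  by rewrite map_inj_uniq ?index_enum_uniq //; exact: val_inj.
move=> u; apply/mapP/idP => [[v _ ->]|uS']; first exact: valP.
by exists (SeqSub uS') => //; exact: mem_index_enum.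
Qed.

(* [B h] runs over the linear parts of the elements of [G], each with one chosen
   translation part [b h]. Modulo lattice translations an element of [G]
   permutes the chosen representatives ([G_perm]). *)
Variables (p : nat) (G : isom_group R n) (H : finType).
Variables (B : H -> 'M[R]_n) (b : H -> V).
Hypothesis inG : forall h, isom_set G (aff (B h) (b h)).
Hypothesis orthB : forall h, B h *m (B h)^T = 1%:M.
Hypothesis latB : forall h (u : V),
  canonical_lattice R n u -> canonical_lattice R n (u *m (B h)^T).
Hypothesis H_pos : (0 < #|H|)%N.
Hypothesis G_perm : forall f, isom_set G f -> exists (C : 'M[R]_n) (c : V) (sg : H -> H),
  [/\ f = aff C c, injective sg & forall h, C *m B h = B (sg h) /\
      canonical_lattice R n (c *m B h + b h - b (sg h))].
Hypothesis transG : forall v, canonical_lattice R n v -> isom_set G (fun x => x + v).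
Variables (l : R) (S : seq V).
Hypothesis S_uniq : uniq S.
Hypothesis S_freq : forall u, u \in S <-> frequency l u.

Definition alt_form (w : pform R n p) : pform R n p := fun x => alternation (w x).

(** The projector onto the invariant alternating forms with frequencies in
    [S]: alternation followed by the average over the holonomy group. *)
Definition G_average (w : pform R n p) : pform R n p :=
  (#|H|%:R)^-1 *: \sum_h aff_pull (B h) (b h) (alt_form w).

Let T : finType := (seq_sub S * {ffun 'I_p -> 'I_n})%type.
(* The waves times the monomial forms are a basis of the forms with
   frequencies in [S]; Fourier coefficients on frames are the coordinates. *)
Let phi (t : T) : pform R n p := fun x M => monomial_form t.2 M * cas (val t.1) x.
Let kappa (t : T) (w : pform R n p) : R := fcoef (fun x => w x (frame t.2)) (val t.1).
Let E := @eigenforms R n p G l.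

Let freqS (u : seq_sub S) : frequency l (val u).
Proof. by apply/S_freq; exact: valP. Qed.

Let latS (u : seq_sub S) : canonical_lattice R n (val u).
Proof. by have [] := freqS u. Qed.

Let span_eval (c : T -> R) x M :
  (\sum_t c t *: phi t) x M = \sum_t c t * phi t x M.
Proof. by rewrite pform_sumE. Qed.

Let kappa_phi (c : T -> R) s : kappa s (\sum_t c t *: phi t) = c s.
Proof.
rewrite /kappa (_ : (fun x => _) =
    \sum_t (c t * (t.2 == s.2)%:R) *: cas (val t.1)); last first.
  apply/funext => x; rewrite span_eval fct_sumE; apply: eq_bigr => t _.
  by rewrite /phi monomial_frame [LHS]mulrA.
rewrite fcoef_sum; [|by move=> t; apply: torusZ; exact: torus_cas|exact: latS].
rewrite (bigD1 s) //= big1 => [|t ts].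
  rewrite (fcoefZ _ (torus_cas (latS s.1)) (latS s.1)).
  by rewrite (fcoef_cas (latS s.1) (latS s.1)) !eqxx !mulr1 addr0.
rewrite (fcoefZ _ (torus_cas (latS t.1)) (latS s.1)) (fcoef_cas (latS t.1) (latS s.1)).
rewrite -mulrA -natrM mulnb (_ : _ && _ = false) ?mulr0 //.
apply: contraNF ts => /andP[/eqP t2 /eqP t1].
by rewrite [t]surjective_pairing [s]surjective_pairing t2 (val_inj t1).
Qed.

Let quotient_periodic (w : pform R n p) : quotient_form G w -> forall M, lattice_periodic (fun x => w x M).
Proof.
move=> [_ Gw] M x v /transG Gv.
have := Gw _ Gv; rewrite (_ : (fun x => x + v) = aff 1%:M v).
  by move=> /(congr1 (fun w => w x M)); rewrite pullback_aff !mulmx1.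
by apply/funext => y; rewrite /aff mulmx1.
Qed.

(* An eigenform has no Fourier coefficients outside [S] by [fcoef_laplacian]
   and is therefore a finite sum of waves by [Fourier_expansion]. *)
Let E_span w : E w -> w = \sum_t kappa t w *: phi t.
Proof.
move=> [qw lw]; have pw := quotient_periodic qw.
have [[aw sw] _] := qw.
apply/funext => x; apply/funext => M; rewrite span_eval.
rewrite (multilinear_expansion M (aw x).1).
rewrite -(pair_bigA _ (fun u g => kappa (u, g) w * phi (u, g) x M)) exchange_big /=.
apply: eq_bigr => g _.
rewrite (@Fourier_expansion _ _ (fun x => w x (frame g)) S _ S_uniq); first last.
- move=> u ui uS; apply/eqP; have := fcoef_laplacian g sw pw ui.
  rewrite lw => /eqP.
  rewrite (fcoefZ l (smooth_torus (sw (frame g)) (pw (frame g))) ui).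
  rewrite -subr_eq0 -mulrBl mulf_eq0 => /orP[|//].
  by rewrite subr_eq0 => /eqP ul; case/negP: uS; apply/S_freq; split.
- by move=> u /S_freq[].
- exact: smooth_torus.
rewrite -(big_seq_sub (fun u => fcoef (fun x => w x (frame g)) u * cas u x)) //.
by rewrite mulr_suml; apply: eq_bigr => u _; rewrite /kappa /phi /= -mulrA [cas _ _ * _]mulrC.
Qed.

Let P_id w : E w -> G_average w = w.
Proof.
move=> [[[aw sw] Gw] _].
have aE : alt_form w = w.
  by apply/funext => x; apply/funext => M; exact: alternation_id.
rewrite /G_average aE (eq_bigr (fun=> w)) => [|h _].
  rewrite sumr_const -[w *+ _]scaler_nat scalerA mulVf ?scale1r //.
  by rewrite pnatr_eq0 -lt0n.
rewrite -[RHS](Gw _ (inG h)); apply/funext => x; apply/funext => M.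
by rewrite pullback_aff.
Qed.

Let alt_lin (c : T -> R) : alt_form (\sum_t c t *: phi t) = \sum_t c t *: alt_form (phi t).
Proof.
apply/funext => x; apply/funext => M; rewrite [RHS]pform_sumE.
rewrite /alt_form /alternation.
have Es (s : 'S_p) : (-1) ^+ s * (\sum_t c t *: phi t) x (row_perm s M) =
    \sum_t (-1) ^+ s * (c t * phi t x (row_perm s M)).
  by rewrite span_eval mulr_sumr.
rewrite (eq_bigr _ (fun s _ => Es s)) exchange_big mulr_sumr; apply: eq_bigr => t _ /=.
rewrite -[RHS]/(c t * (_ * _)) [RHS]mulrCA; congr (_ * _).
by rewrite mulr_sumr; apply: eq_bigr => s _; rewrite mulrCA.
Qed.

Let P_lin (c : T -> R) :
  G_average (\sum_t c t *: phi t) = \sum_t c t *: G_average (phi t).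
Proof.
rewrite /G_average alt_lin; under eq_bigr do rewrite aff_pull_sum.
rewrite exchange_big scaler_sumr; apply: eq_bigr => t _ /=.
rewrite [RHS]scalerA [c t * _]mulrC -[RHS]scalerA; congr (_ *: _).
by rewrite [RHS]scaler_sumr.
Qed.

Let trig_alt w : is_trig_form l w -> is_trig_form l (alt_form w).
Proof.
move=> tw; rewrite (_ : alt_form w = (p`!%:R)^-1 *: \sum_(s : 'S_p) ((-1) ^+ s *:
  (fun x M => w x (row_perm s M) : R)) :> pform R n p).
  by apply/trig_formZ/trig_form_sum => s; apply/trig_formZ/trig_form_row_perm.
by apply/funext => x; apply/funext => M; rewrite -[RHS]/(_ * _) pform_sumE.
Qed.

Let P_E (c : T -> R) : E (G_average (\sum_t c t *: phi t)).
Proof.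
set w := \sum_t _.
have tw : is_trig_form l w.
  apply: trig_form_sum => t; apply/trig_formZ/trig_form1 => //.
  exact: monomial_multilinear.
have ta := trig_alt tw.
have tP : is_trig_form l (G_average w).
  apply/trig_formZ/trig_form_sum => h; apply: (trig_form_aff_pull _ (orthB h) _ ta); exact: latB.
split; last exact: trig_form_laplacian tP.
split.
  split; last by move=> M; exact: trig_form_smooth tP.
  move=> x; split; first exact: trig_form_multilinear tP x.
  move=> A i j ij rA; rewrite /G_average -[LHS]/(_ * _) pform_sumE.
  rewrite big1 ?mulr0 // => h _; rewrite /aff_pull /alt_form.
  have [_ H0] := alternation_alternating (trig_form_multilinear tw (x *m B h + b h)).
  by apply: (H0 _ i j ij); rewrite !row_mul rA.
move=> f /G_perm[C [d [sg [-> sg_inj HC]]]].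
apply/funext => x; apply/funext => M; rewrite pullback_aff /G_average.
rewrite -[LHS]/(_ * _) -[RHS]/(_ * _) !pform_sumE; congr (_ * _).
rewrite [RHS](reindex_inj sg_inj); apply: eq_bigr => h _ /=.
rewrite /aff_pull; have [CB vi] := HC h.
rewrite -mulmxA CB -(trig_form_periodic ta (x *m B (sg h) + b (sg h)) _ vi).
by rewrite mulmxDl -mulmxA CB -!addrA [b (sg h) + _]addrC !addrA subrK.
Qed.

Let fcoef_cas_aff (u : V) h : frequency l u ->
  fcoef (fun x => cas u (x *m B h + b h)) u =
  (u *m (B h)^T == u)%:R * cos (2 * pi * dot u (b h)) +
  (- (u *m (B h)^T) == u)%:R * sin (2 * pi * dot u (b h)).
Proof.
move=> [ui _]; have Bi := latB h ui; have Bi' := latticeN Bi.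
rewrite (_ : (fun x => _) = cos (2 * pi * dot u (b h)) *: cas (u *m (B h)^T) +
    sin (2 * pi * dot u (b h)) *: cas (- (u *m (B h)^T))); last first.
  by apply/funext => x; rewrite cas_aff.
have t1 := torus_cas Bi; have t2 := torus_cas Bi'.
rewrite (fcoefD (torusZ _ t1) (torusZ _ t2) ui) (fcoefZ _ t1 ui) (fcoefZ _ t2 ui).
by rewrite !fcoef_cas // ![_%:R * _]mulrC.
Qed.

(* The sum over [u] and the sum over [- u] are opposite. *)
Let sin_cancel h :
  \sum_(u <- S) (- (u *m (B h)^T) == u)%:R * sin (2 * pi * dot u (b h)) = 0 :> R.
Proof.
set X := \sum_(u <- S) _.
have SN : perm_eq [seq - u | u <- S] S.
  apply: uniq_perm => //; first by rewrite map_inj_uniq //; exact: oppr_inj.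
  move=> u; apply/mapP/idP => [[v /S_freq/frequencyN/S_freq ? ->//]|/S_freq/frequencyN/S_freq ?].
  by exists (- u); rewrite ?opprK.
have : X = - X.
  rewrite {1}/X -(perm_big _ SN) big_map -sumrN; apply: eq_bigr => u _ /=.
  by rewrite mulNmx eqr_opp dotNl mulrN sinN mulrN.
by move/eqP; rewrite -addr_eq0 -mulr2n mulrn_eq0 => /eqP.
Qed.

(* Each diagonal coefficient is a product of a factor that depends on the
   frequency and one that depends on the monomial; the two sums separate. *)
Let G_average_trace : \sum_t kappa t (G_average (phi t)) =
  (#|H|%:R)^-1 * \sum_h wave_trace S (B h) (b h) * ext_trace p (B h).
Proof.
pose a h (g : {ffun 'I_p -> 'I_n}) := alternation (monomial_form g) (frame g *m B h).
have kE t : kappa t (G_average (phi t)) = (#|H|%:R)^-1 * \sum_h a h t.2 *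
   ((val t.1 *m (B h)^T == val t.1)%:R * cos (2 * pi * dot (val t.1) (b h)) +
  (- (val t.1 *m (B h)^T) == val t.1)%:R * sin (2 * pi * dot (val t.1) (b h))).
  have tc h : torus_fun (fun x : V => cas (val t.1) (x *m B h + b h)).
    rewrite (_ : (fun x => _) = cos (2 * pi * dot (val t.1) (b h)) *: cas (val t.1 *m (B h)^T) +
       sin (2 * pi * dot (val t.1) (b h)) *: cas (- (val t.1 *m (B h)^T))); last first.
      by apply/funext => x; rewrite cas_aff.
    by apply: torusD; apply: torusZ; apply: torus_cas; [|apply: latticeN]; exact: latB.
  rewrite /kappa (_ : (fun x => _) = (#|H|%:R)^-1 *:
    \sum_h (a h t.2 *: (fun x => cas (val t.1) (x *m B h + b h)))); last first.
    apply/funext => x; rewrite /G_average -[LHS]/(_ * _) -[RHS]/(_ * _) pform_sumE fct_sumE.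
    congr (_ * _); apply: eq_bigr => h _.
    rewrite /aff_pull /alt_form /phi /a -[RHS]/(_ * _) /alternation -mulrA; congr (_ * _).
    by rewrite mulr_suml; apply: eq_bigr => s _; rewrite mulrA.
  have ts : torus_fun (\sum_h (a h t.2 *: (fun x => cas (val t.1) (x *m B h + b h)))).
    rewrite (_ : \sum_h _ = fun x => \sum_h a h t.2 * cas (val t.1) (x *m B h + b h)).
      by apply: torus_sum => h; exact: torusZ.
    by apply/funext => x; rewrite fct_sumE.
  rewrite (fcoefZ _ ts (latS t.1)); congr (_ * _).
  rewrite fcoef_sum; [|by move=> h; exact: torusZ|exact: latS].
  apply: eq_bigr => h _.
  by rewrite (fcoefZ _ (tc h) (latS t.1)) fcoef_cas_aff.
rewrite (eq_bigr _ (fun t _ => kE t)) -mulr_sumr; congr (_ * _).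
rewrite exchange_big; apply: eq_bigr => h _ /=.
pose F (u : V) := (u *m (B h)^T == u)%:R * cos (2 * pi * dot u (b h)) +
  (- (u *m (B h)^T) == u)%:R * sin (2 * pi * dot u (b h)) : R.
rewrite -(pair_bigA _ (fun (u : seq_sub S) g => a h g * F (val u))) /=.
rewrite exchange_big /=; under eq_bigr do rewrite -mulr_sumr.
rewrite -mulr_suml big_seq_sub // /F big_split /=.
rewrite [X in _ + X]sin_cancel addr0 mulrC; congr (_ * _).
rewrite /ext_trace /a /alternation -mulr_sumr; congr (_ * _).
rewrite exchange_big; apply: eq_bigr => s _ /=; rewrite -mulr_sumr; congr (_ * _).
apply: eq_bigr => g _; apply: eq_bigr => i _; rewrite !mxE (bigD1 (g (s i))) //= big1 => [|j jg].
  by rewrite mxE eqxx mul1r addr0.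
by rewrite mxE (negbTE jg) mul0r.
Qed.

Lemma dimension_formula k : has_dim (@eigenforms R n p G l) k <->
  k%:R = (#|H|%:R)^-1 * \sum_h wave_trace S (B h) (b h) * ext_trace p (B h).
Proof.
rewrite -G_average_trace.
exact: (has_dim_projection kappa_phi P_lin E_span P_id P_E).
Qed.

Lemma eigenforms_finite_dim : exists k, has_dim (@eigenforms R n p G l) k.
Proof. exact: (has_dim_exists kappa_phi P_lin E_span P_id P_E). Qed.

End DimensionFormula.

(** * Isometries and signed permutations *)

Section Isometries.
Context {R : realType} {n : nat}.
Local Notation V := 'rV[R]_n.
Local Notation e_ := (basis_vec R n).

Lemma isometry_dot (f : V -> V) x y : is_isometry f ->
  dot (f x - f y) (f x - f y) = dot (x - y) (x - y).
Proof.
have distE (a c : V) : eucl_dist a c = Num.sqrt (dot (a - c) (a - c)).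
  by congr Num.sqrt; apply: eq_bigr => i _; rewrite !mxE expr2.
have dot_ge0 (a : V) : 0 <= dot a a.
  by apply: sumr_ge0 => i _; rewrite -expr2 sqr_ge0.
move=> /(_ x y); rewrite !distE => /eqP; rewrite eqr_sqrt ?dot_ge0 //.
by move=> /eqP.
Qed.

(** An isometry fixing the origin preserves the scalar product, by
    polarization, and is determined by its values on the orthonormal
    basis. *)
Lemma isometry_affine (f : V -> V) : is_isometry f ->
  exists2 B : 'M[R]_n, B *m B^T = 1%:M & f = aff B (f 0).
Proof.
move=> If; pose g x := f x - f 0.
have gg x y : dot (g x - g y) (g x - g y) = dot (x - y) (x - y).
  by rewrite /g opprB addrA subrK isometry_dot.
have g0 : g 0 = 0 by rewrite /g subrr.
have g1 x : dot (g x) (g x) = dot x x by have := gg x 0; rewrite g0 !subr0.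
have gd x y : dot (g x) (g y) = dot x y.
  have E (a c : V) : dot (a - c) (a - c) = dot a a + dot c c - 2 * dot a c.
    by rewrite dotDl !dotDr !dotNr dotNl [dot c a]dotC dotNl; ring.
  by have := gg x y; rewrite (E (g x) (g y)) (E x y) !g1 => /addrI /oppr_inj /mulfI; apply; rewrite pnatr_eq0.
pose B := \matrix_i g (e_ i).
have BT x j : (g x *m B^T) 0 j = x 0 j.
  rewrite -(dot_basis x j) -gd !mxE; apply: eq_bigr => i _.
  by rewrite !mxE.
have BB : B *m B^T = 1%:M.
  apply/row_matrixP => i; rewrite row_mul rowK; apply/rowP => j.
  by rewrite BT !mxE eqxx eq_sym.
exists B => //; apply/funext => x; rewrite /aff -[f x](subrK (f 0)) -/(g x).
congr (_ + _); rewrite -[LHS]mulmx1 -(mulmx1C BB) mulmxA; congr (_ *m _).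
by apply/rowP => j; rewrite BT.
Qed.

Lemma aff_comp (B C : 'M[R]_n) b c : aff C c \o aff B b = aff (B *m C) (b *m C + c).
Proof. by apply/funext => x; rewrite /aff /= mulmxDl mulmxA addrA. Qed.

Lemma aff_inj (B C : 'M[R]_n) b c : aff B b = aff C c -> B = C /\ b = c.
Proof.
move=> E; have bc : b = c by have := congr1 (fun f => f 0) E; rewrite /aff !mul0mx !add0r.
split => //; apply/row_matrixP => i; rewrite !rowE.
by have := congr1 (fun f => f (delta_mx 0 i)) E; rewrite /aff bc => /addIr.
Qed.

Lemma aff1 (b : V) : aff 1%:M b = (fun x => x + b).
Proof. by apply/funext => x; rewrite /aff mulmx1. Qed.

Section LatticeGroup.
Variable G : isom_group R n.
Hypothesis tG : translation_lattice G = canonical_lattice R n.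

Lemma transG v : canonical_lattice R n v -> isom_set G (fun x => x + v).
Proof. by rewrite -tG. Qed.

Lemma lattice_of_trans v : isom_set G (fun x => x + v) -> canonical_lattice R n v.
Proof. by rewrite -tG. Qed.

Lemma isom_group_affine f : isom_set G f ->
  exists B b, f = aff B b /\ B *m B^T = 1%:M.
Proof.
by move=> /isom_isometry /isometry_affine[B BB E]; exists B, (f 0).
Qed.

Lemma isom_group_inv B b : isom_set G (aff B b) -> B *m B^T = 1%:M ->
  isom_set G (aff B^T (- (b *m B^T))).
Proof.
move=> Gf BB; have [g [Gg fg gf]] := isom_inv Gf.
rewrite (_ : aff _ _ = g) //; apply/funext => x.
rewrite -{1}(gf x) /aff mulmxDl -mulmxA BB mulmx1 addrK //.
Qed.

(** Conjugating the translation by [v] gives the translation by [v *m B]. *)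
Lemma holonomy_lattice B b v : isom_set G (aff B b) -> B *m B^T = 1%:M ->
  canonical_lattice R n v -> canonical_lattice R n (v *m B).
Proof.
move=> Gf BB vi; apply: lattice_of_trans.
have := isom_comp (isom_comp Gf (transG vi)) (isom_group_inv Gf BB).
rewrite -aff1 !aff_comp !mul1mx (mulmx1C BB) aff1 (_ : _ + _ = v *m B) //.
by rewrite mulNmx -mulmxA (mulmx1C BB) mulmx1 addrCA addNr addr0.
Qed.

End LatticeGroup.

(** The value at [j] is the index of the only nonzero entry of column [j],
    with a flag for a negative sign; injectivity of the indices is
    [sp_mx_orthogonalP] below. *)
Definition signed_perm := {ffun 'I_n -> 'I_n * bool}.

Definition sp_mx (t : signed_perm) : 'M[R]_n :=
  \matrix_(i, j) if i == (t j).1 then (-1) ^+ (t j).2 else 0.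

Lemma sp_mx_inj : injective sp_mx.
Proof.
move=> s t st; apply/ffunP => j.
have := congr1 (fun A : 'M[R]_n => A (s j).1 j) st; rewrite !mxE eqxx.
case: eqP => [s1 s2|_ /eqP]; last by rewrite signr_eq0.
rewrite [s j]surjective_pairing [t j]surjective_pairing s1; congr (_, _).
exact: signr_inj s2.
Qed.

Lemma mul_sp_mx (x : V) t j : (x *m sp_mx t) 0 j = (-1) ^+ (t j).2 * x 0 (t j).1.
Proof.
rewrite mxE (bigD1 (t j).1) //= big1 ?addr0 => [|i it]; rewrite mxE ?eqxx ?(negbTE it).
  exact: mulrC.
exact: mulr0.
Qed.

Lemma int_unit_vector (x : 'I_n -> R) : (forall i, x i \is a Num.int) ->
  \sum_i x i ^+ 2 = 1 ->
  exists i, [/\ x i = 1 \/ x i = -1 & forall j, j != i -> x j = 0].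
Proof.
move=> xi x1.
have [i xi0] : exists i, x i != 0.
  apply/existsP; apply: contra_eqT x1; rewrite negb_exists => /forallP H.
  rewrite big1 1?eq_sym ?oner_eq0 // => i _.
  by have := H i; rewrite negbK => /eqP ->; rewrite expr0n.
have sq_ge1 j : x j != 0 -> 1 <= x j ^+ 2.
  move=> xj; rewrite -[x j ^+ 2]ger0_norm ?sqr_ge0 // normrX exprn_ege1 //.
  exact: norm_intr_ge1.
have rest0 : \sum_(j | j != i) x j ^+ 2 = 0.
  apply/eqP; rewrite eq_le sumr_ge0 ?andbT => [|j _]; last exact: sqr_ge0.
  by have := x1; rewrite (bigD1 i) //=; have := sq_ge1 _ xi0; lra.
exists i; split.
  have : x i ^+ 2 = 1 by have := x1; rewrite (bigD1 i) //= rest0 addr0.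
  by move=> /eqP; rewrite sqrf_eq1 => /orP[]/eqP->; [left|right].
move=> j ji; apply/eqP; rewrite -sqrf_eq0; move/eqP: rest0.
rewrite psumr_eq0 => [|k _]; last exact: sqr_ge0.
by move=> /allP/(_ j (mem_index_enum _)) /implyP; apply.
Qed.

(** Each column is an integral vector of length one. *)
Lemma integral_orthogonal_sp (B : 'M[R]_n) : B *m B^T = 1%:M ->
  (forall i j, B i j \is a Num.int) -> exists t, B = sp_mx t.
Proof.
move=> /mulmx1C BB Bi.
have col1 j : exists ib : 'I_n * bool, forall i,
    B i j = if i == ib.1 then (-1) ^+ ib.2 else 0.
  have [|i [Bij B0]] := @int_unit_vector (fun i => B i j) (fun i => Bi i j).
    have := congr1 (fun A : 'M[R]_n => A j j) BB; rewrite !mxE eqxx => E; apply: etrans E.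
    by apply: eq_bigr => i _; rewrite mxE expr2.
  exists (i, B i j != 1) => k /=; case: eqP => [->|/eqP/B0 //].
  by case: Bij => ->; rewrite ?eqxx // eq_sym -addr_eq0 -[1 + 1]/(2%:R) pnatr_eq0.
have [t tE] := choice col1.
exists [ffun j => t j]; apply/matrixP => i j.
by rewrite mxE ffunE tE.
Qed.

End Isometries.

(** * Eigenform multiplicities of a group with lattice of translations Z^n *)

Section Holonomy.
Context {R : realType} {n : nat}.
Local Notation V := 'rV[R]_n.
Variable G : isom_group R n.
Hypothesis tG : translation_lattice G = canonical_lattice R n.

Lemma isom_group_sp f : isom_set G f ->
  exists (t : signed_perm) b, f = aff (sp_mx t) b /\ sp_mx t *m (sp_mx t)^T = 1%:M :> 'M[R]_n.
Proof.
move=> Gf; have [B [b [fE BB]]] := isom_group_affine Gf; rewrite fE in Gf.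
have [t tE] : exists t, B = sp_mx t.
  apply: integral_orthogonal_sp => // i j.
  have /(_ j) := holonomy_lattice tG Gf BB (basis_lattice i).
  by rewrite -rowE mxE.
by exists t, b; rewrite -tE.
Qed.

Lemma sp_mx_orth t b : isom_set G (aff (sp_mx t) b) -> sp_mx t *m (sp_mx t)^T = 1%:M :> 'M[R]_n.
Proof.
by move=> /isom_group_sp[t' [b' [/aff_inj[/sp_mx_inj -> _]]]].
Qed.

Lemma translation_part_unique (B : 'M[R]_n) b1 b2 : B *m B^T = 1%:M ->
  isom_set G (aff B b1) -> isom_set G (aff B b2) -> canonical_lattice R n (b1 - b2).
Proof.
move=> BB G1 G2; apply: (lattice_of_trans tG).
have := isom_comp G1 (isom_group_inv G2 BB).
by rewrite aff_comp (mulmx1C BB) mulNmx -mulmxA (mulmx1C BB) mulmx1 aff1 addrC.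
Qed.

Definition holonomy : pred (@signed_perm n) :=
  fun t => `[< exists b, isom_set G (aff (sp_mx t) b) >].

(** The linear parts preserve the lattice, so they are signed permutations and
    there are finitely many; two elements with the same linear part differ by
    a lattice translation. Hence the sum over the holonomy group is
    defined by one representative of each linear part. The degree [p] enters
    only through [ext_trace] and the eigenvalue only through [wave_trace]. *)
Lemma holonomy_formula : exists (H : finType) (B : H -> @signed_perm n) (b : H -> V),
  [/\ (0 < #|H|)%N, forall h, isom_set G (aff (sp_mx (B h)) (b h)) &
   forall (p : nat) (l : R) (S : seq V), uniq S ->
     (forall u, u \in S <-> frequency l u) ->
     (exists k, has_dim (@eigenforms R n p G l) k) /\
     forall k, has_dim (@eigenforms R n p G l) k <->
       k%:R = (#|H|%:R)^-1 *
         \sum_h wave_trace S (sp_mx (B h)) (b h) * ext_trace p (sp_mx (B h))].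
Proof.
pose H : finType := {t | holonomy t}.
have /choice[b bG] : forall h : H, exists b, isom_set G (aff (sp_mx (val h)) b).
  by move=> h; exact: (asboolW (valP h)).
have orthB (h : H) : sp_mx (val h) *m (sp_mx (val h))^T = 1%:M :> 'M[R]_n.
  exact: sp_mx_orth (bG h).
have hol t c : isom_set G (aff (sp_mx t) c) -> holonomy t.
  by move=> Gt; apply/asboolP; exists c.
have latB (h : H) (u : V) : canonical_lattice R n u ->
    canonical_lattice R n (u *m (sp_mx (val h))^T).
  apply: (holonomy_lattice tG (isom_group_inv (bG h) (orthB h))).
  by rewrite trmxK; exact: mulmx1C.
have H_pos : (0 < #|H|)%N.
  have [t [c [tE _]]] := isom_group_sp (isom_id G).
  have Gt : isom_set G (aff (sp_mx t) c) by rewrite -tE; exact: isom_id.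
  by apply/card_gt0P; exists (exist _ t (hol t c Gt)).
exists H, val, b; split => // p l S uS Sf.
have G_perm f : isom_set G f -> exists (C : 'M[R]_n) (c : V) (sg : H -> H),
  [/\ f = aff C c, injective sg & forall h, C *m sp_mx (val h) = sp_mx (val (sg h)) /\
      canonical_lattice R n (c *m sp_mx (val h) + b h - b (sg h))].
  move=> Gf; have [t0 [c [fE CC]]] := isom_group_sp Gf; rewrite fE in Gf.
  set C : 'M[R]_n := sp_mx t0 in fE CC Gf.
  have comp h : isom_set G (aff (C *m sp_mx (val h)) (c *m sp_mx (val h) + b h)).
    by rewrite -aff_comp; apply: isom_comp.
  have /choice[sg sgE] : forall h : H, exists h' : H, C *m sp_mx (val h) = sp_mx (val h').
    move=> h; have [t [d [E tt]]] := isom_group_sp (comp h).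
    have Gt : isom_set G (aff (sp_mx t) d) by rewrite -E.
    by exists (exist _ t (hol t d Gt)); have [] := aff_inj E.
  exists C, c, sg; split => //.
    move=> h h' hh; apply: val_inj; apply: (@sp_mx_inj R).
    have := congr1 (mulmx C^T) (etrans (sgE h) (etrans (congr1 (fun h => sp_mx (val h)) hh) (esym (sgE h')))).
    by rewrite !mulmxA (mulmx1C CC) !mul1mx.
  move=> h; split => //; apply: (translation_part_unique (orthB (sg h))) => //.
  by rewrite -sgE.
have tr v := transG tG (v := v).
split.
  exact: (eigenforms_finite_dim p bG orthB latB H_pos G_perm tr uS Sf).
exact: (@dimension_formula R n p G H (fun h => sp_mx (val h)) b bG orthB latB H_pos G_perm tr l S uS Sf).
Qed.

End Holonomy.

(** * Conjugation by integral orthogonal matrices *)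

Section Similarity.
Context {R : realType} {n : nat}.
Local Notation V := 'rV[R]_n.

Definition integral_orthogonal (Q : 'M[R]_n) : Prop :=
  Q *m Q^T = 1%:M /\ forall i j, Q i j \is a Num.int.

Lemma integral_orthogonalM P Q :
  integral_orthogonal P -> integral_orthogonal Q -> integral_orthogonal (P *m Q).
Proof.
move=> [PP Pi] [QQ Qi]; split => [|i j].
  by rewrite trmx_mul -mulmxA (mulmxA Q) QQ mul1mx.
by rewrite mxE; apply: rpred_sum => k _; rewrite rpredM.
Qed.

Lemma integral_orthogonalT Q : integral_orthogonal Q -> integral_orthogonal Q^T.
Proof.
move=> [QQ Qi]; split => [|i j]; last by rewrite mxE.
by rewrite trmxK; exact: mulmx1C.
Qed.

Lemma integral_orthogonal_lattice Q v : integral_orthogonal Q ->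
  canonical_lattice R n v -> canonical_lattice R n (v *m Q).
Proof. by move=> [_ Qi] vi i; rewrite mxE; apply: rpred_sum => k _; rewrite rpredM. Qed.

Lemma orthogonal_fixed (B : 'M[R]_n) u : B *m B^T = 1%:M -> (u *m B^T == u) = (u *m B == u :> V).
Proof.
move=> BB; apply/eqP/eqP => uE.
  by rewrite -{1}uE -mulmxA (mulmx1C BB) mulmx1.
by rewrite -{1}uE -mulmxA BB mulmx1.
Qed.

Definition sphere (N : R) (S : seq V) : Prop :=
  uniq S /\ forall u, u \in S <-> canonical_lattice R n u /\ dot u u = N.

Lemma sphere_mulmx N S Q : sphere N S -> integral_orthogonal Q ->
  perm_eq [seq u *m Q | u <- S] S.
Proof.
move=> [uS Sf] iQ; have QQ := iQ.1.
have inj : injective (mulmx^~ Q : V -> V).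
  by move=> u v /(congr1 (mulmx^~ Q^T)); rewrite -!mulmxA QQ !mulmx1.
have dotQ P (u : V) : integral_orthogonal P -> dot (u *m P) (u *m P) = dot u u.
  by move=> [PP _]; rewrite dot_mulmx -mulmxA PP mulmx1.
apply: uniq_perm => //; first by rewrite map_inj_uniq.
move=> u; apply/mapP/idP => [[v /Sf[vi vN] ->]|/Sf[ui uN]].
  by apply/Sf; rewrite dotQ //; split => //; exact: integral_orthogonal_lattice.
have iQT := integral_orthogonalT iQ.
exists (u *m Q^T); last by rewrite -mulmxA (mulmx1C QQ) mulmx1.
by apply/Sf; rewrite dotQ //; split => //; exact: integral_orthogonal_lattice.
Qed.

(** Conjugation by an integral orthogonal matrix, followed by a change of the
    translation part that no wave fixed by the linear part can see: the
    phases of these waves change by integers. Shifting the origin and adding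
    lattice vectors are of this kind, but the relation is coarser. *)
Definition aff_similar (B : 'M[R]_n) (b : V) (B' : 'M[R]_n) (b' : V) : Prop :=
  exists Q, [/\ integral_orthogonal Q, Q *m B' = B *m Q &
    forall u, canonical_lattice R n u -> u *m B' = u -> dot u (b *m Q - b') \is a Num.int].

Lemma similar_conj Q B b B1 B' b' : integral_orthogonal Q -> Q *m B1 = B *m Q ->
  aff_similar B1 (b *m Q) B' b' -> aff_similar B b B' b'.
Proof.
move=> iQ QB [P [iP PB Pb]]; exists (Q *m P); split.
- exact: integral_orthogonalM.
- by rewrite -mulmxA PB mulmxA QB mulmxA.
- by move=> u ui uB; rewrite mulmxA; exact: Pb.
Qed.

Lemma cosD_int (s t : R) : t \is a Num.int -> cos (2 * pi * (s + t)) = cos (2 * pi * s).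
Proof.
move=> ti; have -> : 2 * pi * (s + t) = 2 * pi * s + 2 * pi * t by rewrite mulrDr.
by rewrite cosD (cos_int ti) (sin_int ti) mulr1 mulr0 subr0.
Qed.

Lemma wave_trace_similar N S B b B' b' : sphere N S -> B' *m B'^T = 1%:M ->
  aff_similar B b B' b' -> wave_trace S B b = wave_trace S B' b'.
Proof.
move=> sS BB' [Q [iQ QB Qb]].
have QQ := iQ.1.
rewrite /wave_trace -(perm_big _ (sphere_mulmx sS (integral_orthogonalT iQ))) big_map.
rewrite big_seq [RHS]big_seq; apply: eq_bigr => u uS.
have BE : B = Q *m B' *m Q^T by rewrite QB -mulmxA QQ mulmx1.
have -> : (u *m Q^T *m B^T == u *m Q^T) = (u *m B'^T == u).
  rewrite BE !trmx_mul trmxK !mulmxA -(mulmxA u) (mulmx1C QQ) mulmx1.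
  apply/eqP/eqP => [/(congr1 (mulmx^~ Q))|->//].
  by rewrite -!mulmxA (mulmx1C QQ) !mulmx1.
rewrite (orthogonal_fixed _ BB'); case: eqP => [uB|_]; last by rewrite !mul0r.
rewrite !mul1r -dot_mulmx -[b *m Q](subrK b') dotDr [_ + dot u b']addrC cosD_int //.
by apply: Qb => //; have [/(_ uS)[]] := sS.2 u.
Qed.

Lemma sp_mx_gram (t : @signed_perm n) i j : ((sp_mx t)^T *m sp_mx t) i j =
  if (t i).1 == (t j).1 then (-1) ^+ (t i).2 * (-1) ^+ (t j).2 else 0 :> R.
Proof.
rewrite mxE (bigD1 (t i).1) //= big1 => [|k ki].
  by rewrite !mxE eqxx addr0; case: eqP => // _; exact: mulr0.
by rewrite !mxE (negbTE ki) mul0r.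
Qed.

Lemma sp_mx_orthogonalP (t : @signed_perm n) :
  sp_mx t *m (sp_mx t)^T = 1%:M :> 'M[R]_n <-> injective (fun j => (t j).1).
Proof.
split=> [/mulmx1C tt i j /= ij|t_inj].
  apply/eqP; apply: contraT => nij.
  have := congr1 (fun A : 'M[R]_n => A i j) tt.
  rewrite sp_mx_gram ij eqxx mxE (negbTE nij) -signr_addb => /eqP.
  by rewrite signr_eq0.
apply: mulmx1C; apply/matrixP => i j; rewrite sp_mx_gram mxE (inj_eq t_inj).
by case: eqP => // ->; rewrite -signr_addb addbb.
Qed.

Lemma sp_mx_int (t : @signed_perm n) i j : (sp_mx t i j : R) \is a Num.int.
Proof. by rewrite mxE; case: ifP => _; rewrite ?rpred0 // rpredX // rpredN rpred1. Qed.

(** The conjugating matrix is itself a signed permutation, so that conjugation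
    permutes the basis tuples; the signs occur twice and cancel. *)
Lemma ext_trace_similar p B b B' b' : aff_similar B b B' b' ->
  ext_trace p B = ext_trace p B' :> R.
Proof.
move=> [Q [[QQ Qi] QB _]].
have [q qE] := integral_orthogonal_sp QQ Qi.
have QB' : B' = Q^T *m B *m Q by rewrite -mulmxA -QB mulmxA (mulmx1C QQ) mul1mx.
have Q1 i : Q (q i).1 i = (-1) ^+ (q i).2 by rewrite qE mxE eqxx.
have Q0 i k : k != (q i).1 -> Q k i = 0 by rewrite qE mxE => /negbTE ->.
have entry i j : B' i j = (-1) ^+ (q i).2 * (-1) ^+ (q j).2 * B (q i).1 (q j).1.
  have e1 (C : 'M[R]_n) k : (C *m Q) k j = (-1) ^+ (q j).2 * C k (q j).1.
    have -> : (C *m Q) k j = (row k C *m Q) 0 j by rewrite -row_mul [RHS]mxE.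
    by rewrite qE mul_sp_mx mxE.
  rewrite QB' -mulmxA mxE (bigD1 (q i).1) //= big1 => [|k ki].
    by rewrite (e1 B) [Q^T _ _]mxE Q1 addr0 mulrA.
  by rewrite [Q^T _ _]mxE Q0 ?mul0r.
have q_inj : injective (fun i => (q i).1) by apply/sp_mx_orthogonalP; rewrite -qE.
rewrite /ext_trace; congr (_ * _); apply: eq_bigr => s _; congr (_ * _).
pose F (g : {ffun 'I_p -> 'I_n}) := [ffun i => (q (g i)).1].
have F_inj : injective F.
  move=> g h /ffunP gh; apply/ffunP => i; apply: q_inj.
  by have := gh i; rewrite !ffunE.
rewrite (reindex_inj F_inj); apply: eq_bigr => g _ /=.
under [RHS]eq_bigr do rewrite entry.
have E : \prod_i (-1) ^+ (q (g (s i))).2 = \prod_i (-1) ^+ (q (g i)).2 :> R.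
  by rewrite [RHS](reindex_inj (@perm_inj _ s)).
rewrite !big_split /= E -big_split /=.
rewrite [X in _ = X * _]big1 => [|i _]; last by rewrite /= -signr_addb addbb.
by rewrite mul1r; apply: eq_bigr => i _; rewrite !ffunE.
Qed.

End Similarity.

(** * Torsion-free groups of isometries *)

Section Crystal.
Context {R : realType} {n : nat}.
Local Notation V := 'rV[R]_n.
Implicit Types (Gam : set (V -> V)) (B Q : 'M[R]_n) (b v : V).

(** The part of the group structure on which the classification rests, stated
    for sets of maps so that it is easily carried along conjugations. *)
Definition crystal Gam : Prop :=
  [/\ forall f g, Gam f -> Gam g -> Gam (f \o g),
      forall v, Gam (fun x => x + v) <-> canonical_lattice R n v &
      forall f k, Gam f -> (0 < k)%N -> iter k f = id -> f = id].

Lemma crystal_isom_group (G : isom_group R n) : torsion_free G ->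
  translation_lattice G = canonical_lattice R n -> crystal (isom_set G).
Proof.
move=> tf tG; split; first exact: isom_comp.
  by move=> v; rewrite -tG.
exact: tf.
Qed.

Definition conjugate_set Q Gam : set (V -> V) :=
  fun f => Gam (fun x => f (x *m Q) *m Q^T).

Lemma crystal_conj Q Gam : integral_orthogonal Q -> crystal Gam ->
  crystal (conjugate_set Q Gam).
Proof.
move=> iQ [Gc Gt Gf]; have QQ := iQ.1; have iQT := integral_orthogonalT iQ.
have QK (v : V) : v *m Q^T *m Q = v by rewrite -mulmxA (mulmx1C QQ) mulmx1.
have QK' (v : V) : v *m Q *m Q^T = v by rewrite -mulmxA QQ mulmx1.
split.
- move=> f g Gf1 Gg1; rewrite /conjugate_set.
  rewrite (_ : (fun x => _) =
    (fun x => f (x *m Q) *m Q^T) \o (fun x => g (x *m Q) *m Q^T)); first exact: Gc.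
  by apply/funext => x; rewrite /= QK.
- move=> v; rewrite /conjugate_set.
  rewrite (_ : (fun x => _) = (fun x => x + v *m Q^T)); last first.
    by apply/funext => x; rewrite mulmxDl QK'.
  rewrite Gt; split => vi; last exact: integral_orthogonal_lattice.
  by rewrite -(QK v); exact: integral_orthogonal_lattice.
- move=> f k Gf1 k0 fk; have := Gf _ _ Gf1 k0.
  have E j x : iter j (fun x => f (x *m Q) *m Q^T) x = iter j f (x *m Q) *m Q^T.
    by elim: j => [|j IH]; [rewrite /= QK'|rewrite !iterS IH QK].
  rewrite (_ : iter k _ = id); last by apply/funext => x; rewrite E fk QK'.
  move=> /(_ erefl) fE; apply/funext => x.
  have := congr1 (fun h => h (x *m Q^T) *m Q) fE.
  by rewrite /= QK QK.
Qed.

Lemma conjugate_set_aff Q Gam B b B' : integral_orthogonal Q -> Q *m B' = B *m Q ->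
  Gam (aff B b) -> conjugate_set Q Gam (aff B' (b *m Q)).
Proof.
move=> [QQ _] QB; rewrite /conjugate_set (_ : (fun x => _) = aff B b) //.
apply/funext => x; rewrite /aff -mulmxA QB mulmxA -mulmxDl -mulmxA QQ mulmx1 //.
Qed.

Lemma iter_aff B b k x :
  iter k (aff B b) x = iter k (mulmx^~ B) x + iter k (aff B b) 0.
Proof.
elim: k => [|k IH]; first by rewrite addr0.
by rewrite !iterS IH /aff mulmxDl -addrA.
Qed.

Variable Gam : set (V -> V).
Hypothesis cG : crystal Gam.

Lemma crystal_iter f k : Gam f -> Gam (iter k f).
Proof.
have [Gc Gt _] := cG => Gf; elim: k => [|k IH].
  by rewrite (_ : iter 0 f = fun x => x + 0); [apply/Gt; exact: lattice0|apply/funext => x; rewrite addr0].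
exact: Gc.
Qed.

Lemma crystal_power B b m : Gam (aff B b) -> iter m (mulmx^~ B) =1 (id : V -> V) ->
  canonical_lattice R n (iter m (aff B b) 0).
Proof.
have [_ Gt _] := cG => GB Bm; apply/Gt.
have E : iter m (aff B b) = fun x => x + iter m (aff B b) 0.
  by apply/funext => x; rewrite iter_aff Bm.
by rewrite -E; exact: crystal_iter.
Qed.

(** The map [f = aff B (b + lam)] belongs to [Gam], and [f] iterated [m] times
    is the translation by a vector [c] that is fixed by [B]. All iterates of
    the origin are orthogonal to the fixed vectors of [B], so [c] is
    orthogonal to itself, [f] is a torsion element, and [f] is the
    identity. *)
Lemma crystal_fixed_point_free B b m lam : B *m B^T = 1%:M -> Gam (aff B b) ->
  (0 < m)%N -> iter m (mulmx^~ B) =1 (id : V -> V) -> canonical_lattice R n lam ->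
  (forall v, v *m B = v -> dot v (b + lam) = 0) -> B = 1%:M.
Proof.
have [Gc Gt Gf] := cG => BB GB m0 Bm li Hd.
have GB' : Gam (aff B (b + lam)).
  rewrite (_ : aff _ _ = (fun x => x + lam) \o aff B b).
    by apply: Gc => //; apply/Gt.
  by apply/funext => x; rewrite /aff /= addrA.
set f := aff B (b + lam) in GB'; pose c := iter m f 0.
have fm x : iter m f x = x + c by rewrite iter_aff Bm.
have cB : c *m B = c.
  have : f (iter m f 0) = iter m f (f 0) by rewrite -iterS iterSr.
  rewrite !fm /f /aff add0r mul0mx add0r [RHS]addrC; exact: addIr.
(* [c] is fixed by [B], so it is orthogonal to [b + lam]. *)
have dk k : dot c (iter k f 0) = 0.
  elim: k => [|k IH]; first exact: dot0r.
  rewrite iterS {1}/f /aff dotDr Hd // addr0 dot_mulmx.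
  by have /eqP -> : c *m B^T == c by rewrite orthogonal_fixed // cB.
have c0 : c = 0 by apply/eqP; rewrite -dot_eq0; apply/eqP/dk.
have /aff_inj[] // : f = aff 1%:M 0.
rewrite (Gf f m GB' m0); first by rewrite aff1; apply/funext => x; rewrite addr0.
by apply/funext => x; rewrite fm c0 addr0.
Qed.

End Crystal.

(** * Signed permutations of four coordinates as lists *)

(** The values of a signed permutation in a list, so that the conjugacy classes
    of the 384 signed permutations can be found by evaluation. *)
Definition spcode := seq (nat * bool).

Definition code_at (c : spcode) (i : nat) : nat * bool := nth (0%N, false) c i.

Definition compose (c d : spcode) : spcode :=
  [seq ((code_at c x.1).1, (code_at c x.1).2 (+) x.2) | x <- d].

Definition id_code : spcode := [:: (0, false); (1, false); (2, false); (3, false)]%N.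

Definition pow_code (c : spcode) (m : nat) : spcode := iter m (fun d => compose d c) id_code.

Definition valid_code (c : spcode) : bool :=
  [&& size c == 4%N, all (fun x => x.1 < 4)%N c & uniq [seq x.1 | x <- c]].

Definition code_items : seq (nat * bool) :=
  [seq (k, e) | k <- iota 0 4, e <- [:: false; true]].

Definition all_codes : seq spcode :=
  [seq c <- [seq a :: c | a <- code_items,
             c <- [seq b :: c | b <- code_items,
             c <- [seq a :: c | a <- code_items, c <- [seq [:: b] | b <- code_items]]]]
   | valid_code c].

Definition p_ (k : nat) : nat * bool := (k, false).
Definition m_ (k : nat) : nat * bool := (k, true).

(** Together with the identity, [free_forms] and [excluded_forms] represent the
    20 conjugacy classes of the hyperoctahedral group of rank 4. The
    [excluded_forms] do not occur in torsion-free groups with lattice of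
    translations Z^4, see [excluded_form]. *)
Definition free_forms : seq spcode :=
  [:: [:: p_ 0; p_ 1; p_ 2; m_ 3]; [:: p_ 1; p_ 0; p_ 2; p_ 3];
      [:: p_ 0; p_ 1; m_ 2; m_ 3]; [:: p_ 0; p_ 1; m_ 3; p_ 2];
      [:: p_ 1; p_ 0; p_ 2; m_ 3]; [:: p_ 1; p_ 2; p_ 0; p_ 3];
      [:: p_ 0; m_ 1; m_ 2; m_ 3]; [:: p_ 0; m_ 1; m_ 3; p_ 2];
      [:: p_ 0; m_ 2; m_ 3; m_ 1]; [:: p_ 1; p_ 0; m_ 3; p_ 2]].

Definition excluded_forms : seq spcode :=
  [:: [:: p_ 1; p_ 0; p_ 3; p_ 2]; [:: p_ 1; p_ 0; m_ 2; m_ 3];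
      [:: p_ 1; p_ 2; p_ 0; m_ 3]; [:: p_ 1; p_ 2; p_ 3; p_ 0];
      [:: m_ 0; m_ 1; m_ 2; m_ 3]; [:: m_ 1; p_ 0; m_ 2; m_ 3];
      [:: m_ 1; p_ 0; m_ 3; p_ 2]; [:: m_ 1; m_ 2; m_ 0; m_ 3];
      [:: m_ 1; p_ 2; p_ 3; p_ 0]].

Definition normal_forms := id_code :: free_forms ++ excluded_forms.

(** The candidate for the conjugate of [c] by [q], where [q'] inverts [q]; that
    it is the conjugate is tested in [conjugate_to_forms]. *)
Definition conj_code (q c : spcode) : spcode :=
  let ks := [seq x.1 | x <- q] in
  let q' := [seq (index i ks, (code_at q (index i ks)).2) | i <- iota 0 4] in
  compose (compose q' c) q.

(** The search for a conjugator by [find] stops at the first one that leads to a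
    listed form, which keeps the evaluation short. *)
Definition conjugate_to_forms (forms cs : seq spcode) : bool :=
  all (fun c => find (fun q => let d := conj_code q c in
    if d \in forms then compose q d == compose c q else false) cs < size cs)%N cs.

Lemma conjugacy_check : conjugate_to_forms normal_forms all_codes.
Proof. by vm_compute. Qed.

Section Codes.
Context {R : realType}.
Local Notation V := 'rV[R]_4.

Definition sp_of (c : spcode) : @signed_perm 4 :=
  [ffun j : 'I_4 => (inord (code_at c j).1, (code_at c j).2)].

Definition cmx (c : spcode) : 'M[R]_4 := sp_mx (sp_of c).

Definition co (x : V) (i : nat) : R := x 0 (inord i).

Lemma co_cmx x c i : (i < 4)%N ->
  co (x *m cmx c) i = (-1) ^+ (code_at c i).2 * co x (code_at c i).1.
Proof. by move=> i4; rewrite /co mul_sp_mx ffunE inordK. Qed.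

Lemma co_aff x c b i : (i < 4)%N ->
  co (aff (cmx c) b x) i = (-1) ^+ (code_at c i).2 * co x (code_at c i).1 + co b i.
Proof. by move=> i4; rewrite -co_cmx // /co mxE. Qed.

Lemma co_eq (x y : V) : (forall i, (i < 4)%N -> co x i = co y i) -> x = y.
Proof.
move=> xy; apply/rowP => j; have := xy j (ltn_ord j).
by rewrite /co inord_val.
Qed.

Lemma valid_sub c i : valid_code c -> (i < 4)%N -> ((code_at c i).1 < 4)%N.
Proof. by move=> /and3P[/eqP sc /allP cl _] i4; apply: cl; rewrite mem_nth // sc. Qed.

Lemma cmx_compose c d : valid_code d -> cmx (compose c d) = cmx c *m cmx d.
Proof.
move=> vd; apply/row_matrixP => r; rewrite !rowE mulmxA; apply: co_eq => i i4.
have sd : size d = 4%N by case/and3P: vd => /eqP.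
rewrite !co_cmx //; last exact: valid_sub.
rewrite /code_at /compose (nth_map (0%N, false)) ?sd //=.
by rewrite signr_addb mulrA [X in X * _]mulrC.
Qed.

Lemma cmx_id : cmx id_code = 1%:M.
Proof.
apply/row_matrixP => r; rewrite !rowE mulmx1; apply: co_eq => -[|[|[|[|//]]]] _;
by rewrite co_cmx //= expr0 mul1r.
Qed.

Lemma valid_integral_orthogonal c : valid_code c -> integral_orthogonal (cmx c).
Proof.
move=> /[dup] vc /and3P[/eqP sc _ uc]; split; last exact: sp_mx_int.
apply/sp_mx_orthogonalP => i j /(congr1 val).
rewrite !ffunE /= !inordK; [|exact: valid_sub|exact: valid_sub] => E.
apply/val_inj/eqP.
have ltc (k : 'I_4) : (k < size c)%N by rewrite sc.
rewrite -(nth_uniq 0%N _ _ uc) ?size_map ?ltc //; apply/eqP.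
by rewrite (nth_map (0%N, false) _ _ (ltc i)) (nth_map (0%N, false) _ _ (ltc j)).
Qed.

Lemma pow_codeP c m : valid_code c -> pow_code c m == id_code ->
  iter m (mulmx^~ (cmx c)) =1 (id : V -> V).
Proof.
move=> vc /eqP cm x.
have E : iter m (mulmx^~ (cmx c)) x = x *m cmx (pow_code c m).
  rewrite /pow_code; elim: m {cm} => [|m IH]; first by rewrite cmx_id mulmx1.
  by rewrite !iterS IH cmx_compose // mulmxA.
by rewrite E cm cmx_id mulmx1.
Qed.

Lemma cmx_eq1 c : valid_code c -> cmx c = 1%:M -> c = id_code.
Proof.
move=> vc; rewrite -cmx_id => /sp_mx_inj /ffunP E.
have sc : size c = 4%N by case/and3P: vc => /eqP.
apply: (@eq_from_nth _ (0%N, false)) => [|i]; rewrite sc // => i4.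
have := E (inord i); rewrite !ffunE /= inordK // => -[/(congr1 val) /= e1 e2].
rewrite -/(code_at c i) -/(code_at id_code i).
rewrite [LHS]surjective_pairing [RHS]surjective_pairing e2; congr (_, _).
by move: e1; rewrite !inordK //; exact: valid_sub.
Qed.

Definition code_of (t : @signed_perm 4) : spcode :=
  [seq ((t j).1 : nat, (t j).2) | j <- [:: inord 0; inord 1; inord 2; inord 3]].

Lemma code_ofK t : sp_of (code_of t) = t.
Proof.
apply/ffunP => j; rewrite ffunE; case: j => -[|[|[|[|//]]]] jl;
by rewrite /code_of /code_at /= inord_val [RHS]surjective_pairing;
  congr ((t _).1, (t _).2); apply: val_inj; rewrite /= inordK.
Qed.

Lemma code_of_mem t : sp_mx t *m (sp_mx t)^T = 1%:M :> 'M[R]_4 -> code_of t \in all_codes.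
Proof.
move=> tt.
pose f (j : 'I_4) := ((t j).1 : nat, (t j).2).
have items j : f j \in code_items.
  apply/allpairsP; exists ((t j).1 : nat, (t j).2); split => //.
    by rewrite mem_iota; exact: ltn_ord.
  by case: ((t j).2).
have t_inj := (sp_mx_orthogonalP t).1 tt.
rewrite mem_filter; apply/andP; split.
  apply/and3P; split => //; first by rewrite /= !ltn_ord.
  rewrite /code_of -map_comp (_ : map _ _ = map val (map (fun j => (t j).1)
    [:: inord 0; inord 1; inord 2; inord 3])); last by rewrite -map_comp.
  rewrite (map_inj_uniq val_inj) map_inj_uniq; last exact: t_inj.
  by rewrite /= !inE -!val_eqE /= !inordK.
apply/allpairsP; exists (f (inord 0), [:: f (inord 1); f (inord 2); f (inord 3)]).
split; [exact: items| |by []]; apply/allpairsP; exists (f (inord 1), [:: f (inord 2); f (inord 3)]).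
split; [exact: items| |by []]; apply/allpairsP; exists (f (inord 2), [:: f (inord 3)]).
split; [exact: items| |by []]; apply/mapP; exists (f (inord 3)) => //; exact: items.
Qed.

Lemma valid_all c : c \in all_codes -> valid_code c.
Proof. by rewrite mem_filter => /andP[]. Qed.

Lemma conjugate_to_normal c : c \in all_codes -> exists q d,
  [/\ q \in all_codes, d \in normal_forms & compose q d = compose c q].
Proof.
move=> /(allP conjugacy_check); rewrite -has_find => /hasP[q qa /=].
case: ifP => // dn /eqP E; by exists q, (conj_code q c).
Qed.

End Codes.

(** * Similarity types of group elements *)

(** Linear parts with translation parts in twelfths, which suffices because
    the linear parts that occur have orders 1, 2, 3, 4 and 6. *)
Definition canonical_types : seq (spcode * seq nat) :=
  [:: (id_code, [:: 0; 0; 0; 0]);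
      ([:: p_ 0; p_ 1; p_ 2; m_ 3], [:: 6; 0; 0; 0]);
      ([:: p_ 0; p_ 1; p_ 2; m_ 3], [:: 6; 6; 0; 0]);
      ([:: p_ 0; p_ 1; p_ 2; m_ 3], [:: 6; 6; 6; 0]);
      ([:: p_ 1; p_ 0; p_ 2; p_ 3], [:: 0; 0; 6; 0]);
      ([:: p_ 1; p_ 0; p_ 2; p_ 3], [:: 0; 0; 6; 6]);
      ([:: p_ 0; p_ 1; m_ 2; m_ 3], [:: 6; 0; 0; 0]);
      ([:: p_ 0; p_ 1; m_ 2; m_ 3], [:: 6; 6; 0; 0]);
      ([:: p_ 0; p_ 1; m_ 3; p_ 2], [:: 3; 0; 0; 0]);
      ([:: p_ 0; p_ 1; m_ 3; p_ 2], [:: 3; 6; 0; 0]);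
      ([:: p_ 0; p_ 1; m_ 3; p_ 2], [:: 3; 3; 0; 0]);
      ([:: p_ 1; p_ 0; p_ 2; m_ 3], [:: 0; 0; 6; 0]);
      ([:: p_ 1; p_ 2; p_ 0; p_ 3], [:: 0; 0; 0; 4]);
      ([:: p_ 0; m_ 1; m_ 2; m_ 3], [:: 6; 0; 0; 0]);
      ([:: p_ 0; m_ 1; m_ 3; p_ 2], [:: 3; 0; 0; 0]);
      ([:: p_ 0; m_ 2; m_ 3; m_ 1], [:: 2; 0; 0; 0]);
      ([:: p_ 1; p_ 0; m_ 3; p_ 2], [:: 6; 0; 0; 0])]%N.

Section Classification.
Context {R : realType}.
Local Notation V := 'rV[R]_4.
Local Notation int r := ((r : R) \is a Num.int).

Definition vec4 (a0 a1 a2 a3 : R) : V := \row_j nth 0 [:: a0; a1; a2; a3] j.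

Definition zvec (z : seq nat) : V := \row_j ((nth 0%N z j)%:R / 12).

Lemma co_vec4 a0 a1 a2 a3 i : (i < 4)%N -> co (vec4 a0 a1 a2 a3) i = nth 0 [:: a0; a1; a2; a3] i.
Proof. by move=> i4; rewrite /co mxE inordK. Qed.

Lemma co_zvec z i : (i < 4)%N -> co (zvec z) i = (nth 0%N z i)%:R / 12.
Proof. by move=> i4; rewrite /co mxE inordK. Qed.

Lemma coD (x y : V) i : co (x + y) i = co x i + co y i.
Proof. by rewrite /co mxE. Qed.

Lemma coN (x : V) i : co (- x) i = - co x i.
Proof. by rewrite /co mxE. Qed.

Lemma co0 i : co (0 : V) i = 0.
Proof. by rewrite /co mxE. Qed.

Lemma dot4 (u x : V) : dot u x =
  co u 0 * co x 0 + co u 1 * co x 1 + co u 2 * co x 2 + co u 3 * co x 3.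
Proof.
rewrite /dot !big_ord_recl big_ord0 addr0 !addrA /co.
by repeat (congr (_ + _)); congr (u _ _ * x _ _); apply: val_inj; rewrite /= inordK.
Qed.

Definition code_fixed (c : spcode) (v : V) : Prop := forall i, (i < 4)%N ->
  co v i = (-1) ^+ (code_at c i).2 * co v (code_at c i).1.

Lemma code_fixedP c v : v *m cmx c = v -> code_fixed c v.
Proof. by move=> vc i i4; rewrite -co_cmx // vc. Qed.

Lemma fractional_part12 (d k : nat) (t : R) : (d * k = 12)%N -> int (d%:R * t) ->
  exists2 r, (r < d)%N & int (t - (r * k)%:R / 12).
Proof.
move=> dk /intrP[m mE]; have d0 : (0 < d)%N by case: d dk {mE}.
have k0 : (0 < k)%N by case: k dk {mE} => //; rewrite muln0.
have mp : (0 <= m %% d%:Z)%Z by rewrite modz_ge0 // eqz_nat -lt0n.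
exists `|(m %% d%:Z)%Z|%N.
  by rewrite -ltz_nat gez0_abs // ltz_pmod // ltz_nat.
apply/intrP; exists (m %/ d%:Z)%Z.
have d0R : d%:R != 0 :> R by rewrite pnatr_eq0 -lt0n.
have k0R : k%:R != 0 :> R by rewrite pnatr_eq0 -lt0n.
have -> : 12 = d%:R * k%:R :> R by rewrite -natrM dk.
rewrite natrM -mulf_div divff // mulr1.
have aE : (`|(m %% d%:Z)%Z|%N)%:R = (m %% d%:Z)%Z%:~R :> R.
  by rewrite -[in RHS](gez0_abs mp).
rewrite aE; apply: (mulfI d0R); rewrite mulrBr mE mulrCA divff // mulr1.
by rewrite {1}(divz_eq m d%:Z) intrD intrM addrK mulrC.
Qed.

Variable Gam : set (V -> V).
Hypothesis cG : crystal Gam.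

Lemma crystal_coord c b m i : Gam (aff (cmx c) b) -> valid_code c ->
  pow_code c m == id_code -> int (co (iter m (aff (cmx c) b) 0) i).
Proof. by move=> Gc vc cm; exact: (crystal_power cG Gc (pow_codeP vc cm)). Qed.

Lemma crystal_pow_code c b k d : Gam (aff (cmx c) b) -> valid_code c ->
  pow_code c k == d -> Gam (aff (cmx d) (iter k (aff (cmx c) b) 0)).
Proof.
move=> Gc vc /eqP <-.
have <- : iter k (aff (cmx c) b) = aff (cmx (pow_code c k)) (iter k (aff (cmx c) b) 0).
  apply/funext => x; rewrite iter_aff /aff; congr (_ + _).
  rewrite /pow_code; elim: k => [|k IH]; first by rewrite cmx_id mulmx1.
  by rewrite !iterS IH cmx_compose // mulmxA.
exact: (crystal_iter cG).
Qed.

(** The contrapositive of [crystal_fixed_point_free] in coordinates: a lattice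
    vector [a] that moves the translation part into the orthogonal complement
    of the fixed space is a contradiction, unless the linear part is the
    identity. *)
Lemma crystal_no_fixed c b m a0 a1 a2 a3 : Gam (aff (cmx c) b) -> valid_code c ->
  (0 < m)%N -> pow_code c m == id_code -> c != id_code ->
  int a0 -> int a1 -> int a2 -> int a3 ->
  (forall v, code_fixed c v -> co v 0 * (co b 0 + a0) + co v 1 * (co b 1 + a1) +
    co v 2 * (co b 2 + a2) + co v 3 * (co b 3 + a3) = 0) -> False.
Proof.
move=> Gc vc m0 cm cid i0 i1 i2 i3 Hv.
have [cc _] := valid_integral_orthogonal (R := R) vc.
case/eqP: cid; apply: (@cmx_eq1 R) => //.
apply: (crystal_fixed_point_free (lam := vec4 a0 a1 a2 a3) cG cc Gc m0 (pow_codeP vc cm)).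
  by move=> j; rewrite mxE; case: j => -[|[|[|[|//]]]].
move=> v /code_fixedP /Hv <-; rewrite dot4 !coD.
by rewrite !co_vec4.
Qed.

(** Conjugation by a signed permutation [q] that commutes with the linear part
    permutes and reflects the components of the translation part. *)
Lemma similar_code c q z (b : V) : valid_code c -> valid_code q ->
  compose q c == compose c q ->
  (forall u : V, (forall i, int (co u i)) -> code_fixed c u ->
    int (co u 0 * (co (b *m cmx q) 0 - (nth 0%N z 0)%:R / 12) +
         co u 1 * (co (b *m cmx q) 1 - (nth 0%N z 1)%:R / 12) +
         co u 2 * (co (b *m cmx q) 2 - (nth 0%N z 2)%:R / 12) +
         co u 3 * (co (b *m cmx q) 3 - (nth 0%N z 3)%:R / 12))) ->
  aff_similar (cmx c) b (cmx c) (zvec z).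
Proof.
move=> vc vq /eqP qc Hu; exists (cmx q); split.
- exact: valid_integral_orthogonal.
- by rewrite -!cmx_compose // qc.
- move=> u ui /code_fixedP uc; rewrite dot4 !coD !coN !co_zvec //.
  by apply: Hu => // i; exact: ui.
Qed.

Definition has_type c b : Prop :=
  exists2 t, t \in canonical_types & aff_similar (cmx c) b (cmx t.1) (zvec t.2).

End Classification.

(** * Classification of the elements of torsion-free groups *)

Section Forms.
Context {R : realType}.
Local Notation V := 'rV[R]_4.
Local Notation int r := ((r : R) \is a Num.int).
Variable Gam : set (V -> V).
Hypothesis cG : crystal Gam.
Variable b : V.
Local Notation b0 := (co b 0).
Local Notation b1 := (co b 1).
Local Notation b2 := (co b 2).
Local Notation b3 := (co b 3).

(** If the linear part has order dividing [m], the [m]-th power of the element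
    is a lattice translation. Its components are the signed sums of the
    translation part along the orbits of the coordinates. *)
Lemma power_coord c m i (e : R) : valid_code c -> pow_code c m == id_code ->
  Gam (aff (cmx c) b) -> co (iter m (aff (cmx c) b) 0) i = e -> int e.
Proof. by move=> vc cm Gc <-; exact: (crystal_coord cG _ Gc vc cm). Qed.

Lemma code_fixed4 c (v : V) : code_fixed c v ->
  [/\ co v 0 = (-1) ^+ (code_at c 0).2 * co v (code_at c 0).1,
      co v 1 = (-1) ^+ (code_at c 1).2 * co v (code_at c 1).1,
      co v 2 = (-1) ^+ (code_at c 2).2 * co v (code_at c 2).1 &
      co v 3 = (-1) ^+ (code_at c 3).2 * co v (code_at c 3).1].
Proof. by move=> vf; split; [exact: (vf 0%N)|exact: (vf 1%N)|exact: (vf 2)|exact: (vf 3)]. Qed.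

Ltac orbit := by rewrite /= !co_aff //= !co0; ring.
Ltac fixed v := move=> v /code_fixed4 /= [];
  rewrite ?expr0 ?expr1 ?mul1r ?mulN1r => f0 f1 f2 f3.

Ltac int_tac ui := repeat first [assumption | exact: ui | apply: rpredM | apply: rpredD
  | apply: rpredN | apply: rpred0].

Lemma halves (t : R) : int (2 * t) -> int t \/ int (t - 6%:R / 12).
Proof.
move=> /(fractional_part12 (d := 2) (k := 6) erefl) [[|[|//]] _].
  by rewrite mul0n mul0r subr0; left.
by rewrite mul1n; right.
Qed.

Lemma thirds (t : R) : int (3 * t) ->
  [\/ int t, int (t - 4%:R / 12) | int (- t - 4%:R / 12)].
Proof.
move=> /(fractional_part12 (d := 3) (k := 4) erefl) [[|[|[|//]]] _].
- by rewrite mul0n mul0r subr0 => ?; constructor 1.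
- by rewrite mul1n => ?; constructor 2.
move=> ti; constructor 3; rewrite (_ : _ - _ = - (t - (2 * 4)%N%:R / 12) - 1); last by field.
by rewrite rpredB ?rpredN ?rpred1.
Qed.

Lemma quarters (t : R) : int (4 * t) ->
  [\/ int t, int (t - 3%:R / 12), int (t - 6%:R / 12) | int (- t - 3%:R / 12)].
Proof.
move=> /(fractional_part12 (d := 4) (k := 3) erefl) [[|[|[|[|//]]]] _].
- by rewrite mul0n mul0r subr0 => ?; constructor 1.
- by rewrite mul1n => ?; constructor 2.
- by move=> ?; constructor 3.
move=> ti; constructor 4; rewrite (_ : _ - _ = - (t - (3 * 3)%N%:R / 12) - 1); last by field.
by rewrite rpredB ?rpredN ?rpred1.
Qed.

Lemma sixths (t : R) : int (6 * t) ->
  [\/ int (2 * t), int (3 * t), int (t - 2%:R / 12) | int (- t - 2%:R / 12)].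
Proof.
move=> /(fractional_part12 (d := 6) (k := 2) erefl) [[|[|[|[|[|[|//]]]]]] _] ti.
- by constructor 1; rewrite rpredM ?natr_int //; move: ti; rewrite mul0n mul0r subr0.
- by constructor 3.
- constructor 2; rewrite (_ : _ * _ = 3 * (t - (2 * 2)%N%:R / 12) + 1); last by field.
  by rewrite rpredD ?rpredM ?natr_int ?rpred1.
- constructor 1; rewrite (_ : _ * _ = 2 * (t - (3 * 2)%N%:R / 12) + 1); last by field.
  by rewrite rpredD ?rpredM ?natr_int ?rpred1.
- constructor 2; rewrite (_ : _ * _ = 3 * (t - (4 * 2)%N%:R / 12) + 2); last by field.
  by rewrite rpredD ?rpredM ?natr_int.
constructor 4; rewrite (_ : _ - _ = - (t - (5 * 2)%N%:R / 12) - 1); last by field.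
by rewrite rpredB ?rpredN ?rpred1.
Qed.

Lemma int_double_half (t : R) : int (t - 6%:R / 12) -> int (2 * t).
Proof.
move=> ti; rewrite (_ : 2 * t = 2 * (t - 6%:R / 12) + 1); last by field.
by rewrite rpredD ?rpredM ?natr_int ?rpred1.
Qed.

(** The orbit sums of the translation part are integers, so that a lattice
    translation brings the translation part into the complement of the fixed
    space, and the element has torsion. The next three forms are excluded in
    the same way, [excluded_3cycle_neg] by means of the square. *)
Lemma excluded_transpositions : Gam (aff (cmx [:: p_ 1; p_ 0; p_ 3; p_ 2]) b) -> False.
Proof.
move=> Gc.
have h0 : int (b0 + b1) by apply: (@power_coord _ 2 0 _ _ _ Gc) => //; orbit.
have h2 : int (b2 + b3) by apply: (@power_coord _ 2 2 _ _ _ Gc) => //; orbit.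
apply: (crystal_no_fixed (m := 2) (a0 := - (b0 + b1)) (a1 := 0) (a2 := - (b2 + b3))
  (a3 := 0) cG Gc) => //; rewrite ?rpredN //.
by fixed v; rewrite f0 f2; ring.
Qed.

Lemma excluded_transposition_neg : Gam (aff (cmx [:: p_ 1; p_ 0; m_ 2; m_ 3]) b) -> False.
Proof.
move=> Gc.
have h0 : int (b0 + b1) by apply: (@power_coord _ 2 0 _ _ _ Gc) => //; orbit.
apply: (crystal_no_fixed (m := 2) (a0 := - (b0 + b1)) (a1 := 0) (a2 := 0)
  (a3 := 0) cG Gc) => //; rewrite ?rpredN //.
fixed v; have -> : co v 2 = 0 by lra.
have -> : co v 3 = 0 by lra.
by rewrite f0; ring.
Qed.

Lemma excluded_3cycle_neg : Gam (aff (cmx [:: p_ 1; p_ 2; p_ 0; m_ 3]) b) -> False.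
Proof.
move=> Gc.
have h0 : int (2 * (b0 + b1 + b2)) by apply: (@power_coord _ 6 0 _ _ _ Gc) => //; orbit.
have G2 := crystal_pow_code (k := 2) (d := [:: p_ 2; p_ 0; p_ 1; p_ 3]) cG Gc erefl erefl.
apply: (crystal_no_fixed (m := 3) (a0 := - (2 * (b0 + b1 + b2))) (a1 := 0) (a2 := 0)
  (a3 := 0) cG G2) => //; rewrite ?rpredN //.
fixed v; rewrite !co_aff //= !co0 f0 f2 f1; ring.
Qed.

Lemma excluded_4cycle : Gam (aff (cmx [:: p_ 1; p_ 2; p_ 3; p_ 0]) b) -> False.
Proof.
move=> Gc.
have h0 : int (b0 + b1 + b2 + b3) by apply: (@power_coord _ 4 0 _ _ _ Gc) => //; orbit.
apply: (crystal_no_fixed (m := 4) (a0 := - (b0 + b1 + b2 + b3)) (a1 := 0) (a2 := 0)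
  (a3 := 0) cG Gc) => //; rewrite ?rpredN //.
by fixed v; rewrite f0 f1 f2; ring.
Qed.

(** Here the linear part has no nonzero fixed vector, so every element with it
    is torsion. The number 24 is a common multiple of the orders. *)
Lemma excluded_no_fixed c : c \in [:: [:: m_ 0; m_ 1; m_ 2; m_ 3]; [:: m_ 1; p_ 0; m_ 2; m_ 3];
      [:: m_ 1; p_ 0; m_ 3; p_ 2]; [:: m_ 1; m_ 2; m_ 0; m_ 3];
      [:: m_ 1; p_ 2; p_ 3; p_ 0]] -> Gam (aff (cmx c) b) -> False.
Proof.
rewrite !inE => cE Gc.
have vc : valid_code c by case/or4P: cE => [/eqP->|/eqP->|/eqP->|/orP[]/eqP->].
have c24 : pow_code c 24 == id_code by case/or4P: cE => [/eqP->|/eqP->|/eqP->|/orP[]/eqP->].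
have c1 : c != id_code by case/or4P: cE => [/eqP->|/eqP->|/eqP->|/orP[]/eqP->].
apply: (crystal_no_fixed (m := 24) (a0 := 0) (a1 := 0) (a2 := 0) (a3 := 0) cG Gc) => //.
move=> v vf; have [-> -> -> ->] : [/\ co v 0 = 0, co v 1 = 0, co v 2 = 0 & co v 3 = 0].
  case/or4P: cE vf => [/eqP->|/eqP->|/eqP->|/orP[]/eqP->];
  move=> /code_fixed4 /= []; rewrite ?expr0 ?expr1 ?mul1r ?mulN1r => f0 f1 f2 f3;
  split; lra.
by rewrite !mul0r !addr0.
Qed.

Lemma excluded_form c : c \in excluded_forms -> Gam (aff (cmx c) b) -> False.
Proof.
rewrite -(cat_take_drop 4 excluded_forms) mem_cat => /orP[]; last exact: excluded_no_fixed.
rewrite !inE => /or4P[]/eqP->.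
- exact: excluded_transpositions.
- exact: excluded_transposition_neg.
- exact: excluded_3cycle_neg.
- exact: excluded_4cycle.
Qed.

(** In each of the cases below, the components of the translation part along
    the fixed space have a small denominator. Their residues are listed;
    those that would give torsion, for the element or for one of its powers,
    are impossible, and the others are brought to a canonical form by
    permuting and reflecting the fixed coordinates. *)
Lemma has_type_code c q z : (c, z) \in canonical_types -> valid_code c -> valid_code q ->
  compose q c == compose c q ->
  (forall u : V, (forall i, int (co u i)) -> code_fixed c u ->
    int (co u 0 * (co (b *m cmx q) 0 - (nth 0%N z 0)%:R / 12) +
         co u 1 * (co (b *m cmx q) 1 - (nth 0%N z 1)%:R / 12) +
         co u 2 * (co (b *m cmx q) 2 - (nth 0%N z 2)%:R / 12) +
         co u 3 * (co (b *m cmx q) 3 - (nth 0%N z 3)%:R / 12))) ->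
  has_type c b.
Proof. by move=> cz vc vq qc H; exists (c, z) => //; exact: (similar_code vc vq qc H). Qed.

Ltac typed q0 z0 := apply: (has_type_code (q := q0) (z := z0)) => //;
  let u := fresh "u" in let ui := fresh "ui" in
  move=> u ui /code_fixed4 /= [];
  rewrite !co_cmx //= ?expr0 ?expr1 ?mul1r ?mulN1r ?mul0r ?subr0.

Lemma type_id : Gam (aff (cmx id_code) b) -> has_type id_code b.
Proof.
move=> Gc.
have h0 : int (b0) by apply: (@power_coord _ 1 0 _ _ _ Gc) => //; orbit.
have h1 : int (b1) by apply: (@power_coord _ 1 1 _ _ _ Gc) => //; orbit.
have h2 : int (b2) by apply: (@power_coord _ 1 2 _ _ _ Gc) => //; orbit.
have h3 : int (b3) by apply: (@power_coord _ 1 3 _ _ _ Gc) => //; orbit.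
typed id_code [:: 0; 0; 0; 0]%N => _ _ _ _; int_tac ui.
Qed.

Lemma type_reflection : let c := [:: p_ 0; p_ 1; p_ 2; m_ 3] in
  Gam (aff (cmx c) b) -> has_type c b.
Proof.
move=> c Gc.
have h0 : int (2 * b0) by apply: (@power_coord _ 2 0 _ _ _ Gc) => //; orbit.
have h1 : int (2 * b1) by apply: (@power_coord _ 2 1 _ _ _ Gc) => //; orbit.
have h2 : int (2 * b2) by apply: (@power_coord _ 2 2 _ _ _ Gc) => //; orbit.
case/halves: h0 => h0; case/halves: h1 => h1; case/halves: h2 => h2.
- exfalso; apply: (crystal_no_fixed (m := 2) (a0 := - b0) (a1 := - b1) (a2 := - b2)
    (a3 := 0) cG Gc) => //; rewrite ?rpredN //.
  fixed v; have -> : co v 3 = 0 by lra.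
  ring.
- typed [:: p_ 2; p_ 1; p_ 0; p_ 3] [:: 6; 0; 0; 0]%N => _ _ _ f3; have -> : co u 3 = 0 by lra.
  rewrite mul0r; int_tac ui.
- typed [:: p_ 1; p_ 0; p_ 2; p_ 3] [:: 6; 0; 0; 0]%N => _ _ _ f3; have -> : co u 3 = 0 by lra.
  rewrite mul0r; int_tac ui.
- typed [:: p_ 2; p_ 1; p_ 0; p_ 3] [:: 6; 6; 0; 0]%N => _ _ _ f3; have -> : co u 3 = 0 by lra.
  rewrite mul0r; int_tac ui.
- typed id_code [:: 6; 0; 0; 0]%N => _ _ _ f3; have -> : co u 3 = 0 by lra.
  rewrite mul0r; int_tac ui.
- typed [:: p_ 0; p_ 2; p_ 1; p_ 3] [:: 6; 6; 0; 0]%N => _ _ _ f3; have -> : co u 3 = 0 by lra.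
  rewrite mul0r; int_tac ui.
- typed id_code [:: 6; 6; 0; 0]%N => _ _ _ f3; have -> : co u 3 = 0 by lra.
  rewrite mul0r; int_tac ui.
- typed id_code [:: 6; 6; 6; 0]%N => _ _ _ f3; have -> : co u 3 = 0 by lra.
  rewrite mul0r; int_tac ui.
Qed.

Lemma type_transposition : let c := [:: p_ 1; p_ 0; p_ 2; p_ 3] in
  Gam (aff (cmx c) b) -> has_type c b.
Proof.
move=> c Gc.
have h0 : int (b0 + b1) by apply: (@power_coord _ 2 0 _ _ _ Gc) => //; orbit.
have h2 : int (2 * b2) by apply: (@power_coord _ 2 2 _ _ _ Gc) => //; orbit.
have h3 : int (2 * b3) by apply: (@power_coord _ 2 3 _ _ _ Gc) => //; orbit.
case/halves: h2 => h2; case/halves: h3 => h3.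
- exfalso; apply: (crystal_no_fixed (m := 2) (a0 := - (b0 + b1)) (a1 := 0) (a2 := - b2)
    (a3 := - b3) cG Gc) => //; rewrite ?rpredN //.
  by fixed v; rewrite f0; ring.
- typed [:: p_ 0; p_ 1; p_ 3; p_ 2] [:: 0; 0; 6; 0]%N => f0 _ _ _; rewrite f0 -mulrDr; int_tac ui.
- typed id_code [:: 0; 0; 6; 0]%N => f0 _ _ _; rewrite f0 -mulrDr; int_tac ui.
- typed id_code [:: 0; 0; 6; 6]%N => f0 _ _ _; rewrite f0 -mulrDr; int_tac ui.
Qed.

Lemma type_double_reflection : let c := [:: p_ 0; p_ 1; m_ 2; m_ 3] in
  Gam (aff (cmx c) b) -> has_type c b.
Proof.
move=> c Gc.
have h0 : int (2 * b0) by apply: (@power_coord _ 2 0 _ _ _ Gc) => //; orbit.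
have h1 : int (2 * b1) by apply: (@power_coord _ 2 1 _ _ _ Gc) => //; orbit.
case/halves: h0 => h0; case/halves: h1 => h1.
- exfalso; apply: (crystal_no_fixed (m := 2) (a0 := - b0) (a1 := - b1) (a2 := 0)
    (a3 := 0) cG Gc) => //; rewrite ?rpredN //.
  fixed v; have -> : co v 2 = 0 by lra.
  have -> : co v 3 = 0 by lra.
  ring.
- typed [:: p_ 1; p_ 0; p_ 2; p_ 3] [:: 6; 0; 0; 0]%N => _ _ f2 f3; have -> : co u 2 = 0 by lra.
  have -> : co u 3 = 0 by lra.
  rewrite !mul0r; int_tac ui.
- typed id_code [:: 6; 0; 0; 0]%N => _ _ f2 f3; have -> : co u 2 = 0 by lra.
  have -> : co u 3 = 0 by lra.
  rewrite !mul0r; int_tac ui.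
- typed id_code [:: 6; 6; 0; 0]%N => _ _ f2 f3; have -> : co u 2 = 0 by lra.
  have -> : co u 3 = 0 by lra.
  rewrite !mul0r; int_tac ui.
Qed.

Lemma type_quarter_turn : let c := [:: p_ 0; p_ 1; m_ 3; p_ 2] in
  Gam (aff (cmx c) b) -> has_type c b.
Proof.
move=> c Gc.
have h0 : int (4 * b0) by apply: (@power_coord _ 4 0 _ _ _ Gc) => //; orbit.
have h1 : int (4 * b1) by apply: (@power_coord _ 4 1 _ _ _ Gc) => //; orbit.
have G2 := crystal_pow_code (k := 2) (d := [:: p_ 0; p_ 1; m_ 2; m_ 3]) cG Gc erefl erefl.
have no_half : int (2 * b0) -> int (2 * b1) -> has_type c b.
  move=> i0 i1; exfalso; apply: (crystal_no_fixed (m := 2) (a0 := - (2 * b0))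
    (a1 := - (2 * b1)) (a2 := 0) (a3 := 0) cG G2) => //; rewrite ?rpredN //.
  fixed v; rewrite !co_aff //= !co0; have -> : co v 2 = 0 by lra.
  have -> : co v 3 = 0 by lra.
  ring.
have double (t : R) : int t -> int (2 * t) by move=> ti; rewrite rpredM ?natr_int.
case/quarters: h0 => h0; case/quarters: h1 => h1.
- exact: (no_half (double _ h0) (double _ h1)).
- typed [:: p_ 1; p_ 0; p_ 2; p_ 3] [:: 3; 0; 0; 0]%N => _ _ f2 f3; have -> : co u 2 = 0 by lra.
  have -> : co u 3 = 0 by lra.
  rewrite !mul0r; int_tac ui.
- exact: (no_half (double _ h0) (int_double_half h1)).
- typed [:: m_ 1; p_ 0; p_ 2; p_ 3] [:: 3; 0; 0; 0]%N => _ _ f2 f3; have -> : co u 2 = 0 by lra.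
  have -> : co u 3 = 0 by lra.
  rewrite !mul0r; int_tac ui.
- typed [:: p_ 0; p_ 1; p_ 2; p_ 3] [:: 3; 0; 0; 0]%N => _ _ f2 f3; have -> : co u 2 = 0 by lra.
  have -> : co u 3 = 0 by lra.
  rewrite !mul0r; int_tac ui.
- typed [:: p_ 0; p_ 1; p_ 2; p_ 3] [:: 3; 3; 0; 0]%N => _ _ f2 f3; have -> : co u 2 = 0 by lra.
  have -> : co u 3 = 0 by lra.
  rewrite !mul0r; int_tac ui.
- typed [:: p_ 0; p_ 1; p_ 2; p_ 3] [:: 3; 6; 0; 0]%N => _ _ f2 f3; have -> : co u 2 = 0 by lra.
  have -> : co u 3 = 0 by lra.
  rewrite !mul0r; int_tac ui.
- typed [:: p_ 0; m_ 1; p_ 2; p_ 3] [:: 3; 3; 0; 0]%N => _ _ f2 f3; have -> : co u 2 = 0 by lra.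
  have -> : co u 3 = 0 by lra.
  rewrite !mul0r; int_tac ui.
- exact: (no_half (int_double_half h0) (double _ h1)).
- typed [:: p_ 1; p_ 0; p_ 2; p_ 3] [:: 3; 6; 0; 0]%N => _ _ f2 f3; have -> : co u 2 = 0 by lra.
  have -> : co u 3 = 0 by lra.
  rewrite !mul0r; int_tac ui.
- exact: (no_half (int_double_half h0) (int_double_half h1)).
- typed [:: m_ 1; p_ 0; p_ 2; p_ 3] [:: 3; 6; 0; 0]%N => _ _ f2 f3; have -> : co u 2 = 0 by lra.
  have -> : co u 3 = 0 by lra.
  rewrite !mul0r; int_tac ui.
- typed [:: m_ 0; p_ 1; p_ 2; p_ 3] [:: 3; 0; 0; 0]%N => _ _ f2 f3; have -> : co u 2 = 0 by lra.
  have -> : co u 3 = 0 by lra.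
  rewrite !mul0r; int_tac ui.
- typed [:: m_ 0; p_ 1; p_ 2; p_ 3] [:: 3; 3; 0; 0]%N => _ _ f2 f3; have -> : co u 2 = 0 by lra.
  have -> : co u 3 = 0 by lra.
  rewrite !mul0r; int_tac ui.
- typed [:: m_ 0; p_ 1; p_ 2; p_ 3] [:: 3; 6; 0; 0]%N => _ _ f2 f3; have -> : co u 2 = 0 by lra.
  have -> : co u 3 = 0 by lra.
  rewrite !mul0r; int_tac ui.
- typed [:: m_ 0; m_ 1; p_ 2; p_ 3] [:: 3; 3; 0; 0]%N => _ _ f2 f3; have -> : co u 2 = 0 by lra.
  have -> : co u 3 = 0 by lra.
  rewrite !mul0r; int_tac ui.
Qed.

Lemma type_transposition_reflection : let c := [:: p_ 1; p_ 0; p_ 2; m_ 3] in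
  Gam (aff (cmx c) b) -> has_type c b.
Proof.
move=> c Gc.
have h0 : int (b0 + b1) by apply: (@power_coord _ 2 0 _ _ _ Gc) => //; orbit.
have h2 : int (2 * b2) by apply: (@power_coord _ 2 2 _ _ _ Gc) => //; orbit.
case/halves: h2 => h2.
- exfalso; apply: (crystal_no_fixed (m := 2) (a0 := - (b0 + b1)) (a1 := 0) (a2 := - b2)
    (a3 := 0) cG Gc) => //; rewrite ?rpredN //.
  fixed v; have -> : co v 3 = 0 by lra.
  rewrite f0; ring.
typed id_code [:: 0; 0; 6; 0]%N => f0 _ _ f3; have -> : co u 3 = 0 by lra.
rewrite f0 -mulrDr mul0r; int_tac ui.
Qed.

Lemma type_3cycle : let c := [:: p_ 1; p_ 2; p_ 0; p_ 3] in
  Gam (aff (cmx c) b) -> has_type c b.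
Proof.
move=> c Gc.
have h0 : int (b0 + b1 + b2) by apply: (@power_coord _ 3 0 _ _ _ Gc) => //; orbit.
have h3 : int (3 * b3) by apply: (@power_coord _ 3 3 _ _ _ Gc) => //; orbit.
case/thirds: h3 => h3.
- exfalso; apply: (crystal_no_fixed (m := 3) (a0 := - (b0 + b1 + b2)) (a1 := 0) (a2 := 0)
    (a3 := - b3) cG Gc) => //; rewrite ?rpredN //.
  fixed v; rewrite f0 f1; ring.
- typed id_code [:: 0; 0; 0; 4]%N => f0 f1 _ _; rewrite f0 f1 -!mulrDr; int_tac ui.
typed [:: p_ 0; p_ 1; p_ 2; m_ 3] [:: 0; 0; 0; 4]%N => f0 f1 _ _.
rewrite f0 f1 -!mulrDr; int_tac ui.
Qed.

Lemma type_triple_reflection : let c := [:: p_ 0; m_ 1; m_ 2; m_ 3] in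
  Gam (aff (cmx c) b) -> has_type c b.
Proof.
move=> c Gc.
have h0 : int (2 * b0) by apply: (@power_coord _ 2 0 _ _ _ Gc) => //; orbit.
case/halves: h0 => h0.
- exfalso; apply: (crystal_no_fixed (m := 2) (a0 := - b0) (a1 := 0) (a2 := 0)
    (a3 := 0) cG Gc) => //; rewrite ?rpredN //.
  fixed v; have -> : co v 1 = 0 by lra.
  have -> : co v 2 = 0 by lra.
  have -> : co v 3 = 0 by lra.
  ring.
typed id_code [:: 6; 0; 0; 0]%N => _ f1 f2 f3; have -> : co u 1 = 0 by lra.
have -> : co u 2 = 0 by lra.
have -> : co u 3 = 0 by lra.
rewrite !mul0r; int_tac ui.
Qed.

Lemma type_quarter_turn_reflection : let c := [:: p_ 0; m_ 1; m_ 3; p_ 2] in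
  Gam (aff (cmx c) b) -> has_type c b.
Proof.
move=> c Gc.
have h0 : int (4 * b0) by apply: (@power_coord _ 4 0 _ _ _ Gc) => //; orbit.
have G2 := crystal_pow_code (k := 2) (d := [:: p_ 0; p_ 1; m_ 2; m_ 3]) cG Gc erefl erefl.
have no_half : int (2 * b0) -> has_type c b.
  move=> i0; exfalso; apply: (crystal_no_fixed (m := 2) (a0 := - (2 * b0))
    (a1 := 0) (a2 := 0) (a3 := 0) cG G2) => //; rewrite ?rpredN //.
  fixed v; rewrite !co_aff //= !co0; have -> : co v 2 = 0 by lra.
  have -> : co v 3 = 0 by lra.
  ring.
case/quarters: h0 => h0.
- by apply: no_half; rewrite rpredM ?natr_int.
- typed id_code [:: 3; 0; 0; 0]%N => _ f1 f2 f3; have -> : co u 1 = 0 by lra.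
  have -> : co u 2 = 0 by lra.
  have -> : co u 3 = 0 by lra.
  rewrite !mul0r; int_tac ui.
- exact: (no_half (int_double_half h0)).
typed [:: m_ 0; p_ 1; p_ 2; p_ 3] [:: 3; 0; 0; 0]%N => _ f1 f2 f3.
have -> : co u 1 = 0 by lra.
have -> : co u 2 = 0 by lra.
have -> : co u 3 = 0 by lra.
rewrite !mul0r; int_tac ui.
Qed.

Lemma type_neg_3cycle : let c := [:: p_ 0; m_ 2; m_ 3; m_ 1] in
  Gam (aff (cmx c) b) -> has_type c b.
Proof.
move=> c Gc.
have h0 : int (6 * b0) by apply: (@power_coord _ 6 0 _ _ _ Gc) => //; orbit.
have G2 := crystal_pow_code (k := 2) (d := [:: p_ 0; p_ 3; p_ 1; p_ 2]) cG Gc erefl erefl.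
have G3 := crystal_pow_code (k := 3) (d := [:: p_ 0; m_ 1; m_ 2; m_ 3]) cG Gc erefl erefl.
case/sixths: h0 => h0.
- exfalso; apply: (crystal_no_fixed (m := 3) (a0 := - (2 * b0))
    (a1 := 0) (a2 := 0) (a3 := 0) cG G2) => //; rewrite ?rpredN //.
  fixed v; rewrite !co_aff //= !co0 f2 f1; ring.
- exfalso; apply: (crystal_no_fixed (m := 2) (a0 := - (3 * b0))
    (a1 := 0) (a2 := 0) (a3 := 0) cG G3) => //; rewrite ?rpredN //.
  fixed v; rewrite !co_aff //= !co0; have -> : co v 1 = 0 by lra.
  have -> : co v 2 = 0 by lra.
  have -> : co v 3 = 0 by lra.
  ring.
- typed id_code [:: 2; 0; 0; 0]%N => _ f1 f2 f3; have -> : co u 1 = 0 by lra.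
  have -> : co u 2 = 0 by lra.
  have -> : co u 3 = 0 by lra.
  rewrite !mul0r; int_tac ui.
typed [:: m_ 0; p_ 1; p_ 2; p_ 3] [:: 2; 0; 0; 0]%N => _ f1 f2 f3.
have -> : co u 1 = 0 by lra.
have -> : co u 2 = 0 by lra.
have -> : co u 3 = 0 by lra.
rewrite !mul0r; int_tac ui.
Qed.

Lemma type_transposition_turn : let c := [:: p_ 1; p_ 0; m_ 3; p_ 2] in
  Gam (aff (cmx c) b) -> has_type c b.
Proof.
move=> c Gc.
have h0 : int (2 * (b0 + b1)) by apply: (@power_coord _ 4 0 _ _ _ Gc) => //; orbit.
case/halves: h0 => h0.
- exfalso; apply: (crystal_no_fixed (m := 4) (a0 := - (b0 + b1)) (a1 := 0) (a2 := 0)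
    (a3 := 0) cG Gc) => //; rewrite ?rpredN //.
  fixed v; have -> : co v 2 = 0 by lra.
  have -> : co v 3 = 0 by lra.
  rewrite f0; ring.
typed id_code [:: 6; 0; 0; 0]%N => f0 _ f2 f3; have -> : co u 2 = 0 by lra.
have -> : co u 3 = 0 by lra.
rewrite f0 !mul0r !addr0 -mulrDr addrAC; int_tac ui.
Qed.

Lemma normal_form_type c : c \in normal_forms -> Gam (aff (cmx c) b) -> has_type c b.
Proof.
rewrite in_cons mem_cat => /or3P[/eqP->|cF|/excluded_form H /H //]; first exact: type_id.
move: cF; rewrite -(cat_take_drop 5 free_forms) mem_cat !inE => /orP[|].
  move=> /orP[/eqP->|/or4P[]/eqP->].
  - exact: type_reflection.
  - exact: type_transposition.
  - exact: type_double_reflection.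
  - exact: type_quarter_turn.
  - exact: type_transposition_reflection.
move=> /orP[/eqP->|/or4P[]/eqP->].
- exact: type_3cycle.
- exact: type_triple_reflection.
- exact: type_quarter_turn_reflection.
- exact: type_neg_3cycle.
- exact: type_transposition_turn.
Qed.

End Forms.

(** Conjugate the linear part to a normal form and carry the group along. *)
Lemma crystal_type (R : realType) (Gam : set ('rV[R]_4 -> 'rV[R]_4)) (t : @signed_perm 4) b :
  crystal Gam -> Gam (aff (sp_mx t) b) -> sp_mx t *m (sp_mx t)^T = 1%:M :> 'M[R]_4 ->
  exists2 s, s \in canonical_types & aff_similar (sp_mx t) b (cmx s.1) (zvec s.2).
Proof.
move=> cG Gt tt; have [q [d [qa dn qd]]] := conjugate_to_normal (code_of_mem tt).
have tE : sp_mx t = cmx (code_of t) :> 'M[R]_4 by rewrite /cmx code_ofK.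
have vq := valid_all qa; have vc := valid_all (code_of_mem tt).
have vd : valid_code d.
  by move: d dn {qd}; apply/allP; vm_compute.
have iQ := @valid_integral_orthogonal R q vq.
have QB : cmx q *m cmx d = sp_mx t *m cmx q :> 'M[R]_4.
  by rewrite tE -!cmx_compose // qd.
have [s sc sim] := normal_form_type (crystal_conj iQ cG) dn (conjugate_set_aff iQ QB Gt).
by exists s => //; exact: similar_conj iQ QB sim.
Qed.

From mathcomp Require Import zify.

(** * Evaluation of the wave traces *)

(** Lattice vectors with coordinates between [- K] and [K], shifted by [K] so
    that the coordinates are natural numbers; [qvec] undoes the shift. *)
Definition cube (K : nat) : seq (seq nat) :=
  [seq a :: c | a <- iota 0 K.*2.+1, c <- [seq a :: c | a <- iota 0 K.*2.+1,
     c <- [seq a :: c | a <- iota 0 K.*2.+1, c <- [seq [:: a] | a <- iota 0 K.*2.+1]]]].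

Definition qsq (K a : nat) : nat := ((a - K) + (K - a)) * ((a - K) + (K - a)).

Definition qnorm (K : nat) (t : seq nat) : nat :=
  qsq K (nth 0%N t 0) + qsq K (nth 0%N t 1) + qsq K (nth 0%N t 2) + qsq K (nth 0%N t 3).

Definition qfixed (K : nat) (c : spcode) (t : seq nat) : bool :=
  all (fun i => nth 0 t i == if (code_at c i).2 then K.*2 - nth 0 t (code_at c i).1
                else nth 0 t (code_at c i).1)%N (iota 0 4).

(** Twelve times the phase of a shifted vector, modulo 12: adding [11 * K]
    amounts to removing the shift [K] while staying in the natural numbers. *)
Definition qphase (K : nat) (z t : seq nat) : nat :=
  ((nth 0 t 0 + 11 * K) * nth 0 z 0 + (nth 0 t 1 + 11 * K) * nth 0 z 1 +
   (nth 0 t 2 + 11 * K) * nth 0 z 2 + (nth 0 t 3 + 11 * K) * nth 0 z 3)%N.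

(** Twice the cosine of [k / 12] of a full turn, as a difference of natural
    numbers. It is irrational for the odd multiples of 1/12 other than 3 and
    9, but these never occur as phases here. *)
Definition twice_cos (k : nat) : option (nat * nat) :=
  match k with
  | 0 => Some (2, 0) | 2 | 10 => Some (1, 0) | 3 | 9 => Some (0, 0)
  | 4 | 8 => Some (0, 1) | 6 => Some (0, 2) | _ => None
  end%N.

Definition qlist (K m : nat) : seq (seq nat) := [seq t <- cube K | qnorm K t == m].

(** Twice the wave trace of [s] over the list [l], as a difference of natural
    numbers. *)
Definition qtrace (K : nat) (l : seq (seq nat)) (s : spcode * seq nat) : option (nat * nat) :=
  foldr (fun t r => if r is Some (p, q) then
           if twice_cos (qphase K s.2 t %% 12) is Some (p', q')
           then Some (p + p', q + q')%N else None else None) (Some (0%N, 0%N))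
    [seq t <- l | qfixed K s.1 t].

Section Numeric.
Context {R : realType}.
Local Notation V := 'rV[R]_4.

Definition qvec (K : nat) (t : seq nat) : V := \row_j ((nth 0%N t j)%:R - K%:R).

Lemma cubeP K t : reflect (size t = 4%N /\ all (fun a => a <= K.*2)%N t) (t \in cube K).
Proof.
have io a : (a \in iota 0 K.*2.+1) = (a <= K.*2)%N by rewrite mem_iota.
rewrite /cube; move: (iota 0 _) io => I io.
apply: (iffP idP) => [|[]].
  case/allpairsP => -[a s1] /= [ai + ->]; case/allpairsP => -[b s2] /= [bi + ->].
  by case/allpairsP => -[c s3] /= [ci + ->]; case/mapP => d di ->; rewrite /= -!io ai bi ci di.
case: t => [|a [|b [|c [|d [|//]]]]] //= _; rewrite -!io => /and5P[ai bi ci di _].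
apply/allpairsP; exists (a, [:: b; c; d]); split => //=.
apply/allpairsP; exists (b, [:: c; d]); split => //=.
apply/allpairsP; exists (c, [:: d]); split => //=.
by apply/mapP; exists d.
Qed.

Lemma cube_uniq K : uniq (cube K).
Proof.
do 3 (apply: allpairs_uniq; [exact: iota_uniq| |by move=> [x1 x2] [y1 y2] _ _ /= [-> ->]]).
by rewrite map_inj_uniq ?iota_uniq // => a b [].
Qed.

Lemma co_qvec K t i : (i < 4)%N -> co (qvec K t) i = (nth 0%N t i)%:R - K%:R.
Proof. by move=> i4; rewrite /co mxE inordK. Qed.

Lemma qvec_inj K : {in cube K &, injective (qvec K)}.
Proof.
move=> s t /cubeP[ss _] /cubeP[st _] E; apply: (@eq_from_nth _ 0%N); rewrite ss ?st // => i i4.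
have := congr1 (fun v => co v i) E; rewrite /= !co_qvec // => /addIr /eqP.
by rewrite eqr_nat => /eqP.
Qed.

Lemma qsqE K a : (qsq K a)%:R = (a%:R - K%:R) * (a%:R - K%:R) :> R.
Proof.
rewrite /qsq; have [aK|Ka] := leqP a K.
  rewrite (eqP (_ : a - K == 0)%N) ?subn_eq0 // add0n natrM natrB //; ring.
rewrite (eqP (_ : K - a == 0)%N) ?subn_eq0 1?ltnW // addn0 natrM natrB ?(ltnW Ka) //.
Qed.

Lemma qnormE K t : (qnorm K t)%:R = dot (qvec K t) (qvec K t).
Proof. by rewrite dot4 !co_qvec // /qnorm !natrD !qsqE. Qed.

Definition qsphere K m : seq V := [seq qvec K t | t <- qlist K m].

Lemma qsphereP K m : (m < K.+1 ^ 2)%N -> sphere m%:R (qsphere K m).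
Proof.
move=> mK; split.
  rewrite map_inj_in_uniq ?filter_uniq ?cube_uniq // => s t.
  by rewrite !mem_filter => /andP[_ sK] /andP[_ tK]; exact: qvec_inj.
move=> u; split=> [/mapP[t + ->]|[ui um]].
  rewrite mem_filter => /andP[/eqP tm tc]; rewrite -qnormE tm; split => // i.
  by rewrite mxE rpredB ?natr_int.
have uK i : `|u 0 i| < K.+1%:R.
  rewrite -(@ltr_pXn2r _ 2) ?nnegrE // -natrX.
  apply: le_lt_trans (_ : m%:R < _); last by rewrite ltr_nat.
  rewrite -um /dot (bigD1 i) //= -normrX ger0_norm ?sqr_ge0 // expr2 lerDl.
  by apply: sumr_ge0 => j _; rewrite -expr2 sqr_ge0.
have /choice[t tE] : forall i, exists a : nat, u 0 i = a%:R - K%:R /\ (a <= K.*2)%N.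
  move=> i; have /intrP[z zE] := ui i.
  have := uK i; rewrite zE ltr_norml => /andP[z1 z2].
  have zK : (z + K%:Z >= 0)%R.
    have : (- K.+1%:R < z%:~R :> R)%R := z1.
    rewrite -[K.+1%:R]/((K.+1%:Z)%:~R) -rmorphN ltr_int; lia.
  have zK2 : (z + K%:Z <= K.*2%:Z)%R.
    have : (z%:~R < K.+1%:R :> R)%R := z2.
    rewrite -[K.+1%:R]/((K.+1%:Z)%:~R) ltr_int; lia.
  exists (absz (z + K%:Z)); split; last by rewrite -lez_nat gez0_abs.
  by rewrite -[(absz _)%:R]/(((absz (z + K%:Z))%:Z)%:~R) gez0_abs // intrD addrK.
pose s := [seq t (inord i) | i <- iota 0 4].
have sE : u = qvec K s.
  apply: co_eq => i i4; rewrite co_qvec // (nth_map 0%N) ?size_iota // nth_iota //.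
  by rewrite add0n; have [<- _] := tE (inord i).
rewrite sE; apply: map_f; rewrite mem_filter; apply/andP; split.
  by rewrite -(eqr_nat R) qnormE -sE um.
apply/cubeP; split; first by rewrite size_map.
by apply/allP => a /mapP[i _ ->]; have [] := tE (inord i).
Qed.

Lemma qfixedE K c t : valid_code c -> t \in cube K ->
  (qvec K t *m (cmx c)^T == qvec K t) = qfixed K c t.
Proof.
move=> vc /cubeP[st tK].
have nK i : (i < 4)%N -> (nth 0 t i <= K.*2)%N.
  by move=> i4; apply: (allP tK); rewrite mem_nth ?st.
have [cc _] := @valid_integral_orthogonal R c vc.
rewrite orthogonal_fixed //.
have E i : (i < 4)%N -> (co (qvec K t *m cmx c) i == co (qvec K t) i) =
    (nth 0 t i == if (code_at c i).2 then K.*2 - nth 0 t (code_at c i).1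
                else nth 0 t (code_at c i).1)%N.
  move=> i4; have k4 := valid_sub vc i4; rewrite co_cmx // !co_qvec //.
  case: (code_at c i).2; last first.
    by rewrite expr0 mul1r (inj_eq (addIr _)) eqr_nat eq_sym.
  rewrite expr1 mulN1r opprB -(inj_eq (addIr (K%:R : R))) subrK.
  rewrite -(eqr_nat R) natrB ?nK // -muln2 natrM eq_sym.
  by congr (_ == _); ring.
apply/eqP/allP => [uE i|H].
  by rewrite mem_iota => i4; rewrite -E // uE.
by apply: co_eq => i i4; apply/eqP; rewrite E //; apply: H; rewrite mem_iota.
Qed.

Lemma cos_phase K z t :
  cos (2 * pi * dot (qvec K t) (zvec z)) =
  cos (2 * pi * ((qphase K z t %% 12)%:R / 12)) :> R.
Proof.
rewrite dot4 !co_qvec // !co_zvec //.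
set w := (X in cos (2 * pi * X) = _).
have -> : w = (qphase K z t %% 12)%:R / 12 + ((qphase K z t %/ 12)%:R -
    (K * (nth 0 z 0 + nth 0 z 1 + nth 0 z 2 + nth 0 z 3))%N%:R).
  have : (qphase K z t)%:R = (qphase K z t %/ 12)%:R * 12 + (qphase K z t %% 12)%:R :> R.
    by rewrite {1}(divn_eq (qphase K z t) 12) natrD natrM.
  rewrite {1}/qphase /w !(natrD, natrM) => H; lra.
by rewrite cosD_int // rpredB ?natr_int.
Qed.

(** The cosine of a third of a half turn is the positive root of
    [4 * c ^+ 3 - 3 * c + 1 = (c + 1) * (2 * c - 1) ^+ 2]. *)
Lemma cos_pi_third : cos (pi / 3) = 2^-1 :> R.
Proof.
set c := cos _.
have c0 : 0 < c.
  apply: cos_gt0_pihalf; have := pi_gt0 R => p0.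
  apply/andP; split; first by apply: lt_trans (_ : 0 < _); rewrite ?oppr_lt0 divr_gt0.
  by rewrite ltr_pM2l // ltf_pV2 ?posrE // ltr_nat.
have c3 : cos (pi / 3 + (pi / 3 + pi / 3)) = 4 * c ^+ 3 - 3 * c.
  rewrite cosD cosD sinD -/c; have := cos2Dsin2 (pi / 3 : R); rewrite -/c.
  move: (sin (pi / 3)) => s cs; have -> : s * (s * c + c * s) = 2 * c * s ^+ 2 by ring.
  have -> : c * (c * c - s * s) = c * (c ^+ 2 - s ^+ 2) by ring.
  have -> : s ^+ 2 = 1 - c ^+ 2 by lra.
  ring.
have : 4 * c ^+ 3 - 3 * c = - 1.
  by rewrite -c3 -cospi; congr cos; field.
move=> H; have : (c + 1) * (2 * c - 1) ^+ 2 = 0.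
  have -> : (c + 1) * (2 * c - 1) ^+ 2 = 4 * c ^+ 3 - 3 * c + 1 by ring.
  by rewrite H addNr.
move/eqP; rewrite mulf_eq0 sqrf_eq0 => /orP[/eqP|/eqP]; lra.
Qed.

Lemma twice_cosP k p q : twice_cos k = Some (p, q) ->
  cos (2 * pi * (k%:R / 12)) = (p%:R - q%:R) / 2 :> R.
Proof.
have c6 : cos (2 * pi * (2%:R / 12)) = 2^-1 :> R.
  by rewrite -cos_pi_third; congr cos; field.
have s_pi x : cos (pi + x) = - cos x :> R by rewrite addrC cosDpi.
have refl x : cos (2 * pi - x) = cos x :> R.
  have -> : 2 * pi - x = pi + (pi - x) :> R by ring.
  by rewrite s_pi cosB cospi sinpi; ring.
have c4 : cos (2 * pi * (4%:R / 12)) = - 2^-1 :> R.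
  have -> : 2 * pi * (4%:R / 12) = pi - 2 * pi * (2%:R / 12) :> R by field.
  by rewrite cosB cospi sinpi c6; ring.
have c3 : cos (2 * pi * (3%:R / 12)) = 0 :> R.
  by rewrite -[RHS](@cos_pihalf R); congr cos; field.
case: k => [|[|[|[|[|[|[|[|[|[|[|k]]]]]]]]]]] //= [<- <-].
- by rewrite mul0r mulr0 cos0; field.
- by rewrite c6; field.
- by rewrite c3; field.
- by rewrite c4; field.
- have -> : 2 * pi * (6%:R / 12) = pi :> R by field.
  by rewrite cospi; field.
- have -> : 2 * pi * (8%:R / 12) = 2 * pi - 2 * pi * (4%:R / 12) :> R by field.
  by rewrite refl c4; field.
- have -> : 2 * pi * (9%:R / 12) = 2 * pi - 2 * pi * (3%:R / 12) :> R by field.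
  by rewrite refl c3; field.
- have -> : 2 * pi * (10%:R / 12) = 2 * pi - 2 * pi * (2%:R / 12) :> R by field.
  by rewrite refl c6; field.
Qed.

Lemma qtraceP K m (s : spcode * seq nat) p q : valid_code s.1 ->
  qtrace K (qlist K m) s = Some (p, q) ->
  wave_trace (qsphere K m) (cmx s.1) (zvec s.2) = (p%:R - q%:R) / 2 :> R.
Proof.
move=> vs.
have -> : wave_trace (qsphere K m) (cmx s.1) (zvec s.2) =
    \sum_(t <- [seq t <- qlist K m | qfixed K s.1 t])
    cos (2 * pi * ((qphase K s.2 t %% 12)%:R / 12)) :> R.
  rewrite /wave_trace /qsphere big_map [RHS]big_filter [RHS]big_mkcond /=.
  rewrite big_seq [RHS]big_seq; apply: eq_bigr => t; rewrite mem_filter => /andP[_ tc].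
  rewrite qfixedE // cos_phase //.
  by case: ifP; rewrite ?mul1r ?mul0r.
rewrite /qtrace.
elim: [seq t <- qlist K m | _] p q => [|t r IH] p q /=.
  by move=> [<- <-]; rewrite big_nil subrr mul0r.
case E : (foldr _ _ r) => [[p1 q1]|//].
case E' : twice_cos => [[p2 q2]|//] [<- <-].
by rewrite big_cons (IH _ _ E) (twice_cosP E') !natrD; field.
Qed.

End Numeric.

(** * Independence of the wave traces of the types *)

(** Squared lengths of lattice vectors for which the table of wave traces is
    nonsingular; they were found by computation. *)
Definition norms : seq nat := [:: 0; 1; 2; 3; 4; 5; 6; 7; 8; 9; 10; 11; 12; 14; 15; 16; 17]%N.

(** Twice the wave traces: one row for each entry of [norms] and one column for
    each entry of [canonical_types]. *)
Definition trace_table : seq (seq int) :=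
  ([:: [:: 2; 2; 2; 2; 2; 2; 2; 2; 2; 2; 2; 2; 2; 2; 2; 2; 2];
   [:: 16; 4; - 4; - 12; 0; - 8; 0; - 8; 4; - 4; 0; - 4; - 2; - 4; 0; 2; 0];
   [:: 48; - 8; - 8; 24; - 4; 12; - 8; 8; 0; 0; 0; 4; 0; 0; 0; 0; - 4];
   [:: 64; - 16; 16; - 16; 0; - 16; 0; 0; 0; 0; 0; - 8; 4; 0; 0; 0; 0];
   [:: 48; 12; 12; 12; - 8; 24; 8; 8; 0; 0; - 8; 4; - 6; 4; - 4; - 2; 0];
   [:: 96; 16; - 16; - 48; 0; - 16; 0; - 16; - 8; 8; 0; 0; 0; 0; 0; 0; 0];
   [:: 192; - 16; - 16; 48; 16; 16; 0; 0; 0; 0; 0; 8; 0; 0; 0; 0; 0];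
   [:: 128; 0; 0; 0; 0; - 32; 0; 0; 0; 0; 0; 0; - 4; 0; 0; 0; 0];
   [:: 48; 24; 24; 24; 12; 12; 8; 8; - 8; - 8; 8; 4; 0; 0; 0; 0; 4];
   [:: 208; 20; - 20; - 60; 0; - 24; 0; - 8; 4; - 4; 0; - 12; 4; - 4; 0; - 4; 0];
   [:: 288; - 16; - 16; 48; - 16; 48; - 16; 16; 0; 0; 0; 0; 0; 0; 0; 0; 0];
   [:: 192; - 48; 48; - 48; 0; - 16; 0; 0; 0; 0; 0; - 8; 0; 0; 0; 0; 0];
   [:: 192; 16; 16; 16; - 16; 48; 0; 0; 0; 0; 0; 8; 12; 0; 0; 0; 0];
   [:: 384; - 32; - 32; 96; 0; 0; 0; 0; 0; 0; 0; 0; 0; 0; 0; 0; 0];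
   [:: 384; 0; 0; 0; 0; - 32; 0; 0; 0; 0; 0; 0; 0; 0; 0; 0; 0];
   [:: 48; 12; 12; 12; 24; 24; 8; 8; 8; 8; 8; 4; - 6; 4; 4; - 2; 0];
   [:: 288; 32; - 32; - 96; 0; - 32; 0; - 16; 8; - 8; 0; - 8; 0; 0; 0; 0; 0]])%R.

Definition trace_check (l : seq (seq nat)) (row : seq int) : bool :=
  all2 (fun s e => if qtrace 4 l s is Some (p, q) then (p%:Z - q%:Z)%R == e else false)
    canonical_types row.

Lemma trace_tableP : all2 (fun m row => trace_check (qlist 4 m) row) norms trace_table.
Proof. by vm_compute. Qed.

(** The inverse of [trace_table], each row scaled to integers: the combination
    of the rows of [trace_table] with the [i]-th row of coefficients is
    supported on column [i]. *)
Definition elimination_table : seq (seq int) :=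
  ([:: [:: 16; 8; 12; 14; 8; 8; 10; 32; 4; 8; 2; 2; 6; 1; - 22; 0; 0];
   [:: 256; 128; 192; 420; 128; 128; 209; 855; 64; 128; 32; - 66; 145; - 33; - 646; 0; 0];
   [:: 256; 128; 192; 469; 128; 128; 258; 1051; 64; 128; 32; - 17; 194; - 33; - 793; 0; 0];
   [:: 128; 64; 96; 259; 64; 64; 129; 550; 32; 64; 16; - 33; 97; 8; - 421; 0; 0];
   [:: 128; 64; 96; 259; 64; 64; 178; 403; 32; 64; 16; - 33; 48; - 41; - 323; 0; 0];
   [:: 64; 32; 48; 56; 32; 32; 40; 128; 16; 32; 8; 8; 24; 4; - 137; 0; 0];
   [:: - 128; - 64; - 96; - 553; - 64; - 113; - 325; - 1138; - 32; - 64; - 114; 82; - 195; 90; 813; 0; - 49];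
   [:: - 32; - 16; - 24; - 70; - 16; - 23; - 41; - 169; - 8; - 16; - 4; 3; - 33; - 2; 135; 0; - 7];
   [:: - 256; - 72; - 192; - 231; - 100; - 114; - 146; - 589; - 64; - 128; - 4; - 11; - 82; - 9; 499; 28; 14];
   [:: - 256; - 72; - 192; - 259; - 100; - 86; - 174; - 701; - 64; - 128; - 4; - 11; - 110; - 9; 583; 28; - 14];
   [:: - 320; - 104; - 212; - 322; - 132; - 118; - 214; - 794; - 52; - 160; - 12; 2; - 120; 8; 643; 28; 14];
   [:: - 192; - 96; - 144; - 315; - 96; - 96; - 120; - 531; - 48; - 96; - 24; 25; - 72; - 12; 460; 0; 0];
   [:: - 128; - 64; - 96; - 112; - 64; - 64; - 80; - 403; - 32; - 64; - 16; - 16; - 48; - 8; 323; 0; 0];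
   [:: 1600; 16; 1200; 3213; 800; 800; 1490; 6483; 400; 408; 200; - 241; 1090; 100; - 5287; 0; 588];
   [:: 5760; 1704; 3928; 5187; 2096; 2096; 3404; 14019; 1048; 2880; 132; 181; 2160; 115; - 11497; - 392; - 196];
   [:: - 128; 34; - 96; - 210; - 64; - 64; - 178; - 795; - 32; - 162; - 16; - 16; - 146; - 8; 617; 0; 0];
   [:: - 576; - 288; - 824; - 651; - 288; - 288; - 262; - 1299; - 144; - 288; 124; - 23; - 216; - 85; 1184; 0; 0]])%R.

Definition combination (c : seq int) (j : nat) : int :=
  \sum_(cr <- zip c trace_table) cr.1 * nth 0 cr.2 j.

Lemma elimination_tableP i : (i < 17)%N ->
  combination (nth [::] elimination_table i) i != 0 /\
  forall j, (j < 17)%N -> j != i -> combination (nth [::] elimination_table i) j = 0.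
Proof.
(* A version of [combination] that evaluates: big operators are opaque. *)
pose f c j : int := foldr (fun cr s => cr.1 * nth 0 cr.2 j + s) 0 (zip c trace_table).
have fE c j : combination c j = f c j.
  by rewrite /combination /f; elim: zip => [|cr s IH]; rewrite ?big_nil ?big_cons ?IH.
have : all (fun i => (f (nth [::] elimination_table i) i != 0) &&
    all (fun j => (j == i) || (f (nth [::] elimination_table i) j == 0)) (iota 0 17))
  (iota 0 17) by vm_compute.
move=> /allP H i17; have /H /andP[ii /allP ij] : i \in iota 0 17 by rewrite mem_iota.
split=> [|j j17 ji]; first by rewrite fE.
have /ij : j \in iota 0 17 by rewrite mem_iota.
by rewrite (negPf ji) fE => /eqP.
Qed.

Definition row_eval (R : realType) (x : nat -> R) (row : seq int) : R :=
  \sum_(0 <= i < 17) x i * (nth 0%R row i)%:~R.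

Lemma row_eval_combination (R : realType) (x : nat -> R) (c : seq int) :
  \sum_(cr <- zip c trace_table) cr.1%:~R * row_eval x cr.2 =
  \sum_(0 <= j < 17) x j * (combination c j)%:~R.
Proof.
under eq_bigr do rewrite /row_eval mulr_sumr; rewrite exchange_big /=.
apply: eq_bigr => j _; rewrite /combination rmorph_sum mulr_sumr.
by apply: eq_bigr => cr _; rewrite rmorphM mulrCA.
Qed.

Lemma trace_table_independent (R : realType) (x : nat -> R) :
  (forall row, row \in trace_table -> row_eval x row = 0) ->
  forall i, (i < 17)%N -> x i = 0.
Proof.
move=> H i i17; have [ii ij] := elimination_tableP i17.
have := row_eval_combination x (nth [::] elimination_table i).
rewrite big_seq big1 => [/esym|cr crz].
  rewrite big_mkord (bigD1 (Ordinal i17)) //= big1 ?addr0 => [/eqP|j ji].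
    by rewrite mulf_eq0 intr_eq0 (negPf ii) orbF => /eqP.
  by rewrite ij ?mulr0.
rewrite H ?mulr0 //; move: (nth _ _ _) trace_table crz => c T; clear.
by elim: c T => [|b c IH] [|r T] //=; rewrite !inE => /orP[/eqP->|/IH ->];
  rewrite ?eqxx ?orbT.
Qed.

(** * Isospectral on functions implies isospectral on forms *)

Section Spectrum.
Context {R : realType}.
Local Notation V := 'rV[R]_4.

Definition type_of (i : nat) : spcode * seq nat := nth (id_code, [::]) canonical_types i.

Definition type_wave (S : seq V) (i : nat) : R :=
  wave_trace S (cmx (type_of i).1) (zvec (type_of i).2).

Definition type_ext (p i : nat) : R := ext_trace p (cmx (type_of i).1).

Lemma type_valid i : (i < 17)%N -> valid_code (type_of i).1.
Proof.
move=> i17; have : all (fun s => valid_code s.1) canonical_types by [].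
by move=> /allP; apply; apply: mem_nth.
Qed.

Lemma ext_trace0 (B : 'M[R]_4) : ext_trace 0 B = 1.
Proof.
have E (s : 'S_0) : (-1) ^+ s * (\sum_(g : {ffun 'I_0 -> 'I_4}) \prod_i B (g (s i)) (g i)) = 1.
  have -> : s = 1%g by apply/permP => -[].
  rewrite odd_perm1 expr0 mul1r (eq_bigr (fun=> 1)) => [|g _]; last by rewrite big_ord0.
  by rewrite sumr_const card_ffun !card_ord expn0.
rewrite /ext_trace fact0 invr1 mul1r (eq_bigr _ (fun s _ => E s)) sumr_const.
rewrite (_ : #|_| = 1%N) // -[RHS](card_Sn 0); apply: eq_card => s; by rewrite !inE.
Qed.

Lemma frequency_sphere (N : R) (S : seq V) : sphere N S ->
  forall u, u \in S <-> frequency (4 * pi ^+ 2 * N) u.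
Proof.
move=> [_ SN] u; rewrite SN /frequency.
have p0 : 4 * pi ^+ 2 != 0 :> R.
  by rewrite mulf_neq0 ?pnatr_eq0 // expf_neq0 // gt_eqF ?pi_gt0.
by split=> -[ui uN]; split => //; [rewrite uN|apply: (mulfI p0)].
Qed.

(** If no wave has the eigenvalue [l], an empty sphere is taken. *)
Lemma eigenvalue_sphere (l : R) : exists N (S : seq V), l = 4 * pi ^+ 2 * N /\ sphere N S.
Proof.
have p0 : 4 * pi ^+ 2 != 0 :> R.
  by rewrite mulf_neq0 ?pnatr_eq0 // expf_neq0 // gt_eqF ?pi_gt0.
have [[u [ui ul]]|H] := pselect (exists u : V, frequency l u); last first.
  exists (l / (4 * pi ^+ 2)), [::]; split; first by rewrite mulrCA divff ?mulr1.
  split=> // u; split => // -[ui uN]; case: H; exists u; split => //.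
  by rewrite uN mulrCA divff ?mulr1.
have : dot u u \is a Num.nat.
  rewrite natrEint lattice_dot //=.
  by apply: sumr_ge0 => i _; rewrite -expr2 sqr_ge0.
move=> /natrP[m mE]; exists m%:R, (qsphere m m); split; first by rewrite -ul mE.
by apply: qsphereP; rewrite -mulnn; lia.
Qed.

(** The sum in [holonomy_formula] is sorted by the type of the group element,
    which determines both traces; [y i] is the proportion of elements of the
    type [i] in the holonomy group. It depends neither on the degree nor on
    the eigenvalue. *)
Lemma type_expansion (G : isom_group R 4) : torsion_free G ->
  translation_lattice G = canonical_lattice R 4 ->
  exists y : nat -> R, forall (p : nat) (N : R) (S : seq V), sphere N S ->
    (exists k, has_dim (@eigenforms R 4 p G (4 * pi ^+ 2 * N)) k) /\
    forall k, has_dim (@eigenforms R 4 p G (4 * pi ^+ 2 * N)) k <->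
      k%:R = \sum_(0 <= i < 17) y i * (type_wave S i * type_ext p i).
Proof.
move=> tf tG; have [H [B [b [H_pos bG HF]]]] := holonomy_formula tG.
have cG := crystal_isom_group tf tG.
have /choice[ty tyP] : forall h : H, exists i : 'I_17, aff_similar (sp_mx (B h)) (b h)
    (cmx (type_of i).1) (zvec (type_of i).2).
  move=> h; have [s sc sim] := crystal_type cG (bG h) (sp_mx_orth tG (bG h)).
  have s17 : (index s canonical_types < 17)%N by have := sc; rewrite -index_mem.
  by exists (Ordinal s17); rewrite /type_of /= nth_index.
exists (fun i => (#|H|%:R)^-1 * \sum_(h | ty h == i :> nat) 1) => p N S sS.
have [ex dim] := HF p (4 * pi ^+ 2 * N) S sS.1 (frequency_sphere sS).
split => // k; rewrite dim; suff -> : \sum_h wave_trace S (sp_mx (B h)) (b h) *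
    ext_trace p (sp_mx (B h)) =
  \sum_(0 <= i < 17) (\sum_(h | ty h == i :> nat) 1) * (type_wave S i * type_ext p i).
  by rewrite mulr_sumr (eq_bigr _ (fun i _ => mulrA _ _ _)).
rewrite big_mkord (partition_big ty xpredT) //=; apply: eq_bigr => i _.
rewrite mulr_suml; apply: eq_big => [h|h /eqP hi]; first by [].
rewrite mul1r /type_wave /type_ext -hi (ext_trace_similar p (tyP h)).
have vh := type_valid (ltn_ord (ty h)).
by rewrite (wave_trace_similar sS (valid_integral_orthogonal vh).1 (tyP h)).
Qed.

Lemma type_wave_table m row i : (m, row) \in zip norms trace_table -> (i < 17)%N ->
  type_wave (qsphere 4 m) i = (nth 0 row i)%:~R / 2.
Proof.
move=> mr i17; have := trace_tableP; rewrite all2E => /andP[_ /allP /(_ _ mr)] /=.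
rewrite /trace_check all2E => /andP[/eqP sr /allP H].
have zi : (type_of i, nth 0 row i) \in zip canonical_types row.
  have -> : (type_of i, nth 0 row i) = nth (id_code, [::], 0) (zip canonical_types row) i.
    by rewrite nth_zip.
  by apply: mem_nth; rewrite size_zip -sr minnn.
have := H _ zi => /=; case E : qtrace => [[a c]|//] /eqP <-.
by rewrite /type_wave (qtraceP (type_valid i17) E) rmorphB.
Qed.

End Spectrum.

Theorem corollary4p2 (R : realType) (G G' : isom_group R 4)
    (hG : bieberbach G) (hG' : bieberbach G')
    (tG : translation_lattice G = canonical_lattice R 4)
    (tG' : translation_lattice G' = canonical_lattice R 4) :
  isospectral G G' <-> (forall p : nat, (p <= 4)%N -> p_isospectral p G G').
Proof.
split=> [iso p _|]; last exact.
have [tf _ _] := hG; have [tf' _ _] := hG'.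
have [y yP] := type_expansion tf tG; have [y' yP'] := type_expansion tf' tG'.
(* In degree 0 the exterior trace is 1, so equality of the multiplicities of
   the eigenvalue for squared length [m] says that [y - y'] is orthogonal to
   the row of [m] in the table. *)
have yy' i : (i < 17)%N -> y i = y' i.
  move=> i17; apply/eqP; rewrite -subr_eq0; apply/eqP.
  apply: (@trace_table_independent _ (fun i => y i - y' i)) i17 => row rt.
  have [m mr] : exists m, (m, row) \in zip norms trace_table.
    have sz : size norms = size trace_table by [].
    exists (nth 0%N norms (index row trace_table)).
    rewrite -{2}(nth_index [::] rt) -nth_zip //; apply: mem_nth.
    by rewrite size_zip sz minnn index_mem.
  (* The vectors of squared length below 25 have coordinates at most 4. *)
  have mK : (m < 5 ^ 2)%N.
    have : m \in norms by move/(map_f fst): mr; rewrite -/(unzip1 _) unzip1_zip.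
    by move: m {mr}; apply/allP.
  have sS := @qsphereP R 4 m mK.
  have [[k dk] dim] := yP 0%N _ _ sS.
  have [_ dim'] := yP' 0%N _ _ sS.
  have /dim'/esym e' := (iso (4 * pi ^+ 2 * m%:R) k).1 dk.
  have e : \sum_(0 <= i < 17) y i * (type_wave (qsphere 4 m) i * type_ext 0 i) = k%:R :> R.
    by apply/esym/dim.
  have : \sum_(0 <= i < 17) (y i - y' i) * (type_wave (qsphere 4 m) i * type_ext 0 i) = 0 :> R.
    under eq_bigr do rewrite mulrBl.
    by rewrite sumrB e e' subrr.
  rewrite (eq_big_nat _ _ (F2 := fun i => 2^-1 * ((y i - y' i) * (nth 0 row i)%:~R))).
    rewrite -mulr_sumr => /eqP; rewrite mulf_eq0 invr_eq0 pnatr_eq0 /= => /eqP.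
    by rewrite /row_eval.
  move=> j /andP[_ j17]; rewrite (type_wave_table mr j17) /type_ext ext_trace0; ring.
have expand S : \sum_(0 <= i < 17) y i * (type_wave S i * type_ext p i) =
    \sum_(0 <= i < 17) y' i * (type_wave S i * type_ext p i) :> R.
  by apply: eq_big_nat => i /andP[_ i17]; rewrite yy'.
move=> l k; have [N [S [-> sS]]] := eigenvalue_sphere l.
have [_ ->] := yP p N S sS; have [_ ->] := yP' p N S sS.
by rewrite expand.
Qed.
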